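(* Let $\mathfrak g$ be an affine Kac–Moody algebra of type $B_n^{(1)}$, $C_n^{(1)}$, $D_n^{(1)}$, $A_{2n}^{(2)}$, $A_{2n}^{(2)\dagger}$, $A_{2n-1}^{(2)}$ or $D_{n+1}^{(2)}$, with associated pair $(\diamondsuit_0,\diamondsuit_n)$. (1) If $\diamondsuit_0,\diamondsuit_n\ne(2)$, then $\Lambda(V)$ is a finite-dimensional semisimple $U'_q(\mathfrak g)$-module with a polarizable crystal base $(L(\Lambda(V)),B(\Lambda(V)))$, with ${\rm wt}(|0\rangle)={\rm cl}(\varpi_n)$. (2) $\Lambda(V)^{\otimes2}$ is a finite-dimensional semisimple $U'_q(\mathfrak g)$-module with a polarizable crystal base $(L(\Lambda(V))^{\otimes2},B(\Lambda(V))^{\otimes2})$, with $${\rm wt}(|0\rangle\otimes|0\rangle)=\begin{cases}2\,{\rm cl}(\varpi_n)&\text{if }\diamondsuit_0,\diamondsuit_n\neq(2),\\ {\rm cl}(\varpi_n)&\text{if }\diamondsuit_0=(2)\text{ or }\diamondsuit_n=(2).\end{cases}$$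
   Context: **Types.** $\mathfrak g$ has index set $I=\{0,1,\dots,n\}$, Cartan matrix $(a_{ij})$, simple roots $\alpha_i$, simple coroots $h_i$, fundamental weights $\Lambda_i$, null root $\delta=\sum a_i\alpha_i$, canonical central element $c=\sum a_i^\vee h_i$, weight lattice $P$; ${\rm cl}$ is reduction of weights modulo $\mathbb Q\delta$, $P_{\rm cl}={\rm cl}(P)$. The pair $(\diamondsuit_0,\diamondsuit_n)$ records how the end nodes are attached to the rest of the diagram (arrows point to the shorter root): $\diamondsuit_n=(1)$: $(n-1)\Rightarrow n$; $\diamondsuit_n=(2)$: $(n-1)\Leftarrow n$; $\diamondsuit_n=(1,1)$: $n$ joined to $n-2$ by a simple edge; $\diamondsuit_0=(1)$: $0\Leftarrow1$; $\diamondsuit_0=(2)$: $0\Rightarrow1$; $\diamondsuit_0=(1,1)$: $0$ joined to $2$ by a simple edge; nodes $1,\dots,n-1$ form a diagram $A_{n-1}$. The types are: $B_n^{(1)}$ ($n\ge3$): $((1,1),(1))$; $C_n^{(1)}$ ($n\ge2$): $((2),(2))$; $D_n^{(1)}$ ($n\ge4$): $((1,1),(1,1))$; $A_{2n}^{(2)}$ ($n\ge2$): $((1),(2))$; $A_{2n}^{(2)\dagger}$ ($n\ge2$): $((2),(1))$; $A_{2n-1}^{(2)}$ ($n\ge3$): $((1,1),(2))$; $D_{n+1}^{(2)}$ ($n\ge2$): $((1),(1))$. $\varpi_n=\Lambda_n-a_n^\vee\Lambda_0$, except $\varpi_n=2\Lambda_n-\Lambda_0$ for $A_{2n}^{(2)\dagger}$.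 The invariant form satisfies $(\alpha_i,\alpha_j)=a_i^\vee a_i^{-1}a_{ij}$; $q_i=q^{(\alpha_i,\alpha_i)/2}$, $t_i=q^{(\alpha_i,\alpha_i)h_i/2}$; $d$ is the least positive integer with all $(\alpha_i,\alpha_i)/2\in\frac1d\mathbb Z$; $q_s=q^{1/d}$, $K=\mathbb Q(q_s)$; $\mathbb A\subset K$ is the ring of rational functions regular at $q_s=0$. $U'_q(\mathfrak g)$ is the quantum affine algebra without derivation over $K$ (generators $e_i,f_i,q^h$, weights in $P_{\rm cl}$), with $\Delta(q^h)=q^h\otimes q^h$, $\Delta(e_i)=e_i\otimes t_i^{-1}+1\otimes e_i$, $\Delta(f_i)=f_i\otimes1+t_i\otimes f_i$. **$q$-deformed Clifford algebra and $\Lambda(V)$.** Put $p=q_1$ ($p=q^{1/2}$ for $C_n^{(1)}$, $p=q^2$ for $D_{n+1}^{(2)}$, $p=q$ otherwise). For the ordered set $\bar n<\cdots<\bar1$, the $q$-deformed Clifford algebra (with parameter $p$) is the $K$-algebra generated by $\psi_a,\psi_a^*,\omega_a^{\pm1}$ ($a\in\{\bar n,\dots,\bar1\}$) with relations: the $\omega_a$ commute; $\omega_a\psi_b\omega_a^{-1}=p^{\delta_{ab}}\psi_b$; $\omega_a\psi^*_b\omega_a^{-1}=p^{-\delta_{ab}}\psi^*_b$; $\psi_a\psi_b+\psi_b\psi_a=0=\psi^*_a\psi^*_b+\psi^*_b\psi^*_a$; $\psi_a\psi^*_b+\psi^*_b\psi_a=0$ ($a\ne b$); $\psi_a\psi_a^*=\frac{p\omega_a-p^{-1}\omega_a^{-1}}{p-p^{-1}}$;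 $\psi_a^*\psi_a=-\frac{\omega_a-\omega_a^{-1}}{p-p^{-1}}$. $\Lambda(V)$ is its left module generated by $|0\rangle$ with $\psi_a^*|0\rangle=0$, $\omega_a|0\rangle=p^{-1}|0\rangle$; it has $K$-basis $\psi_{\mathbf m}|0\rangle=\psi_{\bar n}^{m_{\bar n}}\cdots\psi_{\bar1}^{m_{\bar1}}|0\rangle$, $\mathbf m=(m_a)\in\mathbf B=\{0,1\}^n$. $L(\Lambda(V))=\sum_{\mathbf m}\mathbb A\,\psi_{\mathbf m}|0\rangle$, and $B(\Lambda(V))$ is the set of residues of the $\psi_{\mathbf m}|0\rangle$ modulo $q_sL(\Lambda(V))$. **Action.** (That it gives $U'_q(\mathfrak g)$-module structures is part of the claim.) On $\Lambda(V)$: for $1\le i\le n-1$, $t_i\mapsto\omega_{\overline{i+1}}\omega_{\bar i}^{-1}$, $e_i\mapsto\psi_{\overline{i+1}}\psi^*_{\bar i}$, $f_i\mapsto\psi^*_{\overline{i+1}}\psi_{\bar i}$; if $\diamondsuit_0=(1)$: $t_0\mapsto q_0\omega_{\bar1}$, $e_0\mapsto\psi_{\bar1}$, $f_0\mapsto\psi^*_{\bar1}$; if $\diamondsuit_0=(1,1)$: $t_0\mapsto q_0\omega_{\bar1}\omega_{\bar2}$, $e_0\mapsto\psi_{\bar1}\psi_{\bar2}$, $f_0\mapsto\psi^*_{\bar2}\psi^*_{\bar1}$; if $\diamondsuit_n=(1)$: $t_n\mapsto q_n^{-1}\omega_{\bar n}^{-1}$, $e_n\mapsto\psi^*_{\bar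 n}$, $f_n\mapsto\psi_{\bar n}$; if $\diamondsuit_n=(1,1)$: $t_n\mapsto q_n^{-1}(\omega_{\bar n}\omega_{\overline{n-1}})^{-1}$, $e_n\mapsto\psi^*_{\bar n}\psi^*_{\overline{n-1}}$, $f_n\mapsto\psi_{\overline{n-1}}\psi_{\bar n}$. These act on $\Lambda(V)^{\otimes2}$ through $\Delta$. If $\diamondsuit_0=(2)$, then on $\Lambda(V)^{\otimes2}$: $t_0\mapsto q_0\,\omega_{\bar1}^2\otimes\omega_{\bar1}^2$, $e_0\mapsto\psi_{\bar1}\otimes\psi_{\bar1}$, $f_0\mapsto\psi^*_{\bar1}\otimes\psi^*_{\bar1}$; if $\diamondsuit_n=(2)$: $t_n\mapsto q_n^{-1}\omega_{\bar n}^{-2}\otimes\omega_{\bar n}^{-2}$, $e_n\mapsto\psi^*_{\bar n}\otimes\psi^*_{\bar n}$, $f_n\mapsto\psi_{\bar n}\otimes\psi_{\bar n}$. **Crystal bases.** For a weight vector $u=\sum_rf_i^{(r)}u_r$ with $e_iu_r=0$ (divided powers), $\tilde e_iu=\sum_{r\ge1}f_i^{(r-1)}u_r$, $\tilde f_iu=\sum_{r\ge0}f_i^{(r+1)}u_r$. $(L,B)$ is a crystal base of an integrable module $M$ with finite-dimensional weight spaces if $L$ is an $\mathbb A$-lattice of $M$ compatible with the weight decomposition and stable under all $\tilde e_i,\tilde f_i$; $B$ is a $\mathbb Q$-basis of $L/q_sL$ compatible with weights, $\tilde e_iB,\tilde f_iB\subset B\sqcup\{0\}$, and $\tilde f_ib=b'\iff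 b=\tilde e_ib'$ for $b,b'\in B$. A polarization is a symmetric bilinear form on $M$ with $(xu,v)=(u,\eta(x)v)$, where $\eta$ is the anti-automorphism $\eta(q^h)=q^h$, $\eta(e_i)=q_i^{-1}t_i^{-1}f_i$, $\eta(f_i)=q_i^{-1}t_ie_i$. $(L,B)$ is polarizable if for some polarization $(L,L)\subset\mathbb A$ and $B$ is orthonormal (up to multiplication by $\pm1$) for the induced $\mathbb Q$-form on $L/q_sL$.
   Formalization: In the action formulas ψ_a, ψ*_a are replaced by the same operators without their sign (−1)^{#occupied b<a} on ψ_m|0⟩; with the displayed formulas [e_i,f_i] (1≤i≤n−1) has the wrong sign, so they give no U'_q(g)-module for any type. *)

(* Defs.v *)
From HB Require Import structures.
From mathcomp Require Import all_boot all_order all_algebra.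
From mathcomp Require Import ring.

Set Implicit Arguments.
Unset Strict Implicit.
Unset Printing Implicit Defensive.

Import Order.TTheory GRing.Theory Num.Theory.
Local Open Scope ring_scope.

(* TypeB = B_n^(1), TypeC = C_n^(1), TypeD = D_n^(1), TypeAeven = A_{2n}^(2),
   TypeAdagger = A_{2n}^(2)dagger, TypeAodd = A_{2n-1}^(2),
   TypeDtw = D_{n+1}^(2). *)
Inductive affine_type :=
  TypeB | TypeC | TypeD | TypeAeven | TypeAdagger | TypeAodd | TypeDtw.

Inductive diamond := Dia1 | Dia2 | Dia11.

Definition diamond0 (t : affine_type) : diamond :=
  match t with
  | TypeB | TypeD | TypeAodd => Dia11
  | TypeC | TypeAdagger => Dia2
  | TypeAeven | TypeDtw => Dia1
  end.

Definition diamondn (t : affine_type) : diamond :=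
  match t with
  | TypeB | TypeAdagger | TypeDtw => Dia1
  | TypeC | TypeAeven | TypeAodd => Dia2
  | TypeD => Dia11
  end.

Definition is_dia2 (x : diamond) : bool := if x is Dia2 then true else false.

Definition min_rank (t : affine_type) : nat :=
  match t with
  | TypeB | TypeAodd => 3%N
  | TypeD => 4%N
  | _ => 2%N
  end.

(* The entry a_{0j}, resp. a_{j0}, for j != 0, read off the diagram: an arrow
   points to the shorter root, and if alpha_i is the shorter of two roots
   joined by an arrow then a_ij = -2 and a_ji = -1. *)
Definition row0 (x : diamond) (j : nat) : int :=
  match x with
  | Dia1 => if j == 1%N then - 2%:Z else 0
  | Dia2 => if j == 1%N then - 1%:Z else 0
  | Dia11 => if j == 2%N then - 1%:Z else 0
  end.

Definition col0 (x : diamond) (j : nat) : int :=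
  match x with
  | Dia1 => if j == 1%N then - 1%:Z else 0
  | Dia2 => if j == 1%N then - 2%:Z else 0
  | Dia11 => if j == 2%N then - 1%:Z else 0
  end.

Definition swap_end (n j : nat) : nat := (n - j)%N.

(* Node n is attached to n-1, n-2 in the way node 0 is attached to 1, 2: in
   both cases (1) makes the end root the shorter one and (2) the longer one. *)
Definition cartan (t : affine_type) (n i j : nat) : int :=
  if i == j then 2
  else if i == 0%N then (if j == n then 0 else row0 (diamond0 t) j)
  else if j == 0%N then (if i == n then 0 else col0 (diamond0 t) i)
  else if i == n then row0 (diamondn t) (swap_end n j)
  else if j == n then col0 (diamondn t) (swap_end n i)
  else if (i == j.+1) || (j == i.+1) then - 1%:Z else 0.

(* a_i and a_i^vee: the coprime positive integers such that
   sum_j a_ij a_j = 0 for all i and sum_i a_i^vee a_ij = 0 for all j. *)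
Definition mark (t : affine_type) (n i : nat) : nat :=
  match t with
  | TypeB => if (i <= 1)%N then 1%N else 2%N
  | TypeC => if (i == 0%N) || (i == n) then 1%N else 2%N
  | TypeD => if (i <= 1)%N || (n.-1 <= i)%N then 1%N else 2%N
  | TypeAeven => if i == n then 1%N else 2%N
  | TypeAdagger => if i == 0%N then 1%N else 2%N
  | TypeAodd => if (i <= 1)%N || (i == n) then 1%N else 2%N
  | TypeDtw => 1%N
  end.

Definition comark (t : affine_type) (n i : nat) : nat :=
  match t with
  | TypeB => if (i <= 1)%N || (i == n) then 1%N else 2%N
  | TypeC => 1%N
  | TypeD => if (i <= 1)%N || (n.-1 <= i)%N then 1%N else 2%N
  | TypeAeven => if i == 0%N then 1%N else 2%N
  | TypeAdagger => if i == n then 1%N else 2%N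
  | TypeAodd => if (i <= 1)%N then 1%N else 2%N
  | TypeDtw => if (i == 0%N) || (i == n) then 1%N else 2%N
  end.

(* (alpha_i, alpha_i) / 2 = a_i^vee / a_i, so d is the least common multiple of
   the denominators a_i / gcd (a_i, a_i^vee); see [dlcm_min]. *)
Definition dlcm (t : affine_type) (n : nat) : nat :=
  \big[lcmn/1%N]_(i < n.+1)
    (mark t n i %/ gcdn (mark t n i) (comark t n i))%N.

(* d (alpha_i, alpha_i) / 2; the division is exact, see [dnorm_exact]. *)
Definition dnorm (t : affine_type) (n i : nat) : nat :=
  (dlcm t n * comark t n i %/ mark t n i)%N.

Lemma mark_gt0 t n i : (0 < mark t n i)%N.
Proof. by case: t => //=; case: ifP. Qed.

Lemma dnorm_exact t n i : (i <= n)%N ->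
  (dnorm t n i * mark t n i = dlcm t n * comark t n i)%N.
Proof.
move=> le_in; apply: divnK; set a := mark t n i; set b := comark t n i.
have g_gt0 : (0 < gcdn a b)%N by rewrite gcdn_gt0 mark_gt0.
have /dvdn_trans dv : (a %/ gcdn a b %| dlcm t n)%N.
  rewrite /dlcm (bigD1 (Ordinal (le_in : (i < n.+1)%N))) //=.
  exact: dvdn_lcml.
rewrite -{1}(divnK (dvdn_gcdl a b)) dvdn_mul ?dvdn_gcdr //.
exact: dv.
Qed.

Lemma dlcm_min t n d' : (0 < d')%N ->
  (forall i, (i <= n)%N -> mark t n i %| d' * comark t n i)%N ->
  (dlcm t n <= d')%N.
Proof.
move=> d'_gt0 dv; apply: dvdn_leq => //.
apply/dvdn_biglcmP => i _; have {dv} := dv i (ltn_ord i : (i <= n)%N).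
set a := mark t n i; set b := comark t n i => dv.
have g_gt0 : (0 < gcdn a b)%N by rewrite gcdn_gt0 mark_gt0.
rewrite -(@Gauss_dvdl _ _ (b %/ gcdn a b)); last first.
  rewrite /coprime -(eqn_pmul2r g_gt0) mul1n muln_gcdl.
  by rewrite !divnK ?dvdn_gcdl ?dvdn_gcdr.
rewrite -(dvdn_pmul2r g_gt0) -mulnA !divnK ?dvdn_gcdl ?dvdn_gcdr //.
Qed.

(* Q(q_s), where q_s is the variable; q = q_s^d. *)
Notation Qqs := {fraction {poly rat}}.

Definition qs : Qqs := tofrac ('X : {poly rat}).

Definition ratc (c : rat) : Qqs := tofrac (c%:P : {poly rat}).

(* The ring A of rational functions regular at q_s = 0. *)
Definition regular0 (x : Qqs) : Prop :=
  exists u v : {poly rat}, v.[0] != 0 /\ x = tofrac u / tofrac v.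

(* Everything that does not involve A is written over an arbitrary field K,
   whose element q plays the role of q_s. *)
Definition qi (K : fieldType) (q : K) (t : affine_type) (n i : nat) : K :=
  q ^+ dnorm t n i.

Definition qint (K : fieldType) (x : K) (r : nat) : K :=
  (x ^+ r - x ^- r) / (x - x^-1).

Definition qfact (K : fieldType) (x : K) (r : nat) : K :=
  \prod_(1%N <= s < r.+1) qint x s.

(* P_cl = Hom (sum_i Z h_i, Z): mu is stored as its values <h_i, mu>. *)
Definition weight (n : nat) := {ffun 'I_n.+1 -> int}.

(* k stands for h = d^-1 sum_i k_i h_i; elements of this lattice index the
   generators q^h, and t_i = q^((alpha_i, alpha_i) h_i / 2) is one of them. *)
Definition coweight (n : nat) := {ffun 'I_n.+1 -> int}.

(* q^<h, mu> = q_s^(sum_i k_i <h_i, mu>) *)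
Definition qpair (K : fieldType) (q : K) n (h : coweight n) (mu : weight n) : K :=
  q ^ (\sum_i h i * mu i).

Definition cl_root (t : affine_type) n (j : 'I_n.+1) : weight n :=
  [ffun i : 'I_n.+1 => cartan t n i j].

Definition cl_fund n (i : 'I_n.+1) : weight n :=
  [ffun j : 'I_n.+1 => (j == i)%:Z].

Definition varpin (t : affine_type) (n : nat) : weight n :=
  match t with
  | TypeAdagger => cl_fund ord_max *+ 2 - cl_fund ord0
  | _ => cl_fund ord_max - cl_fund ord0 *+ comark t n n
  end.

Definition tco (t : affine_type) n (i : 'I_n.+1) : coweight n :=
  [ffun j : 'I_n.+1 => if j == i then (dnorm t n i)%:Z else 0].

Definition divpow (K : fieldType) (q : K) (t : affine_type) n (i : 'I_n.+1) (M : vectType K)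
    (x : 'End(M)) (r : nat) (u : M) : M :=
  (qfact (qi q t n i) r)^-1 *: iter r x u.

(* sum_r (-1)^r x_i^(r) x_j x_i^(1 - a_ij - r) *)
Definition serre (K : fieldType) (q : K) (t : affine_type) n (i j : 'I_n.+1) (M : vectType K)
    (x : 'I_n.+1 -> 'End(M)) (u : M) : M :=
  let m := `|1 - cartan t n i j|%N in
  \sum_(r < m.+1)
    (-1) ^+ r *: divpow q t i (x i) r (x j (divpow q t i (x i) (m - r) u)).

Record uq_rep (K : fieldType) (q : K) (t : affine_type) (n : nat) (M : vectType K) := UqRep {
  uqh : coweight n -> 'End(M);
  ue : 'I_n.+1 -> 'End(M);
  uf : 'I_n.+1 -> 'End(M);
  uqh0 : uqh 0 = \1%VF;
  uqhD : forall h h', uqh (h + h') = (uqh h \o uqh h')%VF;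
  uqh_ue : forall h j u,
    uqh h (ue j u) = qpair q h (cl_root t j) *: ue j (uqh h u);
  uqh_uf : forall h j u,
    uqh h (uf j u) = (qpair q h (cl_root t j))^-1 *: uf j (uqh h u);
  ue_uf : forall i j u,
    ue i (uf j u) - uf j (ue i u) =
      if i == j then
        (qi q t n i - (qi q t n i)^-1)^-1 *: (uqh (tco t i) u - uqh (- tco t i) u)
      else 0;
  ue_serre : forall i j u, i != j -> serre q t i j ue u = 0;
  uf_serre : forall i j u, i != j -> serre q t i j uf u = 0 }.

Definition ut (K : fieldType) (q : K) t n (M : vectType K)
    (rho : uq_rep q t n M) (i : 'I_n.+1) : 'End(M) :=
  uqh rho (tco t i).
Definition utV (K : fieldType) (q : K) t n (M : vectType K)
    (rho : uq_rep q t n M) (i : 'I_n.+1) : 'End(M) :=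
  uqh rho (- tco t i).

Definition weight_vector (K : fieldType) (q : K) t n (M : vectType K)
    (rho : uq_rep q t n M) (mu : weight n) (u : M) :=
  forall h, uqh rho h u = qpair q h mu *: u.

(* L is the sum of the L_mu = L /\ M_mu; such a sum is direct because q_s is
   not a root of unity. *)
Definition weight_graded (K : fieldType) (q : K) t n (M : vectType K)
    (rho : uq_rep q t n M) (L : M -> Prop) : Prop :=
  forall u, L u -> exists (s : seq (weight n)) (w : weight n -> M),
    [/\ uniq s,
        forall mu, mu \in s -> L (w mu) /\ weight_vector rho mu (w mu)
      & u = \sum_(mu <- s) w mu].

Definition integrable (K : fieldType) (q : K) t n (M : vectType K)
    (rho : uq_rep q t n M) : Prop :=
  weight_graded rho (fun=> True) /\
  forall i u, exists r, iter r (ue rho i) u = 0 /\ iter r (uf rho i) u = 0.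

Definition submodule (K : fieldType) (q : K) t n (M : vectType K)
    (rho : uq_rep q t n M) (U : {vspace M}) : Prop :=
  forall u, u \in U ->
    (forall h, uqh rho h u \in U) /\
    (forall i, ue rho i u \in U /\ uf rho i u \in U).

Definition simple_submodule (K : fieldType) (q : K) t n (M : vectType K)
    (rho : uq_rep q t n M) (U : {vspace M}) : Prop :=
  [/\ submodule rho U, U <> 0%VS
    & forall W : {vspace M}, submodule rho W -> (W <= U)%VS ->
        W = 0%VS \/ W = U].

Definition semisimple (K : fieldType) (q : K) t n (M : vectType K)
    (rho : uq_rep q t n M) : Prop :=
  exists (k : nat) (U : 'I_k -> {vspace M}),
    [/\ forall j, simple_submodule rho (U j),
        directv (\sum_j U j) & (\sum_j U j)%VS = fullv].

(* u = sum_(r < N) f_i^(r) w_r with e_i w_r = 0.  The bound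
   r <= <h_i, wt w_r> for w_r != 0 is what makes the decomposition unique:
   without it 0 = f_i^(r) w_r with r = <h_i, wt w_r> + 1 would give two
   different values to the Kashiwara operator e~_i at 0. *)
Definition string_dec (K : fieldType) (q : K) t n (M : vectType K)
    (rho : uq_rep q t n M) (i : 'I_n.+1) (mu : weight n)
    (u : M) (N : nat) (w : nat -> M) : Prop :=
  (forall r, (r < N)%N ->
     let nu := mu + cl_root t i *+ r in
     [/\ ue rho i (w r) = 0, weight_vector rho nu (w r)
       & w r != 0 -> r%:Z <= nu i]) /\
  u = \sum_(r < N) divpow q t i (uf rho i) r (w r).

Definition kashiwara (K : fieldType) (q : K) t n (M : vectType K)
    (rho : uq_rep q t n M) (i : 'I_n.+1)
    (Et Ft : 'End(M)) : Prop :=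
  forall mu u, weight_vector rho mu u ->
    (exists N w, string_dec rho i mu u N w) /\
    (forall N w, string_dec rho i mu u N w ->
       Et u = \sum_(1%N <= r < N) divpow q t i (uf rho i) r.-1 (w r) /\
       Ft u = \sum_(0%N <= r < N) divpow q t i (uf rho i) r.+1 (w r)).

(* L = sum_j A e_j for a K-basis (e_j) of M *)
Definition lattice (M : vectType Qqs) (L : M -> Prop) : Prop :=
  exists e : (\dim {:M}).-tuple M, basis_of fullv e /\
    forall u, L u <-> exists c : 'I_(\dim {:M}) -> Qqs,
      (forall j, regular0 (c j)) /\ u = \sum_j c j *: e`_j.

(* u = v in L / q_s L *)
Definition congL (M : vectType Qqs) (L : M -> Prop) (u v : M) : Prop :=
  exists w, L w /\ u - v = qs *: w.

(* The set B of elements of L / q_s L is given by a family b of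
   representatives in L of its (distinct) elements. *)
Record crystal_base t n (M : vectType Qqs) (rho : uq_rep qs t n M)
    (L : M -> Prop) (X : finType) (b : X -> M) : Prop := CrystalBase {
  cb_integrable : integrable rho;
  cb_lattice : lattice L;
  cb_graded : weight_graded rho L;
  cb_in : forall x, L (b x);
  cb_span : forall u, L u ->
    exists c : X -> rat, congL L u (\sum_x ratc (c x) *: b x);
  cb_free : forall c : X -> rat,
    congL L (\sum_x ratc (c x) *: b x) 0 -> forall x, c x = 0;
  cb_weight : forall x, exists (mu : weight n) (v : M),
    [/\ L v, weight_vector rho mu v & congL L (b x) v];
  cb_kashiwara : forall i, exists Et Ft : 'End(M),
    [/\ kashiwara rho i Et Ft,
        forall u, L u -> L (Et u) /\ L (Ft u),
        forall x, congL L (Et (b x)) 0 \/ exists y, congL L (Et (b x)) (b y),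
        forall x, congL L (Ft (b x)) 0 \/ exists y, congL L (Ft (b x)) (b y)
      & forall x y, congL L (Ft (b x)) (b y) <-> congL L (b x) (Et (b y))] }.

(* The condition (x u, v) = (u, eta(x) v) is imposed on the generators, which
   is enough since eta is an anti-automorphism. *)
Record polarization (K : fieldType) (q : K) t n (M : vectType K)
    (rho : uq_rep q t n M)
    (form : M -> M -> K) : Prop := Polarization {
  pol_lin : forall a u v w, form (a *: u + v) w = a * form u w + form v w;
  pol_sym : forall u v, form u v = form v u;
  pol_qh : forall h u v, form (uqh rho h u) v = form u (uqh rho h v);
  pol_e : forall i u v,
    form (ue rho i u) v = form u ((qi q t n i)^-1 *: utV rho i (uf rho i v));
  pol_f : forall i u v,
    form (uf rho i u) v = form u ((qi q t n i)^-1 *: ut rho i (ue rho i v)) }.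

Definition polarizable t n (M : vectType Qqs) (rho : uq_rep qs t n M)
    (L : M -> Prop) (X : finType) (b : X -> M) : Prop :=
  exists form, [/\ polarization rho form,
    forall u v, L u -> L v -> regular0 (form u v)
  & forall x y, exists c,
      regular0 c /\ form (b x) (b y) - (x == y)%:R = qs * c].

(* The label a : nat with 1 <= a <= n stands for \bar a, so that
   \bar b < \bar a means a < b; values at other labels are irrelevant. *)
Definition label (n a : nat) : bool := (1 <= a <= n)%N.

Record clifford_rep (K : fieldType) (n : nat) (p : K) (M : vectType K) := CliffordRep {
  psi : nat -> 'End(M);
  psis : nat -> 'End(M);
  om : nat -> 'End(M);
  omV : nat -> 'End(M);
  om_omV : forall a u, label n a -> om a (omV a u) = u;
  omV_om : forall a u, label n a -> omV a (om a u) = u;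
  omC : forall a b u, label n a -> label n b -> om a (om b u) = om b (om a u);
  om_psi : forall a b u, label n a -> label n b ->
    om a (psi b (omV a u)) = p ^+ (a == b) *: psi b u;
  om_psis : forall a b u, label n a -> label n b ->
    om a (psis b (omV a u)) = p ^- (a == b) *: psis b u;
  psi_psi : forall a b u, label n a -> label n b ->
    psi a (psi b u) + psi b (psi a u) = 0;
  psis_psis : forall a b u, label n a -> label n b ->
    psis a (psis b u) + psis b (psis a u) = 0;
  psi_psis : forall a b u, label n a -> label n b -> a != b ->
    psi a (psis b u) + psis b (psi a u) = 0;
  psi_psis_diag : forall a u, label n a ->
    psi a (psis a u) = (p - p^-1)^-1 *: (p *: om a u - p^-1 *: omV a u);
  psis_psi_diag : forall a u, label n a ->
    psis a (psi a u) = - ((p - p^-1)^-1 *: (om a u - omV a u)) }.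

(* The index set {0,1}^n of the basis; m k is m_{\bar{k+1}}. *)
Definition mask (n : nat) := {ffun 'I_n -> bool}.

(* psi_m v = psi_{\bar n}^{m_{\bar n}} ... psi_{\bar 1}^{m_{\bar 1}} v *)
Definition psi_mono (K : fieldType) n (p : K) (M : vectType K)
    (C : clifford_rep n p M) (m : mask n) (v : M) : M :=
  foldl (fun u k => if m k then psi C k.+1 u else u) v (enum 'I_n).

Record fock_space (K : fieldType) (n : nat) (p : K) (M : vectType K) := FockSpace {
  fk_cliff :> clifford_rep n p M;
  vac : M;
  psis_vac : forall a, label n a -> psis fk_cliff a vac = 0;
  om_vac : forall a, label n a -> om fk_cliff a vac = p^-1 *: vac;
  fk_basis :
    basis_of fullv [seq psi_mono fk_cliff m vac | m : mask n] }.

Definition fockv (K : fieldType) n (p : K) (M : vectType K)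
    (F : fock_space n p M) (m : mask n) : M :=
  psi_mono F m (vac F).

Definition fock_lattice n p (M : vectType Qqs) (F : fock_space n p M) (u : M) :
    Prop :=
  exists c : mask n -> Qqs,
    (forall m, regular0 (c m)) /\ u = \sum_m c m *: fockv F m.

(* psi^*_b psi_b - psi_b psi^*_b multiplies psi_m|0> by (-1)^(m_b). *)
Definition parity (K : fieldType) n (p : K) (M : vectType K)
    (C : clifford_rep n p M) (b : nat) : 'End(M) :=
  ((psis C b \o psi C b) - (psi C b \o psis C b))%VF.

Definition parity_below (K : fieldType) n (p : K) (M : vectType K)
    (C : clifford_rep n p M) (a : nat) : 'End(M) :=
  foldr (fun b f => (parity C b \o f)%VF) \1%VF (index_iota a.+1 n.+1).

(* psi_a and psi^*_a stripped of the sign (-1)^(sum of the m_b, \bar b < \bar a)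
   with which they act on psi_m|0>, see [hpsi_fockv] and [hpsis_fockv].  The
   formulas for the action of U'_q(g) are to be read with these operators:
   with psi_a, psi^*_a themselves the commutator of psi_b psi^*_a and
   psi^*_b psi_a has the wrong sign ([clifford_comm_sign]). *)
Definition hpsi (K : fieldType) n (p : K) (M : vectType K)
    (C : clifford_rep n p M) (a : nat) : 'End(M) :=
  (parity_below C a \o psi C a)%VF.
Definition hpsis (K : fieldType) n (p : K) (M : vectType K)
    (C : clifford_rep n p M) (a : nat) : 'End(M) :=
  (parity_below C a \o psis C a)%VF.

Section Fock.
Variables (K : fieldType) (n : nat) (p : K) (M : vectType K).

Lemma clifford_comm_sign (C : clifford_rep n p M) a b u : p != 0 ->
  p - p^-1 != 0 -> label n a -> label n b -> a != b ->
  let t := (om C b \o omV C a)%VF in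
  let tV := (omV C b \o om C a)%VF in
  psi C b (psis C a (psis C b (psi C a u)))
  - psis C b (psi C a (psi C b (psis C a u)))
  = - ((p - p^-1)^-1 *: (t u - tV u)).
Proof.
move=> p0 pp la lb ab t tV.
have ba : b != a by rewrite eq_sym.
have E1 v : psis C a (psis C b v) = - psis C b (psis C a v).
  by apply/eqP; rewrite -addr_eq0 psis_psis.
have E2 v : psi C a (psi C b v) = - psi C b (psi C a v).
  by apply/eqP; rewrite -addr_eq0 psi_psi.
have VC x y v : label n x -> label n y ->
    om C x (omV C y v) = omV C y (om C x v).
  move=> lx ly; rewrite -[LHS](omV_om C _ ly) -[in RHS](om_omV C v ly).
  by rewrite [in RHS](omC C) // om_omV // omV_om // (omC C) // om_omV.
have VV : omV C b (omV C a u) = omV C a (omV C b u).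
  rewrite -[LHS](omV_om C _ la) VC // om_omV //.
have lN (f : 'End(M)) v : f (- v) = - f v by exact: linearN.
have lZ (f : 'End(M)) x v : f (x *: v) = x *: f v by exact: linearZ.
have lB (f : 'End(M)) v w : f (v - w) = f v - f w by exact: linearB.
rewrite E1 E2 !lN (psi_psis_diag C _ lb) !(psis_psi_diag C _ la).
rewrite (psis_psi_diag C _ lb) (psi_psis_diag C _ la).
rewrite /t /tV !comp_lfunE !(lN, lZ, lB).
rewrite VV (VC b a) // (omC C _ lb la).
move: (om C a (om C b u)) (omV C a (om C b u)) (omV C b (om C a u))
      (omV C a (omV C b u)) => v1 v2 v3 v4.
rewrite [LHS](coord_vbasis (memvf _)) [RHS](coord_vbasis (memvf _)).
apply: eq_bigr => i _; congr (_ *: _).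
pose phi v := coord (vbasis {:M}) i v.
have pN v : phi (- v) = - phi v by rewrite /phi linearN.
have pZ x v : phi (x *: v) = x * phi v by rewrite /phi linearZ.
have pB v w : phi (v - w) = phi v - phi w by rewrite /phi linearB.
rewrite -/(phi _) -[RHS]/(phi _) !(pN, pZ, pB).
have p1 : p * p^-1 = 1 by rewrite mulfV.
have c1 : (p - p^-1)^-1 * (p - p^-1) = 1 by rewrite mulVf.
move: (p^-1) ((p - p^-1)^-1) p1 c1 => p' c p1 c1; clear -p1 c1.
move: (phi v1) (phi v2) (phi v3) (phi v4) => x1 x2 x3 x4.
transitivity (- (c * (c * (p - p'))) * (x2 - x3)); first by ring.
by rewrite c1 mulr1 mulNr.
Qed.
End Fock.

Definition flip (n : nat) (k : 'I_n) (m : mask n) : mask n :=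
  [ffun j => (j == k) (+) m j].

Lemma enum_ord_split n (k : 'I_n) :
  [/\ enum 'I_n = take k (enum 'I_n) ++ k :: drop k.+1 (enum 'I_n),
      k \notin take k (enum 'I_n) & k \notin drop k.+1 (enum 'I_n)].
Proof.
have E : enum 'I_n = take k (enum 'I_n) ++ k :: drop k.+1 (enum 'I_n).
  rewrite -{1}(cat_take_drop k (enum 'I_n)) (drop_nth k) ?size_enum_ord //.
  by rewrite nth_ord_enum.
have := enum_uniq 'I_n; rewrite {1}E cat_uniq /=.
by case/and3P => _ /norP[kt _] /andP[kd _].
Qed.

Lemma labelS n (k : 'I_n) : label n k.+1.
Proof. by rewrite /label /= ltn_ord. Qed.

Lemma lfunZ (K : fieldType) (M : vectType K) (f : 'End(M)) a v :
  f (a *: v) = a *: f v.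
Proof. exact: linearZ. Qed.

Section Mono.
Variables (K : fieldType) (n : nat) (p : K) (M : vectType K).
Variable C : clifford_rep n p M.

Definition mono (m : mask n) (s : seq 'I_n) (v : M) : M :=
  foldl (fun u (k : 'I_n) => if m k then psi C k.+1 u else u) v s.

Lemma mono_cons m j s v :
  mono m (j :: s) v = mono m s (if m j then psi C j.+1 v else v).
Proof. by []. Qed.

Lemma monoZ m s a v : mono m s (a *: v) = a *: mono m s v.
Proof.
elim: s v => [//|j s IHs] v; rewrite !mono_cons -IHs.
by case: (m j); rewrite ?linearZ.
Qed.

Lemma mono0 m s : mono m s 0 = 0.
Proof. by have := monoZ m s 0 0; rewrite !scale0r. Qed.

Lemma psi_sq (k : 'I_n) v : (2%:R : K) != 0 -> psi C k.+1 (psi C k.+1 v) = 0.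
Proof.
move=> two_neq0; have /eqP := psi_psi C v (labelS k) (labelS k).
by rewrite -mulr2n -scaler_nat scaler_eq0 (negPf two_neq0) /= => /eqP.
Qed.

Lemma mono_anti (op : 'End(M)) (m : mask n) (s : seq 'I_n) v :
  (forall (j : 'I_n) u, j \in s -> m j ->
     op (psi C j.+1 u) = - psi C j.+1 (op u)) ->
  op (mono m s v) = (-1) ^+ count m s *: mono m s (op v).
Proof.
elim: s v => [|j s IHs] v anti; first by rewrite /= scale1r.
rewrite !mono_cons /= IHs; last by move=> i u si; apply: anti; rewrite inE si orbT.
case: ifP => mj; last by rewrite add0n.
rewrite anti ?mem_head // exprS mulN1r scaleNr -[- psi _ _ _]scaleN1r monoZ.
by rewrite scaleN1r scalerN.
Qed.

Lemma psi_mono_anti (k : 'I_n) m s v : k \notin s ->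
  psi C k.+1 (mono m s v) = (-1) ^+ count m s *: mono m s (psi C k.+1 v).
Proof.
move=> ks; apply: mono_anti => j u js _.
by apply/eqP; rewrite -addr_eq0 psi_psi ?labelS.
Qed.

Lemma psis_mono_anti (k : 'I_n) (m : mask n) s v : ~~ m k ->
  psis C k.+1 (mono m s v) = (-1) ^+ count m s *: mono m s (psis C k.+1 v).
Proof.
move=> mk; apply: mono_anti => j u js mj.
apply/eqP; rewrite -addr_eq0 addrC psi_psis ?labelS // eqSS.
by apply/eqP => /val_inj jk; rewrite -jk mj in mk.
Qed.

Lemma om_mono (k : 'I_n) m s v :
  om C k.+1 (mono m s v) = p ^+ count (fun j => (j == k) && m j) s
     *: mono m s (om C k.+1 v).
Proof.
elim: s v => [|j s IHs] v; first by rewrite /= scale1r.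
rewrite !mono_cons /= IHs; case: (m j); last by rewrite andbF add0n.
have := om_psi C (om C k.+1 v) (labelS k) (labelS j).
rewrite (omV_om C _ (labelS k)) eqSS andbT => ->.
by rewrite monoZ scalerA -exprD addnC [_ == _]eq_sym.
Qed.

Lemma mono_flip (k : 'I_n) m s v : k \notin s -> mono (flip k m) s v = mono m s v.
Proof.
elim: s v => [//|j s IHs] v; rewrite inE negb_or => /andP[kj ks].
by rewrite !mono_cons IHs // ffunE eq_sym (negPf kj).
Qed.

Definition jw_sign (k : 'I_n) (m : mask n) : K :=
  (-1) ^+ count m (drop k.+1 (enum 'I_n)).

Lemma jw_sign_flip k m : jw_sign k (flip k m) = jw_sign k m.
Proof.
have [_ _ kd] := enum_ord_split k; congr (_ ^+ _); apply: eq_in_count => j jd.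
by rewrite ffunE; case: eqP => // jk; rewrite jk (negPf kd) in jd.
Qed.

Lemma jw_sign_sq k m : jw_sign k m * jw_sign k m = 1.
Proof. by rewrite /jw_sign -exprD addnn -mul2n exprM sqrrN expr1n expr1n. Qed.

Lemma psi_mono_psi (k : 'I_n) m v : (2%:R : K) != 0 ->
  psi C k.+1 (psi_mono C m v) =
    if m k then 0 else jw_sign k m *: psi_mono C (flip k m) v.
Proof.
move=> two_neq0; have [E kt kd] := enum_ord_split k.
rewrite /psi_mono -!/(mono _ _ _) E /mono !foldl_cat -!/(mono _ _ _) !mono_cons.
rewrite (mono_flip _ _ kt) (mono_flip _ _ kd) ffunE eqxx /= psi_mono_anti //.
by case: (m k) => //=; rewrite psi_sq // mono0 scaler0.
Qed.

Lemma flipK (k : 'I_n) : involutive (@flip n k).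
Proof. by move=> m; apply/ffunP => j; rewrite !ffunE addKb. Qed.

End Mono.

Section FockBasis.
Variables (K : fieldType) (n : nat) (p : K) (M : vectType K).
Hypothesis p_neq0 : p != 0.
Hypothesis p_sub_neq0 : p - p^-1 != 0.
Hypothesis two_neq0 : (2%:R : K) != 0.
Variable F : fock_space n p M.

Lemma om_fockv (k : 'I_n) m : om F k.+1 (fockv F m) = (p ^+ m k / p) *: fockv F m.
Proof.
rewrite /fockv /psi_mono -/(mono _ _ _ _) om_mono om_vac ?labelS // monoZ scalerA.
congr (_ ^+ _ / _ *: _); case: (boolP (m k)) => mk.
  rewrite (eq_count (a2 := pred1 k)) ?count_uniq_mem ?enum_uniq ?mem_enum //.
  by move=> j /=; case: eqP => // ->; rewrite mk.
rewrite (eq_count (a2 := pred0)) ?count_pred0 // => j /=.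
by case: eqP => // ->; rewrite (negPf mk).
Qed.

Lemma omV_fockv (k : 'I_n) m :
  omV F k.+1 (fockv F m) = (p / p ^+ m k) *: fockv F m.
Proof.
rewrite -[RHS](omV_om F _ (labelS k)) lfunZ om_fockv scalerA.
have -> : p / p ^+ m k * (p ^+ m k / p) = 1.
  by rewrite mulrA divfK ?expf_neq0 // divff.
by rewrite scale1r.
Qed.

Lemma psi_psis_fockv (k : 'I_n) m :
  psi F k.+1 (psis F k.+1 (fockv F m)) = (m k)%:R *: fockv F m.
Proof.
rewrite psi_psis_diag ?labelS // om_fockv omV_fockv !scalerA -scalerBl scalerA.
congr (_ *: _); case: (m k) => /=; first by rewrite expr1 divff // !mulr1 mulVf.
by rewrite expr0 mul1r divr1 divff // mulVf // subrr mulr0.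
Qed.

Lemma psis_psi_fockv (k : 'I_n) m :
  psis F k.+1 (psi F k.+1 (fockv F m)) = (~~ m k)%:R *: fockv F m.
Proof.
rewrite psis_psi_diag ?labelS // om_fockv omV_fockv -scalerBl scalerA -scaleNr.
congr (_ *: _); case: (m k) => /=; first by rewrite expr1 divff // subrr mulr0 oppr0.
by rewrite expr0 mul1r divr1 -mulrN opprB mulVf.
Qed.

Lemma parity_fockv (k : 'I_n) m :
  parity F k.+1 (fockv F m) = (-1) ^+ m k *: fockv F m.
Proof.
rewrite /parity add_lfunE opp_lfunE !comp_lfunE psi_psis_fockv psis_psi_fockv -scalerBl.
by congr (_ *: _); case: (m k); rewrite /= ?sub0r ?subr0.
Qed.

Lemma parity_below_fockv (k : 'I_n) m :
  parity_below F k.+1 (fockv F m) = jw_sign K k m *: fockv F m.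
Proof.
rewrite /parity_below /jw_sign.
have -> : index_iota k.+2 n.+1 = [seq (val j).+1 | j <- drop k.+1 (enum 'I_n)].
  rewrite (map_comp S val) map_drop val_enum_ord drop_iota add0n /index_iota.
  by rewrite subSS -[k.+2]/(1 + k.+1)%N iotaDl.
elim: (drop _ _) => [|j s IHs] /=.
  by rewrite id_lfunE scale1r.
by rewrite comp_lfunE IHs lfunZ parity_fockv scalerA -exprD addnC.
Qed.

Lemma psi_fockv (k : 'I_n) m : psi F k.+1 (fockv F m) =
  if m k then 0 else jw_sign K k m *: fockv F (flip k m).
Proof. exact: psi_mono_psi. Qed.

Lemma psis_fockv (k : 'I_n) m : psis F k.+1 (fockv F m) =
  if m k then jw_sign K k m *: fockv F (flip k m) else 0.
Proof.
case: ifPn => mk.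
  have := psi_fockv k (flip k m); rewrite !ffunE eqxx mk /= flipK jw_sign_flip.
  move=> /(congr1 (fun v => jw_sign K k m *: psis F k.+1 v)).
  rewrite psis_psi_fockv !ffunE eqxx mk /= scale1r => ->.
  by rewrite lfunZ scalerA jw_sign_sq scale1r.
rewrite /fockv /psi_mono -/(mono _ _ _ _) psis_mono_anti // psis_vac ?labelS //.
by rewrite mono0 scaler0.
Qed.

Lemma hpsi_fockv (k : 'I_n) m :
  hpsi F k.+1 (fockv F m) = if m k then 0 else fockv F (flip k m).
Proof.
rewrite /hpsi comp_lfunE psi_fockv; case: ifP => _; first exact: linear0.
by rewrite lfunZ parity_below_fockv jw_sign_flip scalerA jw_sign_sq scale1r.
Qed.

Lemma hpsis_fockv (k : 'I_n) m :
  hpsis F k.+1 (fockv F m) = if m k then fockv F (flip k m) else 0.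
Proof.
rewrite /hpsis comp_lfunE psis_fockv; case: ifP => _; last exact: linear0.
by rewrite lfunZ parity_below_fockv jw_sign_flip scalerA jw_sign_sq scale1r.
Qed.

End FockBasis.

Section FockModel.
Variables (K : fieldType) (n : nat) (p : K).
Hypothesis p_neq0 : p != 0.
Hypothesis p_sub_neq0 : p - p^-1 != 0.

Let FM : vectType K := {ffun mask n -> K^o}.

Definition fdelta (m : mask n) : FM := [ffun m' => (m' == m)%:R : K^o].

Lemma fdelta_sum (u : FM) : u = \sum_m (u m : K) *: fdelta m.
Proof.
apply/ffunP => m; rewrite sum_ffunE (bigD1 m) //= big1 => [|m' m'm].
  by rewrite !ffunE eqxx addr0 -[LHS]mulr1.
by rewrite !ffunE eq_sym (negPf m'm) -[LHS]/(_ * 0) mulr0.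
Qed.

Definition bmap (g : mask n -> FM) : 'End(FM) :=
  linfun (fun u : FM => \sum_m (u m : K) *: g m).

Lemma bmapE g u : bmap g u = \sum_m (u m : K) *: g m.
Proof.
rewrite /bmap; set h := fun u : FM => _.
have hlin : linear h.
  move=> a A B; rewrite /h scaler_sumr -big_split; apply: eq_bigr => i _ /=.
  by rewrite !ffunE scalerDl scalerA.
pose hL := GRing.isLinear.Build _ _ _ _ h hlin.
pose h' : {linear FM -> FM} := HB.pack h hL.
by rewrite (lfunE h').
Qed.

Lemma bmap_delta g m : bmap g (fdelta m) = g m.
Proof.
rewrite bmapE (bigD1 m) //= big1 => [|m' m'm].
  by rewrite ffunE eqxx scale1r addr0.
by rewrite ffunE (negPf m'm) scale0r.
Qed.

Lemma fdelta_ext (f g : 'End(FM)) u :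
  (forall m, f (fdelta m) = g (fdelta m)) -> f u = g u.
Proof.
move=> fg; rewrite (fdelta_sum u) !linear_sum; apply: eq_bigr => m _ /=.
by rewrite !lfunZ fg.
Qed.

Definition onlabel (op : 'I_n -> 'End(FM)) (a : nat) : 'End(FM) :=
  if insub a.-1 is Some k then op k else 0.

Lemma onlabelE op (k : 'I_n) : onlabel op k.+1 = op k.
Proof. by rewrite /onlabel /= valK. Qed.

Definition mpsi := onlabel (fun k => bmap (fun m =>
  if m k then 0 else jw_sign K k m *: fdelta (flip k m))).
Definition mpsis := onlabel (fun k => bmap (fun m =>
  if m k then jw_sign K k m *: fdelta (flip k m) else 0)).
Definition mom := onlabel (fun k => bmap (fun m => (p ^+ m k / p) *: fdelta m)).
Definition momV := onlabel (fun k => bmap (fun m => (p / p ^+ m k) *: fdelta m)).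

Lemma mpsiE (k : 'I_n) m : mpsi k.+1 (fdelta m) =
  if m k then 0 else jw_sign K k m *: fdelta (flip k m).
Proof. by rewrite /mpsi onlabelE bmap_delta. Qed.
Lemma mpsisE (k : 'I_n) m : mpsis k.+1 (fdelta m) =
  if m k then jw_sign K k m *: fdelta (flip k m) else 0.
Proof. by rewrite /mpsis onlabelE bmap_delta. Qed.
Lemma momE (k : 'I_n) m : mom k.+1 (fdelta m) = (p ^+ m k / p) *: fdelta m.
Proof. by rewrite /mom onlabelE bmap_delta. Qed.
Lemma momVE (k : 'I_n) m : momV k.+1 (fdelta m) = (p / p ^+ m k) *: fdelta m.
Proof. by rewrite /momV onlabelE bmap_delta. Qed.

Lemma labelP a : label n a -> exists k : 'I_n, a = k.+1.
Proof. by case: a => // a la; exists (Ordinal (la : a < n)%N). Qed.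

Lemma flip_at (k j : 'I_n) m : flip k m j = (j == k) (+) m j.
Proof. by rewrite ffunE. Qed.

Lemma flipC (j k : 'I_n) m : flip j (flip k m) = flip k (flip j m).
Proof. by apply/ffunP => i; rewrite !ffunE addbCA. Qed.

Lemma jw_flip (k j : 'I_n) m :
  jw_sign K k (flip j m) = (-1) ^+ (k < j)%N * jw_sign K k m.
Proof.
have sgE (s : seq 'I_n) : (-1) ^+ count (flip j m) s =
    (-1) ^+ count (pred1 j) s * (-1) ^+ count m s :> K.
  elim: s => [|i s IHs]; first by rewrite mulr1.
  by rewrite /= !exprD IHs flip_at signr_addb mulrACA.
rewrite /jw_sign sgE count_uniq_mem ?drop_uniq ?enum_uniq //.
congr ((-1) ^+ nat_of_bool _ * _).
rewrite -(mem_map val_inj) map_drop val_enum_ord drop_iota mem_iota add0n.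
case: leqP => //= kj; have := ltn_ord j; have := ltn_ord k.
by rewrite subnKC // => _ ->.
Qed.

Lemma jw_cancel (a b : 'I_n) m : a != b ->
  jw_sign K b m * jw_sign K a (flip b m) + jw_sign K a m * jw_sign K b (flip a m)
  = 0.
Proof.
rewrite -val_eqE neq_ltn !jw_flip /=.
by case: ltngtP => // _ _; rewrite ?expr1 ?expr0; ring.
Qed.

Lemma om_coef (b : bool) : (p ^+ b / p) * (p / p ^+ b) = 1.
Proof. by rewrite mulrA divfK // divff ?expf_neq0. Qed.

Lemma fock_model_vac_mono (C : clifford_rep n p FM) m :
  psi C = mpsi -> psi_mono C m (fdelta [ffun=> false]) = fdelta m.
Proof.
move=> psiE; pose cut i : mask n := [ffun j : 'I_n => (j < i)%N && m j].
suff key i : (i <= n)%N ->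
    mono C m (take i (enum 'I_n)) (fdelta [ffun=> false]) = fdelta (cut i).
  have := key n (leqnn n); rewrite take_oversize ?size_enum_ord //.
  move=> E; rewrite /psi_mono -/(mono _ _ _ _) E; congr fdelta.
  by apply/ffunP => j; rewrite ffunE ltn_ord.
elim: i => [|i IHi] lin.
  by rewrite take0; congr fdelta; apply/ffunP => j; rewrite !ffunE.
pose k := Ordinal lin.
rewrite (take_nth k) ?size_enum_ord // (nth_ord_enum k k).
rewrite /mono foldl_rcons -/(mono _ _ _ _) IHi ?(ltnW lin) // psiE.
have cutS : cut i.+1 = if m k then flip k (cut i) else cut i.
  apply/ffunP => j; rewrite (fun_if (fun f : mask n => f j)) !ffunE ltnS leq_eqVlt.
  rewrite -[(j == k)]/(j == i :> nat); case: eqP => [ji|_] /=; last by case: ifP.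
  have -> : j = k by apply: val_inj.
  by rewrite ltnn /=; case: (m k).
rewrite cutS; case: (m k) => //.
rewrite mpsiE ffunE ltnn /= /jw_sign (_ : count _ _ = 0%N) ?scale1r //.
apply/eqP; rewrite -leqn0 leqNgt -has_count; apply/hasPn => j.
rewrite -(mem_map val_inj) map_drop val_enum_ord drop_iota mem_iota ffunE add0n.
by case/andP => kj _; rewrite ltnNge (ltnW kj).
Qed.

Lemma fdelta_basis : basis_of fullv [seq fdelta m | m : mask n].
Proof.
apply/andP; split.
  rewrite eqEsubv subvf andTb.
  apply/subvP => u _; rewrite (fdelta_sum u); apply: memv_suml => m _.
  by apply: memvZ; apply: memv_span; apply: map_f; rewrite mem_enum.
apply/(@freeP _ _ _ [tuple of [seq fdelta m | m : mask n]]) => c c0 i.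
have nthE (j : 'I_#|mask n|) :
    [tuple of [seq fdelta m | m : mask n]]`_j = fdelta (enum_val j).
  by rewrite /= (nth_map (enum_val j)) -?cardE // -enum_val_nth.
move/(congr1 (fun u : FM => u (enum_val i) : K)): c0.
rewrite sum_ffunE ffunE (bigD1 i) //= big1 => [|j ji].
  by rewrite ffunE nthE ffunE eqxx addr0 => <-; rewrite -[LHS]mulr1.
rewrite ffunE nthE ffunE (inj_eq enum_val_inj) eq_sym (negPf ji).
exact: mulr0.
Qed.

Definition model_cliff : clifford_rep n p FM.
Proof.
apply: (@CliffordRep K n p FM mpsi mpsis mom momV).
- move=> _ u /labelP[a ->].
  rewrite -comp_lfunE -[RHS]id_lfunE; apply: fdelta_ext => m.
  by rewrite comp_lfunE id_lfunE momVE lfunZ momE scalerA mulrC om_coef scale1r.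
- move=> _ u /labelP[a ->].
  rewrite -comp_lfunE -[RHS]id_lfunE; apply: fdelta_ext => m.
  by rewrite comp_lfunE id_lfunE momE lfunZ momVE scalerA om_coef scale1r.
- move=> _ _ u /labelP[a ->] /labelP[b ->].
  rewrite -!comp_lfunE; apply: fdelta_ext => m.
  by rewrite !comp_lfunE !momE !lfunZ !momE !scalerA mulrC.
- move=> _ _ u /labelP[a ->] /labelP[b ->].
  rewrite -!comp_lfunE -scale_lfunE; apply: fdelta_ext => m.
  rewrite scale_lfunE !comp_lfunE momVE !lfunZ mpsiE; case: ifPn => mb.
    by rewrite linear0 !scaler0.
  rewrite lfunZ momE !scalerA flip_at (_ : (a.+1 == b.+1) = (a == b)) //; congr (_ *: _).
  rewrite mulrAC; congr (_ * _).
  case: eqVneq => [->|_] /=; last by rewrite mulrC om_coef expr0.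
  by rewrite (negPf mb) /= expr0 divr1 expr1 divff // mulr1.
- move=> _ _ u /labelP[a ->] /labelP[b ->].
  rewrite -!comp_lfunE -scale_lfunE; apply: fdelta_ext => m.
  rewrite scale_lfunE !comp_lfunE momVE !lfunZ mpsisE; case: ifPn => mb; last first.
    by rewrite linear0 !scaler0.
  rewrite lfunZ momE !scalerA flip_at (_ : (a.+1 == b.+1) = (a == b)) //; congr (_ *: _).
  rewrite mulrAC; congr (_ * _).
  case: eqVneq => [->|_] /=; last by rewrite mulrC om_coef expr0 invr1.
  by rewrite mb /= expr1 expr0 divff // !mul1r.
- move=> _ _ u /labelP[a ->] /labelP[b ->].
  rewrite -!comp_lfunE -add_lfunE -[RHS](@zero_lfunE _ FM FM u); apply: fdelta_ext => m.
  rewrite zero_lfunE add_lfunE !comp_lfunE !mpsiE.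
  rewrite !(fun_if (mpsi _)) !lfunZ !linear0 !mpsiE !flip_at.
  case: (eqVneq a b) => [->|ab].
    by case: (m b); rewrite /= ?scaler0 ?addr0.
  rewrite !addFb.
  case: (m a) (m b) => [] [] //=; rewrite ?scaler0 ?addr0 //.
  by rewrite !scalerA (flipC b a) -scalerDl jw_cancel // scale0r.
- move=> _ _ u /labelP[a ->] /labelP[b ->].
  rewrite -!comp_lfunE -add_lfunE -[RHS](@zero_lfunE _ FM FM u); apply: fdelta_ext => m.
  rewrite zero_lfunE add_lfunE !comp_lfunE !mpsisE.
  rewrite !(fun_if (mpsis _)) !lfunZ !linear0 !mpsisE !flip_at.
  case: (eqVneq a b) => [->|ab].
    by case: (m b); rewrite /= ?scaler0 ?addr0.
  rewrite !addFb.
  case: (m a) (m b) => [] [] //=; rewrite ?scaler0 ?addr0 //.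
  by rewrite !scalerA (flipC b a) -scalerDl jw_cancel // scale0r.
- move=> _ _ u /labelP[a ->] /labelP[b ->]; rewrite eqSS => ab.
  rewrite -!comp_lfunE -add_lfunE -[RHS](@zero_lfunE _ FM FM u); apply: fdelta_ext => m.
  rewrite zero_lfunE add_lfunE !comp_lfunE mpsisE mpsiE.
  rewrite (fun_if (mpsi _)) (fun_if (mpsis _)) !lfunZ !linear0 mpsisE mpsiE !flip_at.
  have {}ab : a != b by [].
  rewrite [b == a]eq_sym (negPf ab) !addFb.
  case: (m a) (m b) => [] [] //=; rewrite ?scaler0 ?addr0 //.
  by rewrite !scalerA (flipC b a) -scalerDl jw_cancel // scale0r.
- move=> _ u /labelP[a ->].
  rewrite -!comp_lfunE -!scale_lfunE -opp_lfunE -add_lfunE -scale_lfunE.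
  apply: fdelta_ext => m.
  rewrite !(scale_lfunE, add_lfunE, opp_lfunE, comp_lfunE) mpsisE momE momVE.
  rewrite !scalerA -scalerBl scalerA (fun_if (mpsi _)) linear0 lfunZ mpsiE.
  rewrite flip_at eqxx /= flipK jw_sign_flip; case: (m a) => /=.
    by rewrite scalerA jw_sign_sq expr1 divff // !mulr1 mulVf.
  by rewrite expr0 mul1r divr1 divff // mulVf // subrr mulr0 scale0r.
- move=> _ u /labelP[a ->].
  rewrite -!comp_lfunE -!opp_lfunE -add_lfunE -scale_lfunE -opp_lfunE.
  apply: fdelta_ext => m.
  rewrite !(scale_lfunE, add_lfunE, opp_lfunE, comp_lfunE) mpsiE momE momVE.
  rewrite -scalerBl scalerA -scaleNr (fun_if (mpsis _)) linear0 lfunZ mpsisE.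
  rewrite flip_at eqxx /= flipK jw_sign_flip; case: (m a) => /=.
    by rewrite expr1 divff // subrr mulr0 oppr0 scale0r.
  by rewrite scalerA jw_sign_sq expr0 mul1r divr1 -mulrN opprB mulVf.
Defined.

Lemma fock_space_exists : exists M : vectType K, inhabited (fock_space n p M).
Proof.
exists FM; constructor.
apply: (@FockSpace K n p FM model_cliff (fdelta [ffun=> false])).
- by move=> _ /labelP[a ->]; rewrite mpsisE ffunE.
- by move=> _ /labelP[a ->]; rewrite momE ffunE expr0 mul1r.
have -> : [seq psi_mono model_cliff m (fdelta [ffun=> false]) | m : mask n]
   = [seq fdelta m | m : mask n].
  by apply: eq_map => m; rewrite fock_model_vac_mono.
exact: fdelta_basis.
Qed.

End FockModel.

(* M (x) M in coordinates with respect to a fixed basis of M. *)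
Definition tsq (K : fieldType) (M : vectType K) : vectType K :=
  'M[K]_(\dim {:M}, \dim {:M}).

Definition tens (K : fieldType) (M : vectType K) (u v : M) : tsq M :=
  \matrix_(i, j) (coord (vbasis fullv) i u * coord (vbasis fullv) j v).

(* f (x) g, see [tens_lfunE]. *)
Definition tens_lfun (K : fieldType) (M : vectType K) (f g : 'End(M)) : 'End(tsq M) :=
  linfun (fun A : tsq M => \sum_i \sum_j
    (A : 'M[K]_(_, _)) i j *:
      tens (f (vbasis fullv)`_i) (g (vbasis fullv)`_j)).

Section Tensor.
Variables (K : fieldType) (M : vectType K).
Implicit Types u v : M.

Lemma tensP u v : forall i j, (tens u v : 'M[K]_(_, _)) i j =
  coord (vbasis fullv) i u * coord (vbasis fullv) j v.
Proof. by move=> i j; rewrite mxE. Qed.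

Lemma tensDl u u' v : tens (u + u') v = tens u v + tens u' v.
Proof. by apply/matrixP => i j; rewrite !mxE raddfD mulrDl. Qed.
Lemma tensDr u v v' : tens u (v + v') = tens u v + tens u v'.
Proof. by apply/matrixP => i j; rewrite !mxE raddfD mulrDr. Qed.
Lemma tensZl a u v : tens (a *: u) v = a *: tens u v.
Proof. by apply/matrixP => i j; rewrite !mxE linearZ /= mulrA. Qed.
Lemma tensZr a u v : tens u (a *: v) = a *: tens u v.
Proof. by apply/matrixP => i j; rewrite !mxE linearZ /= mulrCA. Qed.
Lemma tens0l v : tens 0 v = 0 :> tsq M.
Proof. by apply/matrixP => i j; rewrite !mxE linear0 mul0r. Qed.
Lemma tens0r u : tens u 0 = 0 :> tsq M.
Proof. by apply/matrixP => i j; rewrite !mxE linear0 mulr0. Qed.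
Lemma tens_suml I (r : seq I) (P : pred I) (f : I -> M) v :
  tens (\sum_(i <- r | P i) f i) v = \sum_(i <- r | P i) tens (f i) v.
Proof. exact: (big_morph (fun u => tens u v) (fun x y => tensDl x y v) (tens0l v)). Qed.
Lemma tens_sumr I (r : seq I) (P : pred I) (f : I -> M) u :
  tens u (\sum_(i <- r | P i) f i) = \sum_(i <- r | P i) tens u (f i).
Proof. exact: (big_morph (tens u) (tensDr u) (tens0r u)). Qed.

Lemma tens_lfunE (f g : 'End(M)) u v : tens_lfun f g (tens u v) = tens (f u) (g v).
Proof.
rewrite /tens_lfun; set h := fun A : tsq M => _.
have hlin : linear h.
  move=> a A B; rewrite /h scaler_sumr -big_split; apply: eq_bigr => i _ /=.
  rewrite scaler_sumr -big_split; apply: eq_bigr => j _ /=.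
  by rewrite !mxE scalerDl scalerA.
pose hL := GRing.isLinear.Build _ _ _ _ h hlin.
pose h' : {linear tsq M -> tsq M} := HB.pack h hL.
rewrite -[RHS]/(tens (f u) (g v)) (lfunE h') /= /h.
rewrite {2}(coord_vbasis (memvf u)) {2}(coord_vbasis (memvf v)).
rewrite !linear_sum tens_suml; apply: eq_bigr => i _.
rewrite tens_sumr; apply: eq_bigr => j _.
by rewrite tensP !linearZ tensZl tensZr scalerA.
Qed.

End Tensor.

Definition tens_lattice (M : vectType Qqs) (L : M -> Prop) (w : tsq M) : Prop :=
  exists (k : nat) (u v : 'I_k -> M),
    (forall j, L (u j) /\ L (v j)) /\ w = \sum_j tens (u j) (v j).

Section Action.
Variables (K : fieldType) (q : K) (t : affine_type) (n : nat) (p : K)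
  (M : vectType K).
Variable F : fock_space n p M.

(* The operators by which t_i, e_i, f_i act on Lambda(V); the value 0 at an
   end node of kind (2) is a placeholder that is never used. *)
Definition act1_t (i : nat) : 'End(M) :=
  if i == 0%N then
    match diamond0 t with
    | Dia1 => qi q t n 0%N *: om F 1%N
    | Dia11 => qi q t n 0%N *: (om F 1%N \o om F 2%N)%VF
    | Dia2 => 0
    end
  else if i == n then
    match diamondn t with
    | Dia1 => (qi q t n n)^-1 *: omV F n
    | Dia11 => (qi q t n n)^-1 *: (omV F n \o omV F n.-1)%VF
    | Dia2 => 0
    end
  else (om F i.+1 \o omV F i)%VF.

Definition act1_e (i : nat) : 'End(M) :=
  if i == 0%N then
    match diamond0 t with
    | Dia1 => hpsi F 1%N
    | Dia11 => (hpsi F 1%N \o hpsi F 2%N)%VF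
    | Dia2 => 0
    end
  else if i == n then
    match diamondn t with
    | Dia1 => hpsis F n
    | Dia11 => (hpsis F n \o hpsis F n.-1)%VF
    | Dia2 => 0
    end
  else (hpsi F i.+1 \o hpsis F i)%VF.

Definition act1_f (i : nat) : 'End(M) :=
  if i == 0%N then
    match diamond0 t with
    | Dia1 => hpsis F 1%N
    | Dia11 => (hpsis F 2%N \o hpsis F 1%N)%VF
    | Dia2 => 0
    end
  else if i == n then
    match diamondn t with
    | Dia1 => hpsi F n
    | Dia11 => (hpsi F n.-1 \o hpsi F n)%VF
    | Dia2 => 0
    end
  else (hpsis F i.+1 \o hpsi F i)%VF.

(* The operators on Lambda(V) (x) Lambda(V): by Delta except at the end nodes
   of kind (2). *)
Definition act2_t (i : nat) : 'End(tsq M) :=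
  if (i == 0%N) && is_dia2 (diamond0 t) then
    qi q t n 0%N *: tens_lfun (om F 1%N \o om F 1%N)%VF (om F 1%N \o om F 1%N)%VF
  else if (i == n) && is_dia2 (diamondn t) then
    (qi q t n n)^-1 *: tens_lfun (omV F n \o omV F n)%VF (omV F n \o omV F n)%VF
  else tens_lfun (act1_t i) (act1_t i).

Definition act2_e (i : nat) : 'End(tsq M) :=
  if (i == 0%N) && is_dia2 (diamond0 t) then tens_lfun (hpsi F 1%N) (hpsi F 1%N)
  else if (i == n) && is_dia2 (diamondn t) then
    tens_lfun (hpsis F n) (hpsis F n)
  else tens_lfun (act1_e i) ((act1_t i)^-1)%VF + tens_lfun \1%VF (act1_e i).

Definition act2_f (i : nat) : 'End(tsq M) :=
  if (i == 0%N) && is_dia2 (diamond0 t) then tens_lfun (hpsis F 1%N) (hpsis F 1%N)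
  else if (i == n) && is_dia2 (diamondn t) then
    tens_lfun (hpsi F n) (hpsi F n)
  else tens_lfun (act1_f i) \1%VF + tens_lfun (act1_t i) (act1_f i).

End Action.

(* As the module has weights in P_cl, the q^h are determined by the t_i. *)
Definition acts_by (K : fieldType) (q : K) t n (M : vectType K)
    (rho : uq_rep q t n M) (T E F : nat -> 'End(M)) : Prop :=
  forall i : 'I_n.+1, [/\ ut rho i = T i, ue rho i = E i & uf rho i = F i].

Definition fockv2 (K : fieldType) n (p : K) (M : vectType K)
    (F : fock_space n p M) (mm : mask n * mask n) : tsq M :=
  tens (fockv F mm.1) (fockv F mm.2).

(* Main.v *)
Require Import Defs.
From HB Require Import structures.
From mathcomp Require Import all_boot all_order all_algebra.
From mathcomp Require Import generic_quotient zify ring.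
From Stdlib Require Import Classical FunctionalExtensionality PropExtensionality.

Set Implicit Arguments.
Unset Strict Implicit.
Unset Printing Implicit Defensive.

Import Order.TTheory GRing.Theory Num.Theory.
Local Open Scope ring_scope.

(* On the basis psi_m |0> every node acts on Lambda(V) by a partial move of the
   occupation numbers m in {0,1}^n: e_i raises some sites and lowers others, f_i
   undoes this, and all <h_i, .> lie in {-1, 0, 1}; an end of kind (2) acts on
   the tensor square in the same fashion.  So all h_i-weights of both modules lie
   in [-2, 2].  This has three consequences.  The Serre element S of (i, j)
   commutes with f_i and raises the h_i-weight by 2 - a_ij, hence kills every
   vector e_i-highest of weight l: S w has weight l + 2 - a_ij > 2 unless
   a_ij = l = 0, and then f_i w = 0 gives f_i (S w) = 0 = e_i (S w).
   The Kashiwara operators are e_i D and f_i D, where D divides the vectors of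
   h_i-weight 0 by [2]_i.  On the tensor basis they are therefore given by the
   coefficients 1, q_i, (1 + q_i^2)^-1 and q_i (1 + q_i^2)^-1, from which the
   crystal is read off.  Finally the form for which the psi_m |0> (or their
   tensor products) are orthonormal is a polarization; it is anisotropic because
   a sum of squares in Q(q_s) vanishes only trivially, so orthogonal complements
   prove semisimplicity. *)

(** An end node of kind (2) does not act on one copy of Λ(V), so the square is not in general a
    tensor product of modules, and its relations cannot be deduced from those of Λ(V): they are
    checked directly on the tensor basis. Both modules pass through the same interface [spin_like],
    a list of conditions on a basis labelled by weights: the bound 2, the weight shift of e_i, the
    commutators of e_i and f_j, and adjointness for the form in which the basis is orthonormal.
    These yield the representation, integrability, the Kashiwara operators, the polarization and
    semisimplicity; the crystal needs in addition only the residues recorded in [crystal_graph].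

    The ends of kind (2) are governed by a rescaling. Let α'_i and h'_i belong to an end of kind (1)
    in the same place; then α_i = 2 α'_i and h_i = h'_i / 2. On one factor the occupation numbers
    see h'_i, and on the square e_i acts in both factors at once, hence shifts weights by 2 α'_i.
    The factor 2 is [kap]; identities about weights are multiplied by it so as to stay in the
    integers. *)

Local Notation mask := Defs.mask.

(** * Strings of the quantum sl_2 with weights at most 2 *)

Lemma vec_eq (K : fieldType) (M : vectType K) (u v : M) :
  (forall i, coord (vbasis {:M}) i u = coord (vbasis {:M}) i v) -> u = v.
Proof.
move=> uv; rewrite [u](coord_vbasis (memvf _)) [v](coord_vbasis (memvf _)).
by apply: eq_bigr => i _; rewrite uv.
Qed.

(** Identities between linear combinations of vectors become, on each coordinate, identities for
    [field]. *)
Ltac vec_field :=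
  apply: vec_eq => ?; rewrite ?(linearD, linearN, linearB, linearZ, linear0) /=; field.

Section QuantumIntegers.
Variables (K : fieldType) (y : K).

Definition br (k : int) : K := (y ^ k - y ^ (- k)) / (y - y^-1).

Lemma br0 : br 0 = 0.
Proof. by rewrite /br oppr0 subrr mul0r. Qed.

Lemma brN k : br (- k) = - br k.
Proof. by rewrite /br opprK -mulNr opprB. Qed.

Hypotheses (y0 : y != 0) (y1 : y - y^-1 != 0).

Lemma br1 : br 1 = 1.
Proof. by rewrite /br expr1z exprN1 divff. Qed.

Lemma br2 : br 2 = y + y^-1.
Proof.
rewrite /br -invr_expz -[y ^ 2]/(y ^+ 2).
apply: (mulIf y1); rewrite divfK //; field; exact: y0.
Qed.

(** Moving f across e^2 on a vector of weight k leaves the coefficient [k] + [k + 2] in front of e;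
    this form of it cancels in the Serre elements. *)
Lemma br_rec k : br (k + 2) + br k = br 2 * br (k + 1).
Proof.
rewrite br2 /br mulrA -mulrDl; congr (_ / _).
rewrite -(invr_expz y (k + 2)) -(invr_expz y k) -(invr_expz y (k + 1)) !expfzDr //.
rewrite !expr1z.
field; rewrite y0 /=; exact: expfz_neq0.
Qed.

End QuantumIntegers.

Section Sl2.
Variables (K : fieldType) (M : vectType K) (y : K).
Hypotheses (y0 : y != 0) (y1 : y - y^-1 != 0) (y2 : y + y^-1 != 0).

(** The weight group is abstract and [h] merely additive, so that exchanging e and f and changing
    the signs of [h] and [al] gives another instance. The [W mu] are not assumed to span M; the
    lemmas speak of vectors of one weight. *)
Variant sl2_graded (T : zmodType) (h : T -> int) (al : T) (W : T -> {vspace M})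
    (e f : 'End(M)) : Prop := Sl2Graded of
  (forall mu nu, h (mu + nu) = h mu + h nu) &
  h al = 2 &
  (forall mu u, u \in W mu -> u != 0 -> -2 <= h mu <= 2) &
  (forall mu u, u \in W mu -> e u \in W (mu + al)) &
  (forall mu u, u \in W mu -> f u \in W (mu - al)) &
  (forall mu u, u \in W mu -> e (f u) - f (e u) = br y (h mu) *: u).

(** With it the Serre relations of the f_i follow from the argument for the e_i. *)
Lemma sl2_graded_swap T h al W e f : @sl2_graded T h al W e f ->
  sl2_graded (fun mu => - h mu) (- al) W f e.
Proof.
case=> hD hal hW eW fW ef.
have hN mu : h (- mu) = - h mu.
  by have := hD 0 0; have := hD mu (- mu); rewrite subrr addr0; clear; lia.
split=> [mu nu|||||mu u uW].
- by rewrite hD opprD.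
- by rewrite hN opprK.
- by move=> mu u uW u0; have := hW _ _ uW u0; clear; lia.
- exact: fW.
- by move=> mu u /eW; rewrite opprK.
- by rewrite brN scaleNr -(ef mu u uW) opprB.
Qed.

Section Strings.
Variables (T : zmodType) (h : T -> int) (al : T) (W : T -> {vspace M}).
Variables (e f : 'End(M)).
Hypothesis g : sl2_graded h al W e f.

Let two : br y 2 != 0. Proof. by rewrite br2. Qed.

Lemma sg_hN mu : h (- mu) = - h mu.
Proof. by case: g => hD *; have := hD 0 0; have := hD mu (- mu); rewrite subrr addr0; clear; lia. Qed.

Lemma sg_hal mu : h (mu + al) = h mu + 2.
Proof. by case: g => -> ->. Qed.

Lemma sg_hsub mu : h (mu - al) = h mu - 2.
Proof. by case: g => -> E *; rewrite sg_hN E. Qed.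

Lemma sg_eW mu u : u \in W mu -> e u \in W (mu + al).
Proof. by case: g => ??? H _ _; apply: H. Qed.

Lemma sg_fW mu u : u \in W mu -> f u \in W (mu - al).
Proof. by case: g => ???? H _; apply: H. Qed.

Lemma sg_out mu u : u \in W mu -> ~~ (-2 <= h mu <= 2) -> u = 0.
Proof.
by case: g => ?? hW _ _ _ uW; apply: contraNeq => u0; apply: hW uW u0.
Qed.

Lemma sg_ef mu u : u \in W mu -> e (f u) = f (e u) + br y (h mu) *: u.
Proof. by case: g => ????? H; move=> uW; rewrite -(H mu) // addrC subrK. Qed.

Lemma sg_fe mu u : u \in W mu -> f (e u) = e (f u) - br y (h mu) *: u.
Proof. by move=> uW; rewrite (sg_ef uW) addrK. Qed.

Lemma sg_eout mu u : u \in W mu -> (1 <= h mu) -> e u = 0.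
Proof. by move=> uW k; apply: sg_out (sg_eW uW) _; rewrite sg_hal; lia. Qed.

Lemma sg_fout mu u : u \in W mu -> (h mu <= -1) -> f u = 0.
Proof. by move=> uW k; apply: sg_out (sg_fW uW) _; rewrite sg_hsub; lia. Qed.

Lemma sg_eeout mu u : u \in W mu -> (-1 <= h mu) -> e (e u) = 0.
Proof. by move=> uW k; apply: sg_eout (sg_eW uW) _; rewrite sg_hal; lia. Qed.

Lemma sg_ffout mu u : u \in W mu -> (h mu <= 1) -> f (f u) = 0.
Proof. by move=> uW k; apply: sg_fout (sg_fW uW) _; rewrite sg_hsub; lia. Qed.

(** Here e f w = [0] w = 0, and f f w = 0 because its weight would be -4. The commutator applied to
    f w, of weight -2, then gives [2] f w = 0. *)
Lemma hw0_f mu w : w \in W mu -> h mu = 0 -> e w = 0 -> f w = 0.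
Proof.
move=> wW k0 ew.
have efw : e (f w) = 0 by rewrite (sg_ef wW) ew linear0 k0 br0 scale0r addr0.
have ffw : f (f w) = 0 by apply: sg_ffout wW _; rewrite k0.
have /eqP := sg_ef (sg_fW wW).
rewrite ffw efw !linear0 add0r sg_hsub k0 add0r brN eq_sym scaler_eq0 oppr_eq0.
by rewrite (negPf two) => /eqP.
Qed.

Definition fdiv r u := (qfact y r)^-1 *: iter r f u.

Lemma qfact0 : qfact y 0 = 1. Proof. by rewrite /qfact big_geq. Qed.
Lemma qfact1 : qfact y 1 = 1.
Proof. by rewrite /qfact big_nat1 /qint expr1 divff. Qed.
Lemma qfact2 : qfact y 2 = br y 2.
Proof. by rewrite /qfact big_nat_recr //= -/(qfact y 1) qfact1 mul1r /br -invr_expz. Qed.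

Lemma fdiv0 u : fdiv 0 u = u.
Proof. by rewrite /fdiv qfact0 invr1 scale1r. Qed.
Lemma fdiv1 u : fdiv 1 u = f u.
Proof. by rewrite /fdiv qfact1 invr1 scale1r. Qed.
Lemma fdiv2 u : fdiv 2 u = (br y 2)^-1 *: f (f u).
Proof. by rewrite /fdiv qfact2. Qed.

Lemma fdivr0 r : fdiv r 0 = 0.
Proof.
rewrite /fdiv; suff -> : iter r f 0 = 0 by rewrite scaler0.
by elim: r => //= r ->; rewrite linear0.
Qed.

(** The weight bound allows strings of length at most 3, so three summands suffice; the highest
    vectors are written down for each of the possible weights of u. *)
Lemma string_exists mu u : u \in W mu -> exists w : nat -> M,
  (forall r, [/\ e (w r) = 0, w r \in W (mu + al *+ r) &
     w r != 0 -> r%:Z <= h (mu + al *+ r)]) /\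
  u = \sum_(r < 3) fdiv r (w r).
Proof.
move=> uW; have [->|u0] := eqVneq u 0.
  exists (fun=> 0); split=> [r|]; first by rewrite linear0 mem0v eqxx.
  by rewrite big1 // => r _; rewrite fdivr0.
have : -2 <= h mu <= 2 by case: g => _ _ hW _ _ _; apply: hW uW u0.
have E0 : mu + al *+ 0 = mu by rewrite addr0.
have E1 : mu + al *+ 1 = mu + al by [].
have E2 : mu + al *+ 2 = mu + al + al by rewrite mulr2n addrA.
pose S w0 w1 w2 := fun r : nat => nth (0 : M) [:: w0; w1; w2] r.
have key w0 w1 w2 : [/\ e w0 = 0, w0 \in W mu & w0 != 0 -> 0 <= h mu] ->
    [/\ e w1 = 0, w1 \in W (mu + al) & w1 != 0 -> 1 <= h mu + 2] ->
    [/\ e w2 = 0, w2 \in W (mu + al + al) & w2 != 0 -> 2 <= h mu + 4] ->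
    u = w0 + f w1 + (br y 2)^-1 *: f (f w2) ->
    exists w : nat -> M, (forall r, [/\ e (w r) = 0, w r \in W (mu + al *+ r) &
     w r != 0 -> r%:Z <= h (mu + al *+ r)]) /\ u = \sum_(r < 3) fdiv r (w r).
  move=> [a0 b0 c0] [a1 b1 c1] [a2 b2 c2] uE; exists (S w0 w1 w2); split.
    case=> [|[|[|r]]]; rewrite /S.
    - by rewrite E0; split.
    - by rewrite E1 sg_hal; split.
    - by rewrite E2 !sg_hal; split=> // /c2; rewrite -addrA.
    - by rewrite /= nth_nil linear0 mem0v eqxx.
  by rewrite !big_ord_recl big_ord0 addr0 fdiv0 fdiv1 fdiv2 uE addrA.
have z mu' : [/\ e 0 = 0, (0 : M) \in W mu' & forall k : bool, (0 : M) != 0 -> k].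
  by rewrite linear0 mem0v eqxx; split.
have [z1 z2 z3] := z mu.
have feW : f (e u) \in W mu by have := sg_fW (sg_eW uW); rewrite addrK.
have feuW := sg_eW uW.
have eeW := sg_eW feuW.
case: (ltrgtP (h mu) 0) => [k0|k0|k0] hk.
- have [k1|k1] : h mu = -1 \/ h mu = -2 by move: hk k0; clear; lia.
  + apply: (key 0 (e u) 0); rewrite ?linear0 ?mem0v ?eqxx //.
      by split=> //; [apply: sg_eeout uW _; rewrite k1 | rewrite k1].
    rewrite (sg_fe uW) (sg_fout uW) ?k1 // brN br1 //.
    by rewrite linear0 scaleN1r opprK addr0 !add0r.
  (* At weight -2 one has f^2 e^2 u = [2]^2 u; one factor [2] is absorbed by the divided power, the
     other by the witness. *)
  + apply: (key 0 0 ((br y 2)^-1 *: e (e u))); rewrite ?linear0 ?mem0v ?eqxx //.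
      split; last by rewrite k1.
        rewrite linearZ /= (sg_eout eeW) ?scaler0 //.
        by rewrite !sg_hal k1.
      exact: memvZ.
    have fu : f u = 0 by apply: sg_fout uW _; rewrite k1.
    have feu : f (e u) = br y 2 *: u.
      by rewrite (sg_fe uW) fu linear0 k1 brN scaleNr opprK add0r.
    have feeu : f (e (e u)) = br y 2 *: e u.
      by rewrite (sg_fe feuW) feu sg_hal k1 addNr br0 scale0r subr0 linearZ.
    rewrite !lfunZ feeu lfunZ feu !scalerA !add0r.
    by rewrite mulVf // mulr1 mulVf // scale1r.
- apply: (key u 0 0); rewrite ?linear0 ?mem0v ?eqxx //; last first.
    by rewrite !addr0.
  by split=> //; [apply: sg_eout uW _; rewrite -gtz0_ge1 | rewrite ltW].
(* At weight 0 one has e f e u = [2] e u, since e e u = 0; subtracting f e u / [2] from u therefore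
   leaves a vector killed by e. *)
- apply: (key (u - (br y 2)^-1 *: f (e u)) ((br y 2)^-1 *: e u) 0);
    rewrite ?linear0 ?mem0v ?eqxx //; last by rewrite lfunZ addr0 subrK.
    split; [|by rewrite memvB // memvZ|by rewrite k0].
    rewrite linearB linearZ /= (sg_ef feuW) (sg_eeout uW) ?k0 // linear0 add0r.
    by rewrite sg_hal k0 add0r scalerA mulVf // scale1r subrr.
  split; [|by rewrite memvZ|by rewrite k0].
  by rewrite linearZ /= (sg_eeout uW) ?scaler0 ?k0.
Qed.

(** Commutation with f carries S through the divided powers of [string_exists], so only highest
    vectors matter; S pushes those of positive weight beyond 2. *)
Lemma commuting_f_eq0 (s : T) (S : 'End(M)) : 2 <= h s ->
  (forall mu u, u \in W mu -> S u \in W (mu + s)) ->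
  (forall mu u, u \in W mu -> f (S u) = S (f u)) ->
  forall mu u, u \in W mu -> S u = 0.
Proof.
move=> hs SW Sf mu u /string_exists[w [wP ->]].
have Sfd r v nu : v \in W nu -> S (fdiv r v) = fdiv r (S v).
  rewrite /fdiv linearZ /= => vW; congr (_ *: _).
  have itW : forall r, iter r f v \in W (nu - al *+ r).
    elim=> [|r' IH]; first by rewrite subr0.
    by rewrite iterS mulrSr opprD addrA; exact: sg_fW.
  by elim: r => //= r <-; rewrite (Sf _ _ (itW r)).
rewrite linear_sum big1 // => r _ /=; have [ew wW wk] := wP r.
rewrite (Sfd _ _ _ wW); suff -> : S (w r) = 0.
  exact: fdivr0.
set nu := mu + al *+ r in wW wk *.
have [->|w0] := eqVneq (w r) 0; first exact: linear0.
have hnu := wk w0; have SwW := SW _ _ wW.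
have hD : h (nu + s) = h nu + h s by case: g.
have [k0|k0] := eqVneq (h nu) 0; last by apply: sg_out SwW _; rewrite hD; lia.
have [s2|s2] := eqVneq (h s) 2; last by apply: sg_out SwW _; rewrite hD; lia.
have := sg_ef SwW; rewrite (Sf _ _ wW) (hw0_f wW k0 ew) !linear0.
rewrite (sg_eout SwW) ?hD ?k0 ?s2 // linear0 add0r => /esym/eqP.
by rewrite scaler_eq0 (negPf two) => /eqP.
Qed.

Definition kasE_spec (Et Ft : 'End(M)) :=
  forall mu w r, w \in W mu -> e w = 0 -> w != 0 -> (r%:Z <= h mu) ->
  Et (fdiv r w) = (if r is r'.+1 then fdiv r' w else 0) /\
  Ft (fdiv r w) = fdiv r.+1 w.

(** On strings of length 1 or 2 the operators e and f already are the Kashiwara operators. On w, f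
    w, f^(2) w they differ only at the middle: e f w = [2] w and f f w = [2] f^(2) w. The middle has
    weight 0, and the other vectors w of weight 0 form strings of length 1, on which e and f
    vanish. *)
Lemma kashiwara_ops (D : 'End(M)) :
  (forall mu u, u \in W mu ->
     D u = (if h mu == 0 then (br y 2)^-1 else 1) *: u) ->
  kasE_spec (e \o D)%VF (f \o D)%VF.
Proof.
move=> DE mu w r wW ew w0 rk; rewrite !comp_lfunE.
have hk : h mu <= 2.
  case: g => _ _ hW _ _ _;
  by have /andP[] := hW _ _ wW w0.
have fW := sg_fW wW; have ffW := sg_fW fW.
have efw : e (f w) = br y (h mu) *: w by rewrite (sg_ef wW) ew linear0 add0r.
case: r rk => [|[|[|r]]] rk; last by move: rk hk; clear; lia.
- rewrite fdiv0 fdiv1 (DE _ _ wW) !linearZ /= ew scaler0; split=> //.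
  case: eqP => [k0|_]; last by rewrite scale1r.
  by rewrite (hw0_f wW) ?scaler0.
- rewrite fdiv1 fdiv0 fdiv2 (DE _ _ fW) !linearZ /= efw sg_hsub scalerA.
  have [k1|k2] : h mu = 1 \/ h mu = 2 by move: rk hk; clear; lia.
    by rewrite k1 br1 // mul1r scale1r (sg_ffout wW) ?k1 ?scaler0.
  by rewrite k2 subrr eqxx mulVf // scale1r.
- have k2 : h mu = 2 by move: rk hk; clear; lia.
  rewrite fdiv2 fdiv1 linearZ /= (DE _ _ ffW) !sg_hsub k2 scale1r !linearZ /=.
  rewrite (sg_fout ffW) ?sg_hsub ?k2 // scaler0 /fdiv /= (sg_fout ffW) ?sg_hsub ?k2 //.
  rewrite scaler0 (sg_ef fW) efw linearZ /= sg_hsub k2 subrr br0 scale0r addr0.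
  by rewrite scalerA mulVf // scale1r.
Qed.

End Strings.

(** This is [serre] with q_i, x_i, x_j and 1 - a_ij made free parameters; [serre] unfolds to it. *)
Definition sserre (e xj : 'End(M)) (m : nat) (u : M) : M :=
  \sum_(r < m.+1) (-1) ^+ r *:
    ((qfact y r)^-1 *: iter r e (xj ((qfact y (m - r))^-1 *: iter (m - r) e u))).

Lemma sserre1 e xj u : sserre e xj 1 u = xj (e u) - e (xj u).
Proof.
rewrite /sserre !big_ord_recl big_ord0 /= !qfact0 !qfact1 // /bump /=.
by rewrite !invr1 !scale1r addr0 expr1 scaleN1r.
Qed.

Lemma sserre2 e xj u : sserre e xj 2 u =
  (br y 2)^-1 *: xj (e (e u)) - e (xj (e u)) + (br y 2)^-1 *: e (e (xj u)).
Proof.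
rewrite /sserre !big_ord_recl big_ord0 /= !qfact0 !qfact1 ?qfact2 // /bump /=.
rewrite !invr1 !scale1r addr0 !lfunZ addrA expr1 expr2 mulrNN mulr1.
by rewrite !scale1r scaleN1r.
Qed.

(** In bounded weights every e^3 vanishes, so the two outer terms drop and the factor 1/[3]! is
    never evaluated. *)
Lemma sserre3 (e xj : 'End(M)) u : e (e (e u)) = 0 -> e (e (e (xj u))) = 0 ->
  sserre e xj 3 u =
  (br y 2)^-1 *: (e (e (xj (e u))) - e (xj (e (e u)))).
Proof.
move=> eee eeex.
rewrite /sserre !big_ord_recl big_ord0 /= !qfact0 !qfact1 ?qfact2 // /bump /=.
rewrite !invr1 !scale1r addr0 !lfunZ eee eeex !(linear0, scaler0) add0r addr0.
rewrite expr1 expr2 mulrNN mulr1 scale1r scaleN1r.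
by rewrite scalerBr addrC.
Qed.

Lemma serre_eq0 (T : zmodType) (h : T -> int) (al be : T) (W : T -> {vspace M})
    (e f xj : 'End(M)) (m : nat) :
  sl2_graded h al W e f -> (m = 1 \/ m = 2 \/ m = 3)%N -> h be = 1 - m%:Z ->
  (forall mu u, u \in W mu -> xj u \in W (mu + be)) ->
  (forall u, f (xj u) = xj (f u)) ->
  forall mu u, u \in W mu -> sserre e xj m u = 0.
Proof.
move=> g mE hbe xW fx mu u uW.
have two : br y 2 != 0 by rewrite br2.
have hD := let: Sl2Graded hD _ _ _ _ _ := g in hD.
have feE nu v : v \in W nu -> f (e v) = e (f v) - br y (h nu) *: v by exact: (sg_fe g).
have feeE nu v : v \in W nu ->
    f (e (e v)) = e (e (f v)) - (br y 2 * br y (h nu + 1)) *: e v.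
  move=> vW; rewrite (feE _ _ (sg_eW g vW)) (feE _ _ vW) (sg_hal g) -br_rec //.
  by vec_field.
have eW nu v : v \in W nu -> e v \in W (nu + al) by exact: (sg_eW g).
have hal : h al = 2 by case: g.
have h0 : h 0 = 0 by have := hD 0 0; rewrite addr0; lia.
have hX k : h (al *+ k) = 2 * k%:Z.
  by elim: k => [|k IH]; rewrite ?mulr0n ?h0 ?mulrSr ?hD ?IH ?hal; lia.
have hs : 2 <= h (be + al *+ m) by rewrite hD hX hbe; case: mE => [->|[]->].
have eee nu v : v \in W nu -> e (e (e v)) = 0.
  move=> vW; have vW1 := eW _ _ vW; have vW2 := eW _ _ vW1.
  have [k|k] := lerP (-1) (h nu); first by rewrite (sg_eeout g vW) // linear0.
  have [k2|k2] := lerP (-2) (h nu).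
    by apply: (sg_eout g) vW2 _; rewrite !(sg_hal g); lia.
  by rewrite (sg_out g vW) ?linear0 // !negb_and -ltNge k2.
(* [commuting_f_eq0] needs an endomorphism, whereas [sserre] is a bare function; for m = 3 the two
   are matched only on weight spaces, where e^3 = 0. *)
have [S SE] : exists S : 'End(M), forall nu v, v \in W nu -> S v = sserre e xj m v.
  case: mE => [->|[]->].
  - exists ((xj \o e) - (e \o xj))%VF => nu v vW.
    by rewrite sserre1 add_lfunE opp_lfunE !comp_lfunE.
  - exists ((br y 2)^-1 *: (xj \o e \o e) - (e \o xj \o e)
            + (br y 2)^-1 *: (e \o e \o xj))%VF => nu v vW.
    by rewrite sserre2 !(add_lfunE, opp_lfunE, comp_lfunE, scale_lfunE).
  - exists ((br y 2)^-1 *: ((e \o e \o xj \o e) - (e \o xj \o e \o e)))%VF => nu v vW.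
    rewrite sserre3 ?(eee _ _ vW) ?(eee _ _ (xW _ _ vW)) //.
    by rewrite !(add_lfunE, opp_lfunE, comp_lfunE, scale_lfunE).
suff : S u = 0 by rewrite (SE _ _ uW).
have SW nu v : v \in W nu -> S v \in W (nu + (be + al *+ m)).
  have iW r w nu' : w \in W nu' -> iter r e w \in W (nu' + al *+ r).
    move=> wW; elim: r => [|r IH]; first by rewrite addr0.
    by rewrite iterS mulrSr addrA; exact: eW.
  move=> vW; rewrite (SE _ _ vW) /sserre memv_suml // => r _.
  rewrite !memvZ // (_ : nu + _ = nu + al *+ (m - r) + be + al *+ r).
    by apply: (iW); apply: xW; rewrite memvZ // iW.
  have /subnK E : (r <= m)%N by rewrite -ltnS.
  by rewrite -{1}E mulrnDr -!addrA; congr (_ + _); rewrite addrCA.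
apply: (commuting_f_eq0 g hs SW) uW => nu v vW.
have fvW := sg_fW g vW.
rewrite (SE _ _ vW) (SE _ _ fvW); set k := h nu.
have vW1 := eW _ _ vW.
have xvW := xW _ _ vW.
have xevW := xW _ _ vW1.
have hk : v != 0 -> -2 <= k <= 2 by case: g => _ _ hW _ _ _; exact: hW.
have [v0|v0] := eqVneq v 0.
  by rewrite -(SE _ _ vW) -(SE _ _ fvW) v0 !linear0.
have {}hk := hk v0.
case: mE hbe => [->|[]->] hbe.
- rewrite !sserre1 linearB /= fx (feE _ _ vW) (feE _ _ xvW) hD hbe subrr addr0 fx.
  by vec_field.
- rewrite !sserre2 !(linearD, linearN, linearZ) /= fx (feeE _ _ vW) (feeE _ _ xvW).
  rewrite (feE _ _ xevW) !fx (feE _ _ vW) !hD hbe hal -/k.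
  have -> : k + 2 + (1 - 2) = k + 1 by ring.
  have -> : k + (1 - 2) + 1 = k by ring.
  by vec_field.
- rewrite !sserre3 ?(eee _ _ vW) ?(eee _ _ xvW) ?(eee _ _ fvW) ?(eee _ _ (xW _ _ fvW)) //.
  rewrite lfunZ linearB /=; congr (_ *: _).
  rewrite (feeE _ _ xevW) fx (feE _ _ vW) (feE _ _ (xW _ _ (eW _ _ vW1))) fx.
  rewrite (feeE _ _ vW) !hD hbe hal -/k.
  have -> : k + 2 + (1 - 3) + 1 = k + 1 by ring.
  have -> : k + 2 + 2 + (1 - 3) = k + 2 by ring.
  rewrite !(linearB, linearZ) /= !scalerN !opprK.
  (* In the commutator with f the multiples of e xj e v cancel and two end terms remain. The vector
     xj v has weight k - 2, hence vanishes for k < 0; for k > 0 the weight k + 2 of e e xj v is too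
     large; at k = 0 the coefficient is [0]. *)
  have -> : br y k *: e (e (xj v)) = 0.
    have [->|k0] := eqVneq k 0; first by rewrite br0 scale0r.
    suff -> : e (e (xj v)) = 0 by rewrite scaler0.
    have [kn|kp] := ltP k 0.
      suff -> : xj v = 0 by rewrite !linear0.
      by apply: (sg_out g xvW); rewrite hD hbe -/k; move: kn; clear; lia.
    apply: (sg_out g (eW _ _ (eW _ _ xvW))); rewrite !hD hbe hal -/k.
    by move: kp k0; clear; lia.
  (* For k > -2 the weight k + 4 of e e v is too large; at k = -2 the coefficient is [0]. *)
  have -> : br y (k + 2) *: xj (e (e v)) = 0.
    have [k0|k0] := eqVneq k (-2); first by rewrite k0 addNr br0 scale0r.
    suff -> : xj (e (e v)) = 0 by rewrite scaler0.
    by rewrite (sg_eeout g vW) ?linear0 //; move: hk k0; clear; lia.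
  by vec_field.
Qed.

End Sl2.

(** * Semisimplicity from an anisotropic polarization *)

Section Semisimple.
Variables (K : fieldType) (q : K) (t : affine_type) (n : nat) (M : vectType K).
Variables (rho : uq_rep q t n M) (form : M -> M -> K).
Hypothesis pol : polarization rho form.
Hypothesis aniso : forall u, form u u = 0 -> u = 0.

Let formC u v : form u v = form v u. Proof. exact: pol_sym pol u v. Qed.

Let formDl u u' v : form (u + u') v = form u v + form u' v.
Proof. by have := pol_lin pol 1 u u' v; rewrite scale1r mul1r. Qed.

Let form0l v : form 0 v = 0.
Proof. by apply: (addrI (form 0 v)); rewrite -formDl !addr0. Qed.

Let formZl a u v : form (a *: u) v = a * form u v.
Proof. by have := pol_lin pol a u 0 v; rewrite addr0 form0l addr0. Qed.

Let form_sumr I (r : seq I) (P : pred I) (F : I -> M) u :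
  form u (\sum_(i <- r | P i) F i) = \sum_(i <- r | P i) form u (F i).
Proof.
by apply: (big_morph (form u)) => [x y|]; rewrite formC ?form0l // formDl !(formC _ u).
Qed.

(** The adjoint of each generator is again a product of generators up to a scalar, hence preserves
    U, so the orthogonal complement is a submodule; anisotropy makes the intersection zero. *)
Lemma orthocomplement (U : {vspace M}) : submodule rho U ->
  exists V : {vspace M}, [/\ submodule rho V, (U :&: V = 0)%VS & (U + V = fullv)%VS].
Proof.
move=> subU; pose g (v : M) : 'rV[K]_(\dim U) := \row_j form (vbasis U)`_j v.
have glin : linear g.
  move=> a u v; apply/rowP => j; rewrite !mxE.
  by rewrite formC formDl formZl !(formC _ (vbasis U)`_j).
pose gL := GRing.isLinear.Build _ _ _ _ g glin.
pose g' : {linear M -> 'rV[K]_(\dim U)} := HB.pack g gL.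
pose V := lker (linfun g').
have VP v : reflect (forall u, u \in U -> form u v = 0) (v \in V).
  apply: (iffP idP) => [|orth].
    rewrite memv_ker lfunE /= => /eqP gv u /coord_vbasis ->.
    rewrite formC form_sumr big1 // => j _; rewrite formC formZl.
    by have /rowP/(_ j) := gv; rewrite !mxE => ->; rewrite mulr0.
  rewrite memv_ker lfunE /=; apply/eqP/rowP => j; rewrite !mxE.
  by apply: orth; apply: vbasis_mem; rewrite mem_nth ?size_tuple.
have UV : (U :&: V = 0)%VS.
  apply/eqP; rewrite -subv0; apply/subvP => u; rewrite memv_cap => /andP[uU /VP uV].
  by rewrite memv0; apply/eqP/aniso/uV.
exists V; split=> //.
  move=> v /VP vV; split=> [h|i]; last split.
  - apply/VP => u uU; rewrite -(pol_qh pol); apply: vV.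
    by have [] := subU u uU.
  - apply/VP => u uU; rewrite formC (pol_e pol) formC formZl vV ?mulr0 //.
    have [_ /(_ i)[_ fU]] := subU _ uU.
    by rewrite /utV; have [/(_ (- tco t i))] := subU _ fU.
  - apply/VP => u uU; rewrite formC (pol_f pol) formC formZl vV ?mulr0 //.
    have [_ /(_ i)[eU _]] := subU _ uU.
    by rewrite /ut; have [/(_ (tco t i))] := subU _ eU.
(* The map [g'] has values in a space of dimension dim U, so its kernel V has at least the
   complementary dimension. *)
apply/eqP; rewrite eqEdim subvf /= dimv_disjoint_sum //.
have := limg_ker_dim (linfun g') fullv; rewrite capfv -/V => <-.
rewrite addnC leq_add2r (leq_trans (dimvS (subvf _))) // dimvf.
by rewrite /dim /= mul1n.
Qed.

Lemma submodule_cap U V : submodule rho U -> submodule rho V -> submodule rho (U :&: V).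
Proof.
move=> sU sV u; rewrite memv_cap => /andP[/sU[hU efU] /sV[hV efV]].
split=> [h|i]; first by rewrite memv_cap hU hV.
by rewrite !memv_cap; case: (efU i) (efV i) => -> -> [-> ->].
Qed.

(** Induction on a bound for the dimension: a nonzero U that is not simple splits into a submodule
    and its orthogonal complement inside U. Simplicity is decided by excluded middle. *)
Lemma semisimple_submodule d (U : {vspace M}) : (\dim U <= d)%N -> submodule rho U ->
  exists (k : nat) (V : 'I_k -> {vspace M}),
    [/\ forall j, simple_submodule rho (V j),
        directv (\sum_j V j) & (\sum_j V j)%VS = U].
Proof.
elim: d U => [|d IHd] U dU sU.
  exists 0%N, (fun=> 0%VS); split=> [[]//||]; first by rewrite directvE /= !big_ord0 dimv0.
  by rewrite big_ord0; apply/esym/eqP; rewrite -dimv_eq0 -leqn0.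
have [U0|U0] := eqVneq U 0%VS; first by apply: IHd => //; rewrite U0 dimv0.
have [simU|nsimU] := classic (simple_submodule rho U).
  exists 1%N, (fun=> U); split=> //; last by rewrite big_ord1.
  by rewrite directvE /= !big_ord1.
have [W [sW WU W0 WneU]] : exists W : {vspace M},
    [/\ submodule rho W, (W <= U)%VS, W <> 0%VS & W <> U].
  apply: NNPP => nW; apply: nsimU; split=> //; first exact/eqP.
  move=> W sW WU; apply: NNPP => /not_or_and[W0 WneU]; apply: nW.
  by exists W.
have [C [sC WC0 WCf]] := orthocomplement sW.
pose W' := (U :&: C)%VS.
have WW'0 : (W :&: W' = 0)%VS.
  apply/eqP; rewrite -subv0 -WC0 capvS //; exact: capvSr.
have WW' : (W + W' = U)%VS.
  rewrite /W' capvC; have := vspace_modl C WU.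
  by rewrite WCf capfv => ->.
have dWW' : (\dim W + \dim W' = \dim U)%N by rewrite -dimv_disjoint_sum // WW'.
have dW : (0 < \dim W)%N by rewrite lt0n dimv_eq0; apply/eqP.
have dW' : (0 < \dim W')%N.
  rewrite lt0n dimv_eq0; apply/eqP => W'0; apply: WneU.
  by rewrite -WW' W'0 addv0.
have [|k1 [V1 [s1 d1 e1]]] := IHd W _ sW; first by lia.
have [|k2 [V2 [s2 d2 e2]]] := IHd W' _ (submodule_cap sU sC); first by lia.
exists (k1 + k2)%N, (fun j => match split j with inl a => V1 a | inr b => V2 b end).
have Es : (\sum_(j < k1 + k2) match split j with inl a => V1 a | inr b => V2 b end)%VS = U.
  rewrite big_split_ord /= -WW' -e1 -e2; congr (_ + _)%VS; apply: eq_bigr => j _.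
    by rewrite (unsplitK (inl j)).
  by rewrite (unsplitK (inr j)).
split=> //; first by move=> j; case: (split j).
rewrite directvE /= Es -dWW' -e1 -e2 (directvP d1) (directvP d2) big_split_ord /=.
apply/eqP; congr (_ + _)%N; apply: eq_bigr => j _.
  by rewrite (unsplitK (inl j)).
by rewrite (unsplitK (inr j)).
Qed.

Lemma anisotropic_semisimple : semisimple rho.
Proof.
apply: (@semisimple_submodule (\dim {:M})) => // u _; split=> [h|i]; first exact: memvf.
by split; exact: memvf.
Qed.

End Semisimple.

(** * Rational functions regular at 0 *)

Lemma qs_neq0 : qs != 0.
Proof. by rewrite /qs tofrac_eq0 polyX_eq0. Qed.

Lemma qsX_neq1 k : (0 < k)%N -> qs ^+ k != 1.
Proof.
move=> k0; rewrite /qs -rmorphXn -(rmorph1 (@tofrac {poly rat})) tofrac_eq.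
apply/eqP => /(congr1 (fun u : {poly rat} => u.[0])).
by rewrite hornerXn hornerC expr0n eqn0Ngt k0 => /eqP; rewrite eq_sym oner_eq0.
Qed.

Section Regular.

Let nz (v : {poly rat}) : v.[0] != 0 -> tofrac v != 0.
Proof. by move=> v0; rewrite tofrac_eq0; apply: contraNneq v0 => ->; rewrite horner0. Qed.

Lemma regular0_poly u : regular0 (tofrac u).
Proof. by exists u, 1; rewrite hornerC oner_neq0 rmorph1 divr1. Qed.

Lemma regular0_0 : regular0 0.
Proof. by rewrite -(rmorph0 (@tofrac {poly rat})); exact: regular0_poly. Qed.
Lemma regular0_1 : regular0 1.
Proof. by rewrite -(rmorph1 (@tofrac {poly rat})); exact: regular0_poly. Qed.
Lemma regular0_qsX k : regular0 (qs ^+ k).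
Proof. by rewrite -rmorphXn; exact: regular0_poly. Qed.

Lemma regular0D x y : regular0 x -> regular0 y -> regular0 (x + y).
Proof.
move=> [u [v [v0 ->]]] [u' [v' [v'0 ->]]].
exists (u * v' + u' * v), (v * v'); rewrite hornerM mulf_neq0 //; split=> //.
by rewrite addf_div ?nz // rmorphD !rmorphM.
Qed.

Lemma regular0M x y : regular0 x -> regular0 y -> regular0 (x * y).
Proof.
move=> [u [v [v0 ->]]] [u' [v' [v'0 ->]]].
exists (u * u'), (v * v'); rewrite hornerM mulf_neq0 //; split=> //.
by rewrite mulf_div !rmorphM.
Qed.

Lemma regular0N x : regular0 x -> regular0 (- x).
Proof.
move=> rx; rewrite -mulN1r; apply: regular0M => //.
by rewrite -(rmorph1 (@tofrac {poly rat})) -rmorphN; exact: regular0_poly.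
Qed.

Lemma regular0_sum I (r : seq I) (P : pred I) (c : I -> Qqs) :
  (forall i, regular0 (c i)) -> regular0 (\sum_(i <- r | P i) c i).
Proof.
by move=> rc; elim/big_ind: _ => //; [exact: regular0_0 | exact: regular0D].
Qed.

Lemma regular0_1DqsXV k : (0 < k)%N -> regular0 (1 + qs ^+ k)^-1.
Proof.
move=> k0; exists 1, (1 + 'X^k).
rewrite hornerD hornerXn hornerC expr0n eqn0Ngt k0 addr0 oner_neq0; split=> //.
by rewrite rmorphD rmorphXn rmorph1 div1r.
Qed.

(** The residue field at q_s = 0 is Q: with c = u(0)/v(0) the polynomial u - c v vanishes at 0,
    hence is divisible by X. *)
Lemma regular0_residue x : regular0 x ->
  exists c y, regular0 y /\ x = ratc c + qs * y.
Proof.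
move=> [u [v [v0 ->]]]; pose c := u.[0] / v.[0].
have : root (u - c%:P * v) 0.
  by rewrite /root !(hornerE, hornerN) /c divfK ?subrr.
move/factor_theorem => [w]; rewrite subr0 => wE.
exists c, (tofrac w / tofrac v); split; first by exists w, v.
have -> : u = c%:P * v + w * 'X by rewrite -wE addrC subrK.
rewrite tofracD !tofracM mulrDl mulfK ?nz //; congr (_ + _).
by rewrite mulrA [qs * _]mulrC.
Qed.

(** Uniqueness of the residue, by clearing the denominator and evaluating at 0. *)
Lemma ratc_qs c x : regular0 x -> ratc c = qs * x -> c = 0.
Proof.
move=> [u [v [v0 ->]]] /(congr1 (fun z => z * tofrac v)).
rewrite -mulrA divfK ?nz // -!rmorphM => /eqP; rewrite tofrac_eq => /eqP.
move/(congr1 (fun u : {poly rat} => u.[0])); rewrite !hornerE => /eqP.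
by rewrite ?mul0r mulf_eq0 (negPf v0) orbF => /eqP.
Qed.

End Regular.

(** At each rational point the values are rationals whose squares sum to zero, so every rational is
    a root of each p_i, more roots than a nonzero polynomial can have. *)
Lemma poly_sum_sqr_eq0 (I : finType) (p : I -> {poly rat}) :
  \sum_i p i ^+ 2 = 0 -> forall i, p i = 0.
Proof.
move=> p0 i; apply/eqP/negPn/negP => pi0.
have roots a : root (p i) a.
  have := congr1 (fun u : {poly rat} => u.[a]) p0; rewrite horner_sum horner0.
  move/eqP; rewrite psumr_eq0; last by move=> j _; rewrite horner_exp sqr_ge0.
  by move/allP/(_ i (mem_index_enum _)); rewrite horner_exp sqrf_eq0.
have := max_poly_roots pi0 (rs := [seq k%:R | k <- iota 0 (size (p i))]).
rewrite size_map size_iota ltnn => H; suff : false by []; apply: H.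
  by apply/allP => a _; apply: roots.
rewrite map_inj_uniq ?iota_uniq //; exact: mulrIn (oner_neq0 _).
Qed.

Lemma fraction_numden (R : idomainType) (x : {fraction R}) :
  exists u v : R, v != 0 /\ tofrac v * x = tofrac u.
Proof.
elim/quotP: x => r _; exists r.1, r.2; split; first exact: denom_ratioP.
unlock FracField.tofrac; rewrite -[LHS]FracField.pi_mul.
apply/eqmodP; rewrite /= FracField.equivfE /FracField.mulf.
by rewrite !numden_Ratio ?mulf_neq0 ?denom_ratioP ?oner_neq0 // mulr1 mul1r.
Qed.

Lemma common_denominator (R : idomainType) (I : finType) (c : I -> {fraction R}) :
  exists (d : R) (p : I -> R), d != 0 /\ forall i, tofrac d * c i = tofrac (p i).
Proof.
have /fin_all_exists2[u uP] i : exists2 uv : R * R,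
    uv.2 != 0 & tofrac uv.2 * c i = tofrac uv.1.
  by have [u [v [v0 vc]]] := fraction_numden (c i); exists (u, v).
move=> cE; exists (\prod_i (u i).2), (fun i => (u i).1 * \prod_(j | j != i) (u j).2).
split; first by apply/prodf_neq0 => i _; apply: uP.
by move=> i; rewrite (bigD1 i) //= !rmorphM /= mulrAC cE.
Qed.

(** A common denominator reduces this to polynomials; it is what makes [bform] anisotropic. *)
Lemma Qqs_sum_sqr_eq0 (I : finType) (c : I -> Qqs) :
  \sum_i c i ^+ 2 = 0 -> forall i, c i = 0.
Proof.
move=> c0 i; have [d [p [d0 dp]]] := common_denominator c.
have /poly_sum_sqr_eq0/(_ i) : \sum_i p i ^+ 2 = 0.
  apply/eqP; rewrite -tofrac_eq0 rmorph_sum /=.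
  under eq_bigr do rewrite rmorphXn /= -dp exprMn.
  by rewrite -mulr_sumr c0 mulr0.
move=> pi0; have /eqP := dp i.
by rewrite pi0 rmorph0 mulf_eq0 tofrac_eq0 (negPf d0) => /eqP.
Qed.

(** * Coordinates *)

Section Coordinates.
Variables (K : fieldType) (M : vectType K) (X : finType) (b : X -> M).

Definition bcoord (x : X) (u : M) : K :=
  coord [tuple of [seq b x | x : X]] (enum_rank x) u.

Lemma bcoordD x u v : bcoord x (u + v) = bcoord x u + bcoord x v.
Proof. exact: linearD. Qed.
Lemma bcoordZ x a u : bcoord x (a *: u) = a * bcoord x u.
Proof. exact: linearZ. Qed.
Lemma bcoordB x u v : bcoord x (u - v) = bcoord x u - bcoord x v.
Proof. exact: linearB. Qed.
Lemma bcoord0 x : bcoord x 0 = 0.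
Proof. exact: linear0. Qed.
Lemma bcoord_suml x I (r : seq I) (P : pred I) (F : I -> M) :
  bcoord x (\sum_(i <- r | P i) F i) = \sum_(i <- r | P i) bcoord x (F i).
Proof. exact: linear_sum. Qed.

Hypothesis b_basis : basis_of fullv [seq b x | x : X].

Let nthb (j : 'I_#|X|) : [tuple of [seq b x | x : X]]`_j = b (enum_val j).
Proof. by rewrite /= (nth_map (enum_val j)) -?cardE // -enum_val_nth. Qed.

Lemma bcoord_b x y : bcoord x (b y) = (x == y)%:R.
Proof.
have := basis_free b_basis => fr; rewrite /bcoord -[y in b y]enum_rankK -nthb.
by rewrite (coord_free _ _ fr) (inj_eq enum_rank_inj) eq_sym.
Qed.

Lemma bcoord_sum u : u = \sum_x bcoord x u *: b x.
Proof.
have -> : \sum_x bcoord x u *: b x =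
    \sum_(j < #|X|) bcoord (enum_val j) u *: b (enum_val j).
  rewrite (reindex (fun j : 'I_#|X| => enum_val j)) //.
  by apply: onW_bij; exact: enum_val_bij.
rewrite {1}(coord_basis b_basis (memvf u)); apply: eq_bigr => j _.
by rewrite -nthb /bcoord enum_valK.
Qed.

Lemma bcoord_lincomb x (c : X -> K) : bcoord x (\sum_y c y *: b y) = c x.
Proof.
rewrite bcoord_suml (bigD1 x) //= big1 => [|y yx]; rewrite bcoordZ bcoord_b.
  by rewrite eqxx mulr1 addr0.
by rewrite eq_sym (negPf yx) mulr0.
Qed.

Lemma bcoord_inj u v : (forall x, bcoord x u = bcoord x v) -> u = v.
Proof.
move=> uv; rewrite [u]bcoord_sum [v]bcoord_sum; apply: eq_bigr => x _.
by rewrite uv.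
Qed.

Lemma lfun_bsum (f : 'End(M)) u : f u = \sum_x bcoord x u *: f (b x).
Proof.
rewrite {1}[u]bcoord_sum linear_sum; apply: eq_bigr => x _ /=; exact: lfunZ.
Qed.

Lemma lfun_bext (f g : 'End(M)) : (forall x, f (b x) = g (b x)) -> f = g.
Proof.
by move=> fg; apply/lfunP => u; rewrite !lfun_bsum; apply: eq_bigr => x _; rewrite fg.
Qed.

Definition bop (g : X -> M) : 'End(M) := linfun (fun u => \sum_x bcoord x u *: g x).

Lemma bopE g x : bop g (b x) = g x.
Proof.
rewrite /bop; set h := fun u : M => _.
have hlin : linear h.
  move=> a u v; rewrite /h scaler_sumr -big_split; apply: eq_bigr => i _ /=.
  by rewrite bcoordD bcoordZ scalerDl scalerA.
pose hL := GRing.isLinear.Build _ _ _ _ h hlin.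
pose h' : {linear M -> M} := HB.pack h hL.
rewrite (lfunE h') /= /h (bigD1 x) //= bcoord_b eqxx scale1r.
by rewrite big1 ?addr0 // => y yx; rewrite bcoord_b (negPf yx) scale0r.
Qed.

Section Weights.
Variables (T : zmodType) (wt : X -> T).

(** Built from the labels alone, so that it is available before the q^h are defined;
    [weight_vectorP] later identifies it with the weight space of the representation. *)
Definition wspace (mu : T) : {vspace M} := (\sum_(x | wt x == mu) <[b x]>)%VS.

Lemma wspaceP mu u : reflect (forall x, bcoord x u != 0 -> wt x = mu) (u \in wspace mu).
Proof.
apply: (iffP idP) => [/memv_sumP[v vb ->] x|uW].
  rewrite bcoord_suml; apply: contraNeq => xmu; rewrite big1 // => y ymu.
  have /vlineP[a ->] := vb y ymu; rewrite bcoordZ bcoord_b.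
  by case: (eqVneq x y) xmu => [->|_]; rewrite ?mulr0 // ymu.
rewrite [u]bcoord_sum memv_suml // => x _.
have [->|/uW wx] := eqVneq (bcoord x u) 0; first by rewrite scale0r mem0v.
by apply/memvZ/(subvP (sumv_sup x _ (subvv _))); rewrite ?wx ?memv_line.
Qed.

Lemma b_wspace x : b x \in wspace (wt x).
Proof. by apply/wspaceP => y; rewrite bcoord_b; case: (eqVneq y x) => [->|_] //; rewrite eqxx. Qed.

End Weights.
End Coordinates.

(** * Modules with a basis of weight vectors *)

Lemma cartan_diag t n i : cartan t n i i = 2.
Proof. by rewrite /cartan eqxx. Qed.

Lemma cartan_off t n i j : i != j ->
  cartan t n i j = 0 \/ cartan t n i j = -1 \/ cartan t n i j = -2.
Proof.
rewrite /cartan => /negPf ->; case: t => /=;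
  by repeat (case: ifP => _ /=; auto).
Qed.

Lemma dnorm_gt0 t n i : (i <= n)%N -> (0 < dnorm t n i)%N.
Proof.
move=> lin; have : (0 < dnorm t n i * mark t n i)%N; last by rewrite muln_gt0 => /andP[].
rewrite dnorm_exact // muln_gt0; apply/andP; split.
  rewrite /dlcm; elim/big_ind: _ => // [x y x0 y0|j _]; first by rewrite lcmn_gt0 x0.
  by rewrite divn_gt0 ?gcdn_gt0 ?mark_gt0 // dvdn_leq ?dvdn_gcdl ?mark_gt0.
by case: (t) => /=; repeat case: ifP.
Qed.

Section BasedRep.
Variables (K : fieldType) (q : K) (t : affine_type) (n : nat) (M : vectType K).
Variables (X : finType) (b : X -> M) (wt : X -> weight n) (E F : 'I_n.+1 -> 'End(M)).
Implicit Types (h : coweight n) (mu : weight n) (i j : 'I_n.+1) (x y : X).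

Local Notation y i := (qi q t n (nat_of_ord i)).

(* [sl_pol] is (e_i u, v) = (u, q_i^-1 t_i^-1 f_i v) for the form in which b is
   orthonormal. *)
Record spin_like : Prop := SpinLike {
  sl_basis : basis_of fullv [seq b x | x : X];
  sl_bound : forall x i, -2 <= wt x i <= 2;
  sl_E : forall j x x', bcoord b x' (E j (b x)) != 0 -> wt x' = wt x + cl_root t j;
  sl_EF : forall i j x, E i (F j (b x)) - F j (E i (b x)) =
    if i == j then br (y i) (wt x i) *: b x else 0;
  sl_pol : forall i x x', bcoord b x' (E i (b x)) =
    (y i)^-1 * y i ^ (- wt x i) * bcoord b x (F i (b x')) }.

Hypotheses (q0 : q != 0) (qX : forall k, (0 < k)%N -> q ^+ k != 1).

Lemma qi_neq0 i : y i != 0.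
Proof. exact: expf_neq0. Qed.

Lemma qi_expr_neq1 i k : (0 < k)%N -> y i ^+ k != 1.
Proof.
by move=> k0; rewrite /qi -exprM qX // muln_gt0 k0 dnorm_gt0 // -ltnS ltn_ord.
Qed.

Lemma qi_sub_neq0 i : y i - (y i)^-1 != 0.
Proof.
have := qi_expr_neq1 i (isT : 0 < 2)%N; apply: contraNneq => /eqP.
rewrite subr_eq0 => /eqP yE; rewrite expr2 {1}yE mulVf ?qi_neq0 //.
Qed.

Lemma qi_add_neq0 i : y i + (y i)^-1 != 0.
Proof.
have := qi_expr_neq1 i (isT : 0 < 4)%N; apply: contraNneq => /eqP.
rewrite addr_eq0 => /eqP yE.
have y2 : y i ^+ 2 = -1 by rewrite expr2 {1}yE mulNr mulVf ?qi_neq0.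
by rewrite (exprM _ 2 2) y2 sqrrN expr1n.
Qed.

Lemma exprz_inj (k l : int) : q ^ k = q ^ l -> k = l.
Proof.
wlog le_lk : k l / l <= k => [H kl|].
  by have [/H->//|/ltW/H->//] := lerP l k.
move=> kl; apply/eqP; rewrite -subr_eq0; apply/negPn/negP => kl0.
have [m mE] : exists m : nat, k - l = m by exists `|k - l|%N; lia.
have m0 : (0 < m)%N by lia.
have := qX m0; rewrite -[q ^+ m]/(q ^ m%:Z) -mE expfzDr // kl -expfzDr //.
by rewrite subrr eqxx.
Qed.

Lemma qpairDl h h' mu : qpair q (h + h') mu = qpair q h mu * qpair q h' mu.
Proof.
rewrite /qpair -expfzDr // -big_split; congr (_ ^ _); apply: eq_bigr => i _.
by rewrite !ffunE mulrDl.
Qed.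

Lemma qpairDr h mu nu : qpair q h (mu + nu) = qpair q h mu * qpair q h nu.
Proof.
rewrite /qpair -expfzDr // -big_split; congr (_ ^ _); apply: eq_bigr => i _.
by rewrite !ffunE mulrDr.
Qed.

Lemma qpair0l mu : qpair q 0 mu = 1.
Proof. by rewrite /qpair big1 // => i _; rewrite !ffunE mul0r. Qed.

Lemma qpair_neq0 h mu : qpair q h mu != 0.
Proof. exact: expfz_neq0. Qed.

Lemma qpair_tco i mu : qpair q (tco t i) mu = y i ^ mu i.
Proof.
rewrite /qpair (bigD1 i) //= big1 => [|j ji]; rewrite ffunE ?eqxx.
  by rewrite addr0 /qi -exprz_exp.
by rewrite (negPf ji) mul0r.
Qed.

Lemma qpairNl h mu : qpair q (- h) mu = (qpair q h mu)^-1.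
Proof.
apply: (mulIf (qpair_neq0 h mu)); rewrite -qpairDl addNr qpair0l mulVf //.
exact: qpair_neq0.
Qed.

Lemma qpair_inj mu nu : (forall h, qpair q h mu = qpair q h nu) -> mu = nu.
Proof.
move=> E'; apply/ffunP => i; apply: exprz_inj.
have := E' [ffun j => (j == i)%:Z]; rewrite /qpair.
have S k : \sum_j [ffun j0 => (j0 == i)%:Z : int] j * k j = k i :> int.
  rewrite (bigD1 i) //= big1 => [|j ji]; rewrite ffunE ?eqxx ?mul1r ?addr0 //.
  by rewrite (negPf ji) mul0r.
by rewrite !S.
Qed.

Section Rep.
Hypothesis sl : spin_like.
Let bB := sl_basis sl.
Let W := wspace b wt.

(** By [sl_pol] the matrix of F_j is, up to invertible factors, the transpose of that of E_j; this
    is why [spin_like] prescribes a weight shift for E only. *)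
Lemma sl_F j x x' : bcoord b x' (F j (b x)) != 0 -> wt x' = wt x - cl_root t j.
Proof.
move=> c0; have := sl_pol sl j x' x; have := @sl_E sl j x' x.
move=> /[swap] ->; rewrite mulf_neq0 ?mulf_neq0 ?invr_eq0 ?expfz_neq0 ?qi_neq0 //.
by move=> ->; rewrite ?addrK.
Qed.

Lemma lfun_wspace (f : 'End(M)) (al : weight n) :
  (forall x x', bcoord b x' (f (b x)) != 0 -> wt x' = wt x + al) ->
  forall mu u, u \in W mu -> f u \in W (mu + al).
Proof.
move=> fE mu u uW; rewrite (lfun_bsum bB) memv_suml // => x _.
have [->|c0] := eqVneq (bcoord b x u) 0; first by rewrite scale0r mem0v.
have <- : wt x = mu by have /(wspaceP bB) := uW; apply.
by apply: memvZ; apply/(wspaceP bB) => x'; exact: fE.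
Qed.

Lemma E_wspace j mu u : u \in W mu -> E j u \in W (mu + cl_root t j).
Proof. by apply: lfun_wspace => x x'; exact: sl_E. Qed.

Lemma F_wspace j mu u : u \in W mu -> F j u \in W (mu - cl_root t j).
Proof. by apply: lfun_wspace => x x'; exact: sl_F. Qed.

Lemma EF_wspace i j mu u : u \in W mu ->
  E i (F j u) - F j (E i u) = if i == j then br (y i) (mu i) *: u else 0.
Proof.
move=> uW; pose C := ((E i \o F j) - (F j \o E i))%VF.
have CE v : E i (F j v) - F j (E i v) = C v by rewrite add_lfunE opp_lfunE !comp_lfunE.
rewrite CE (lfun_bsum bB); have -> : (if i == j then br (y i) (mu i) *: u else 0)
   = \sum_x bcoord b x u *: (if i == j then br (y i) (mu i) *: b x else 0).
  case: eqP => _; last by rewrite big1 // => x _; rewrite scaler0.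
  rewrite {1}[u](bcoord_sum bB) scaler_sumr; apply: eq_bigr => x _.
  by rewrite !scalerA mulrC.
apply: eq_bigr => x _; rewrite -CE (sl_EF sl).
have [->|c0] := eqVneq (bcoord b x u) 0; first by rewrite !scale0r.
by have /(wspaceP bB)/(_ x c0) -> := uW.
Qed.

Lemma sl2_node i : sl2_graded (y i) (fun mu : weight n => mu i) (cl_root t i) W (E i) (F i).
Proof.
split=> [mu nu||mu u uW u0|mu u|mu u|mu u uW].
- by rewrite ffunE.
- by rewrite ffunE cartan_diag.
- have [x c0] : exists x, bcoord b x u != 0.
    apply: NNPP => nx; case/eqP: u0; apply: (bcoord_inj bB) => x.
    by rewrite bcoord0; apply/eqP/negPn/negP => c0; apply: nx; exists x.
  by have /(wspaceP bB)/(_ x c0) <- := uW; exact: sl_bound.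
- exact: E_wspace.
- exact: F_wspace.
- by rewrite (EF_wspace _ _ uW) eqxx.
Qed.

Lemma iter_lfunP (f : 'End(M)) r a u v : iter r f (a *: u + v) = a *: iter r f u + iter r f v.
Proof. by elim: r => //= r ->; rewrite linearP. Qed.

Lemma sserreP (z : K) (e xj : 'End(M)) m a u v :
  sserre z e xj m (a *: u + v) = a *: sserre z e xj m u + sserre z e xj m v.
Proof.
rewrite /sserre scaler_sumr -big_split; apply: eq_bigr => r _ /=.
have cP (c : K) (v1 v2 : M) : c *: (a *: v1 + v2) = a *: (c *: v1) + c *: v2.
  by rewrite scalerDr !scalerA mulrC.
rewrite [iter (m - r) e (_ + _)]iter_lfunP cP.
rewrite linearP iter_lfunP !scalerDr; congr (_ + _).
by rewrite !scalerA; congr (_ *: _); ring.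
Qed.

Lemma serre_wspaces (e : 'I_n.+1 -> 'End(M)) i j :
  (forall mu u, u \in W mu -> serre q t i j e u = 0) -> forall u, serre q t i j e u = 0.
Proof.
move=> H u; rewrite [u](bcoord_sum bB).
elim/big_rec: _ => [|x v _ IH].
  by apply: (H 0); exact: mem0v.
have -> : serre q t i j e (bcoord b x u *: b x + v) =
    bcoord b x u *: serre q t i j e (b x) + serre q t i j e v by exact: sserreP.
rewrite IH addr0 (H (wt x)) ?scaler0 //.
exact: b_wspace.
Qed.

Lemma serre_expo i j : i != j ->
  (let m := `|1 - cartan t n i j|%N in
    (m = 1 \/ m = 2 \/ m = 3)%N /\ cartan t n i j = 1 - m%:Z).
Proof.
move=> ij /=; have {}ij : i != j :> nat by [].
by have [->|[->|->]] := cartan_off t n ij; split; auto.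
Qed.

(** The q^h are defined as diagonal operators with the prescribed eigenvalues. The relations are
    then compared on the basis, except the Serre relations, which come from [serre_eq0] and the
    commutation of E_j with F_i for i != j. *)
Lemma spin_like_rep : exists rho : uq_rep q t n M,
  (forall h x, uqh rho h (b x) = qpair q h (wt x) *: b x) /\
  (forall i, ue rho i = E i /\ uf rho i = F i).
Proof.
pose U h := bop b (fun x => qpair q h (wt x) *: b x).
have UE h x : U h (b x) = qpair q h (wt x) *: b x by rewrite /U bopE.
have UW h mu u : u \in W mu -> U h u = qpair q h mu *: u.
  move=> uW; rewrite (lfun_bsum bB) [in RHS](bcoord_sum bB u) scaler_sumr.
  apply: eq_bigr => x _; rewrite UE scalerA mulrC -scalerA.
  have [->|c0] := eqVneq (bcoord b x u) 0; first by rewrite !scale0r.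
  by have /(wspaceP bB)/(_ x c0) -> := uW.
have bW x : b x \in W (wt x) by exact: b_wspace.
have ext (f g : 'End(M)) u : (forall x, f (b x) = g (b x)) -> f u = g u.
  by move/(lfun_bext bB) ->.
have U0 : U 0 = \1%VF.
  by apply: (lfun_bext bB) => x; rewrite UE qpair0l scale1r id_lfunE.
have UD h h' : U (h + h') = (U h \o U h')%VF.
  by apply: (lfun_bext bB) => x; rewrite comp_lfunE !UE lfunZ UE scalerA qpairDl mulrC.
have Ue h j u : U h (E j u) = qpair q h (cl_root t j) *: E j (U h u).
  rewrite -comp_lfunE -comp_lfunE -scale_lfunE; apply: ext => x.
  rewrite scale_lfunE !comp_lfunE UE lfunZ scalerA.
  by rewrite (UW _ _ _ (E_wspace j (bW x))) qpairDr mulrC.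
have Uf h j u : U h (F j u) = (qpair q h (cl_root t j))^-1 *: F j (U h u).
  rewrite -comp_lfunE -comp_lfunE -scale_lfunE; apply: ext => x.
  rewrite scale_lfunE !comp_lfunE UE lfunZ scalerA.
  rewrite (UW _ _ _ (F_wspace j (bW x))) mulrC; congr (_ *: _).
  have EE := congr1 (qpair q h) (subrK (cl_root t j) (wt x)).
  by apply: (mulIf (qpair_neq0 h (cl_root t j))); rewrite -qpairDr EE divfK ?qpair_neq0.
have EFu i j u : E i (F j u) - F j (E i u) =
    if i == j then (qi q t n i - (qi q t n i)^-1)^-1 *: (U (tco t i) u - U (- tco t i) u)
    else 0.
  pose C := ((E i \o F j) - (F j \o E i))%VF.
  have -> : E i (F j u) - F j (E i u) = C u by rewrite add_lfunE opp_lfunE !comp_lfunE.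
  pose D : 'End(M) := if i == j then (qi q t n i - (qi q t n i)^-1)^-1 *:
     (U (tco t i) - U (- tco t i)) else 0.
  have -> : (if i == j then (qi q t n i - (qi q t n i)^-1)^-1 *:
      (U (tco t i) u - U (- tco t i) u) else 0) = D u.
    by rewrite /D; case: eqP; rewrite ?scale_lfunE ?add_lfunE ?opp_lfunE ?zero_lfunE.
  apply: ext => x; rewrite add_lfunE opp_lfunE !comp_lfunE (sl_EF sl) /D.
  case: eqP => _; last by rewrite zero_lfunE.
  rewrite scale_lfunE add_lfunE opp_lfunE !UE qpair_tco qpairNl qpair_tco -scalerBl scalerA.
  by rewrite /br -invr_expz mulrC.
have se i j u : i != j -> serre q t i j E u = 0.
  move=> ij; have [mE aE] := serre_expo ij; apply: serre_wspaces => mu v vW.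
  have hb : cl_root t j i = 1 - `|1 - cartan t n i j|%N%:Z by rewrite ffunE -aE.
  apply: (serre_eq0 (qi_neq0 i) (qi_sub_neq0 i) (qi_add_neq0 i) (sl2_node i) mE hb _ _ vW).
    exact: E_wspace.
  move=> w; have := EFu j i w; rewrite eq_sym (negPf ij) => /eqP.
  by rewrite subr_eq0 => /eqP ->.
have sf i j u : i != j -> serre q t i j F u = 0.
  move=> ij; have [mE aE] := serre_expo ij; apply: serre_wspaces => mu v vW.
  have g := sl2_graded_swap (sl2_node i).
  apply: (serre_eq0 (be := - cl_root t j) (xj := F j)
            (qi_neq0 i) (qi_sub_neq0 i) (qi_add_neq0 i) g mE _ _ _ vW).
  - by rewrite !ffunE opprK -aE.
  - exact: F_wspace.
  move=> w; have := EFu i j w; rewrite (negPf ij) => /eqP.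
  by rewrite subr_eq0 => /eqP ->.
by exists (UqRep U0 UD Ue Uf EFu se sf).
Qed.

End Rep.
End BasedRep.

(* The Kashiwara operators are e_i and f_i after division of the vectors of
   h_i-weight 0 by [2]_i, see [kashiwara_ops]. *)
Definition kcoef (K : fieldType) (q : K) t n (i : 'I_n.+1) (mu : weight n) : K :=
  if mu i == 0 then (br (qi q t n i) 2)^-1 else 1.

(** * Weight spaces, Kashiwara operators and polarization of a module with a weight basis *)

Section BasedModule.
Variables (K : fieldType) (q : K) (t : affine_type) (n : nat) (M : vectType K).
Variables (X : finType) (b : X -> M) (wt : X -> weight n) (E F : 'I_n.+1 -> 'End(M)).
Hypotheses (q0 : q != 0) (qX : forall k, (0 < k)%N -> q ^+ k != 1).
Hypothesis sl : spin_like q t b wt E F.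
Variable rho : uq_rep q t n M.
Hypothesis rho_h : forall h x, uqh rho h (b x) = qpair q h (wt x) *: b x.
Hypothesis rho_ef : forall i, ue rho i = E i /\ uf rho i = F i.
Implicit Types (mu : weight n) (i : 'I_n.+1) (x : X).

Let bB := sl_basis sl.
Let W := wspace b wt.
Local Notation y i := (qi q t n (nat_of_ord i)).
Let g i := sl2_node q0 sl i.

Lemma bcoord_uqh h x u : bcoord b x (uqh rho h u) = qpair q h (wt x) * bcoord b x u.
Proof.
rewrite (lfun_bsum bB); under eq_bigr do rewrite rho_h scalerA.
by rewrite bcoord_lincomb // mulrC.
Qed.

Lemma weight_vectorP mu u : weight_vector rho mu u <-> u \in W mu.
Proof.
split=> [wu|uW h]; last first.
  apply: (bcoord_inj bB) => x; rewrite bcoord_uqh bcoordZ.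
  have [->|c0] := eqVneq (bcoord b x u) 0; first by rewrite !mulr0.
  by have /(wspaceP bB)/(_ x c0) -> := uW.
apply/(wspaceP bB) => x c0; apply: (qpair_inj q0 qX) => h.
by apply: (mulIf c0); rewrite -bcoord_uqh wu bcoordZ.
Qed.

Definition wcomp mu u := \sum_(x | wt x == mu) bcoord b x u *: b x.

Lemma wcompE mu u x : bcoord b x (wcomp mu u) = if wt x == mu then bcoord b x u else 0.
Proof.
rewrite /wcomp big_mkcond /=.
under eq_bigr => z _ do rewrite
  -[0](scale0r (b z)) -(fun_if (fun c => c *: b z)).
by rewrite bcoord_lincomb.
Qed.

Lemma weight_graded_coord (L : M -> Prop) :
  (forall mu u, L u -> L (wcomp mu u)) -> weight_graded rho L.
Proof.
move=> LW u Lu; exists (undup [seq wt x | x <- enum X]), (fun mu => wcomp mu u).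
split; first exact: undup_uniq.
  move=> mu _; split; first exact: LW.
  by apply/weight_vectorP/(wspaceP bB) => x; rewrite wcompE; case: (eqVneq (wt x) mu) => // _; rewrite eqxx.
apply: (bcoord_inj bB) => x; rewrite bcoord_suml (bigD1_seq (wt x)) ?undup_uniq //=.
  rewrite wcompE eqxx big1 ?addr0 // => mu muE.
  by rewrite wcompE eq_sym (negPf muE).
by rewrite mem_undup map_f // mem_enum.
Qed.

Lemma nilpotent_on_basis (f : 'End(M)) r :
  (forall x, iter r f (b x) = 0) -> forall u, iter r f u = 0.
Proof.
move=> f0 u; rewrite [u](bcoord_sum bB); elim/big_rec: _ => [|x v _ IH].
  by elim: r {f0} => //= r ->; rewrite linear0.
by rewrite iter_lfunP f0 IH scaler0 addr0.
Qed.

Lemma based_integrable : integrable rho.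
Proof.
split; first exact: weight_graded_coord.
(* Three steps of size 2 lead out of the interval [-2, 2] from any of its points. *)
move=> i u; have [-> ->] := rho_ef i; exists 3%N.
have bW x : b x \in W (wt x) by exact: b_wspace.
split; apply: nilpotent_on_basis => x /=.
  apply: (sg_out (g i) (sg_eW (g i) (sg_eW (g i) (sg_eW (g i) (bW x))))).
  rewrite !(sg_hal (g i)); have := sl_bound sl x i; lia.
apply: (sg_out (g i) (sg_fW (g i) (sg_fW (g i) (sg_fW (g i) (bW x))))).
rewrite !(sg_hsub (g i)); have := sl_bound sl x i; lia.
Qed.

Definition kdiag i : 'End(M) := bop b (fun x => kcoef q t i (wt x) *: b x).

Lemma kdiagW i mu u : u \in W mu -> kdiag i u = kcoef q t i mu *: u.
Proof.
move=> uW; rewrite (lfun_bsum bB); apply: (bcoord_inj bB) => x.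
under eq_bigr do rewrite bopE // scalerA.
rewrite bcoord_lincomb // bcoordZ mulrC.
have [->|c0] := eqVneq (bcoord b x u) 0; first by rewrite !mulr0.
by have /(wspaceP bB)/(_ x c0) -> := uW.
Qed.

Lemma based_kashiwara i : kashiwara rho i (E i \o kdiag i)%VF (F i \o kdiag i)%VF.
Proof.
have [eE fE] := rho_ef i.
have dpE r u : divpow q t i (uf rho i) r u = fdiv (y i) (F i) r u by rewrite fE.
have y0 := qi_neq0 t q0 i; have y1 := qi_sub_neq0 t q0 qX i; have y2 := qi_add_neq0 t q0 qX i.
move=> mu u /weight_vectorP uW; split.
  have [w [wP uE]] := string_exists y0 y1 y2 (g i) uW.
  exists 3%N, w; split.
    move=> r _ nu; have [ew wW wr] := wP r; rewrite eE; split=> //.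
    exact/weight_vectorP.
  by rewrite {1}uE; apply: eq_bigr => r _; rewrite dpE.
move=> N w [wP uE].
have key r : (r < N)%N ->
    (E i \o kdiag i)%VF (fdiv (y i) (F i) r (w r)) =
      (if r is r'.+1 then fdiv (y i) (F i) r' (w r) else 0) /\
    (F i \o kdiag i)%VF (fdiv (y i) (F i) r (w r)) = fdiv (y i) (F i) r.+1 (w r).
  move=> /wP[]; rewrite eE => ew /weight_vectorP wW wk.
  have [->|w0] := eqVneq (w r) 0.
    by rewrite !fdivr0 !linear0; split=> //; case: (r) => // r'; rewrite fdivr0.
  apply: (kashiwara_ops y0 y1 y2 (g i) _ wW ew w0 (wk w0)).
  by move=> nu v vW; rewrite (kdiagW i vW).
rewrite uE !linear_sum /=; split.
  transitivity (\sum_(r < N) (if r : nat is r'.+1 then fdiv (y i) (F i) r' (w r) else 0)).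
    by apply: eq_bigr => r _; have [<- _] := key r (ltn_ord r); rewrite dpE.
  case: (N) => [|N']; first by rewrite big_ord0 big_geq.
  rewrite big_ord_recl add0r big_add1 /= big_mkord; apply: eq_bigr => r _.
  by rewrite dpE.
rewrite big_mkord; apply: eq_bigr => r _; rewrite !dpE.
by have [_ <-] := key r (ltn_ord r).
Qed.

Definition bform u v : K := \sum_x bcoord b x u * bcoord b x v.

Lemma bcoord_lfun (f : 'End(M)) x u :
  bcoord b x (f u) = \sum_z bcoord b z u * bcoord b x (f (b z)).
Proof.
by rewrite (lfun_bsum bB) bcoord_suml; apply: eq_bigr => z _; rewrite bcoordZ.
Qed.

Lemma bform_adj (f f' : 'End(M)) :
  (forall x x', bcoord b x' (f (b x)) = bcoord b x (f' (b x'))) ->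
  forall u v, bform (f u) v = bform u (f' v).
Proof.
move=> ff' u v; rewrite /bform.
under eq_bigr => x _ do rewrite bcoord_lfun mulr_suml.
under [RHS]eq_bigr => x _ do rewrite bcoord_lfun mulr_sumr.
rewrite exchange_big; apply: eq_bigr => x _; apply: eq_bigr => z _ /=.
by rewrite ff' mulrA mulrAC -mulrA mulrA mulrAC.
Qed.

Lemma based_polarization : polarization rho bform.
Proof.
split=> [a u v w|u v|h|i|i].
- rewrite /bform mulr_sumr -big_split; apply: eq_bigr => x _ /=.
  by rewrite bcoordD bcoordZ mulrDl mulrA.
- by apply: eq_bigr => x _; rewrite mulrC.
- apply: bform_adj => x x'; rewrite !bcoord_uqh !bcoord_b //.
  by rewrite [x' == x]eq_sym; case: eqP => [->|]; rewrite ?mulr0.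
- move=> u v; have [-> ->] := rho_ef i.
  rewrite -[utV rho i _]comp_lfunE -scale_lfunE; apply: bform_adj => x x'.
  rewrite scale_lfunE comp_lfunE bcoordZ bcoord_uqh (sl_pol sl) mulrA.
  by rewrite qpairNl // qpair_tco // invr_expz.
move=> u v; have [-> ->] := rho_ef i.
rewrite -[ut rho i _]comp_lfunE -scale_lfunE; apply: bform_adj => x x'.
rewrite scale_lfunE comp_lfunE bcoordZ bcoord_uqh (sl_pol sl) qpair_tco //.
have [->|c0] := eqVneq (bcoord b x' (F i (b x))) 0; first by rewrite !mulr0.
(* The weight shift contributes q_i^2, which cancels the factor q_i^-1 of η(f_i) against the one of
   [sl_pol]. *)
have -> := sl_F q0 sl c0.
have y0 := qi_neq0 t q0 i; rewrite !ffunE cartan_diag opprB.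
rewrite expfzDr // -invr_expz -[_ ^ 2]/(_ ^+ 2).
by field; rewrite y0 /= ?expfz_neq0.
Qed.

End BasedModule.

(** * Crystal bases from a weight basis *)

Section BasedCrystal.
Variables (t : affine_type) (n : nat) (M : vectType Qqs).
Variables (X : finType) (b : X -> M) (wt : X -> weight n) (E F : 'I_n.+1 -> 'End(M)).
Implicit Types (mu : weight n) (i : 'I_n.+1) (x : X).

Definition blattice (u : M) : Prop := forall x, regular0 (bcoord b x u).

Definition ob (o : option X) : M := if o is Some x then b x else 0.

(** The vectors scaled by [kcoef] are the values at b x of the Kashiwara operators of
    [based_kashiwara]; [None] stands for the residue 0. *)
Definition crystal_node i (e f : 'End(M)) : Prop := exists ce cf : X -> option X,
  (forall x x', cf x = Some x' <-> ce x' = Some x) /\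
  forall x, congL blattice (kcoef qs t i (wt x) *: e (b x)) (ob (ce x)) /\
            congL blattice (kcoef qs t i (wt x) *: f (b x)) (ob (cf x)).

Definition crystal_graph : Prop := forall i, crystal_node i (E i) (F i).

Hypothesis bB : basis_of fullv [seq b x | x : X].

Lemma blatticeD u v : blattice u -> blattice v -> blattice (u + v).
Proof. by move=> Lu Lv x; rewrite bcoordD; apply: regular0D. Qed.

Lemma blatticeZ a u : regular0 a -> blattice u -> blattice (a *: u).
Proof. by move=> ra Lu x; rewrite bcoordZ; apply: regular0M. Qed.

Lemma blattice0 : blattice 0.
Proof. by move=> x; rewrite bcoord0; apply: regular0_0. Qed.

Lemma blattice_b x : blattice (b x).
Proof.
by move=> z; rewrite bcoord_b //; case: eqP; [move=> _; exact: regular0_1 | move=> _; exact: regular0_0].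
Qed.

Lemma blattice_ob o : blattice (ob o).
Proof. by case: o => [x|]; [exact: blattice_b | exact: blattice0]. Qed.

Lemma blatticeP u : blattice u <->
  exists c : X -> Qqs, (forall x, regular0 (c x)) /\ u = \sum_x c x *: b x.
Proof.
split=> [Lu|[c [rc ->]] x]; last by rewrite bcoord_lincomb.
by exists (fun x => bcoord b x u); split=> //; exact: bcoord_sum.
Qed.

Lemma congL_refl u : congL blattice u u.
Proof. by exists 0; split; [exact: blattice0 | rewrite subrr scaler0]. Qed.

Lemma congL_sym u v : congL blattice u v -> congL blattice v u.
Proof.
move=> [w [Lw uv]]; exists (- 1 *: w); split.
  by apply: blatticeZ => //; apply/regular0N/regular0_1.
by rewrite scaleN1r scalerN -uv opprB.
Qed.

Lemma congL_trans u v w : congL blattice u v -> congL blattice v w -> congL blattice u w.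
Proof.
move=> [r [Lr uv]] [s [Ls vw]]; exists (r + s); split; first exact: blatticeD.
by rewrite scalerDr -uv -vw addrA subrK.
Qed.

Lemma congL_lattice u v : congL blattice u v -> blattice v -> blattice u.
Proof.
move=> [w [Lw /eqP]]; rewrite subr_eq => /eqP -> Lv; apply: blatticeD => //.
by apply: blatticeZ => //; rewrite -[qs]expr1; exact: regular0_qsX.
Qed.

Lemma ratc_lincomb_free (c : X -> rat) :
  congL blattice (\sum_x ratc (c x) *: b x) 0 -> forall x, c x = 0.
Proof.
move=> [w [Lw]]; rewrite subr0 => wE x; apply: (ratc_qs (Lw x)).
by rewrite -bcoordZ -wE bcoord_lincomb.
Qed.

Lemma ratc_bool (B : bool) : ratc B%:R = B%:R.
Proof. by case: B; rewrite /ratc ?rmorph1 ?rmorph0. Qed.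

(** It turns a congruence modulo q_s L between elements of B and 0 into an equality of labels, on
    which the combinatorial inverse maps operate. *)
Lemma ob_inj o o' : congL blattice (ob o) (ob o') -> o = o'.
Proof.
have obE o1 z : bcoord b z (ob o1) = (o1 == Some z)%:R.
  by case: o1 => [x|] /=; rewrite ?bcoord0 // bcoord_b // eq_sym.
move=> [w [Lw ow]]; have eqz z : (o == Some z) = (o' == Some z).
  have := ratc_qs (c := (o == Some z)%:R - (o' == Some z)%:R) (Lw z).
  rewrite -bcoordZ -ow bcoordB !obE /ratc !rmorphB /= -!/(ratc _) !ratc_bool.
  move=> /(_ erefl)/eqP; rewrite subr_eq0.
  by case: (o == _); case: (o' == _); rewrite ?oner_eq0 // eq_sym oner_eq0.
clear -eqz; case: o o' eqz => [x|] [x'|] //= eqz; last first.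
- by have := eqz x'; rewrite eqxx.
- by have := eqz x; rewrite eqxx.
by apply/esym/eqP; have := eqz x; rewrite eqxx => <-.
Qed.

Lemma blattice_lattice : lattice blattice.
Proof.
have sz : size [seq b x | x : X] == \dim {:M}.
  by rewrite (size_basis bB) size_map -cardE.
exists (Tuple sz); split=> // u.
have dX : \dim {:M} = #|X| by rewrite -(eqP sz) size_map -cardE.
have nthE (j : 'I_(\dim {:M})) : (Tuple sz)`_j = b (enum_val (cast_ord dX j)).
  rewrite /= (nth_map (enum_val (cast_ord dX j))) -?cardE ?(ltn_ord (cast_ord dX j)) //.
  by congr b; apply/esym; exact: enum_val_nth.
split=> [Lu|[c [rc ->]] x].
  exists (fun j => bcoord b (enum_val (cast_ord dX j)) u); split=> //.
  rewrite [LHS](bcoord_sum bB) (reindex (fun j => enum_val (cast_ord dX j))) /=.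
    by apply: eq_bigr => j _; rewrite nthE.
  apply: onW_bij; exists (fun x => cast_ord (esym dX) (enum_rank x)) => [j|x].
    by rewrite enum_valK cast_ordK.
  by rewrite cast_ordKV enum_rankK.
rewrite bcoord_suml; apply: regular0_sum => j; rewrite bcoordZ nthE.
by apply: regular0M => //; exact: blattice_b.
Qed.

Lemma based_crystal_base : spin_like qs t b wt E F -> crystal_graph ->
  exists rho : uq_rep qs t n M,
  [/\ forall h x, uqh rho h (b x) = qpair qs h (wt x) *: b x,
      forall i, ue rho i = E i /\ uf rho i = F i,
      semisimple rho,
      crystal_base rho blattice b
    & polarizable rho blattice b].
Proof.
move=> sl crys; have [rho [rho_h rho_ef]] := spin_like_rep qs_neq0 qsX_neq1 sl.
have pol := based_polarization qs_neq0 sl rho_h rho_ef.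
exists rho; split=> //.
- apply: (anisotropic_semisimple pol) => u; rewrite /bform => u0.
  apply: (bcoord_inj bB) => x; rewrite bcoord0.
  by apply: (@Qqs_sum_sqr_eq0 _ (fun x => bcoord b x u)); rewrite -[RHS]u0.
- have Lb := blattice_b.
  split=> //.
  + exact: (based_integrable qs_neq0 qsX_neq1 sl rho_h rho_ef).
  + exact: blattice_lattice.
  + apply: (weight_graded_coord qs_neq0 qsX_neq1 sl rho_h) => mu u Lu x.
    by rewrite (wcompE sl); case: eqP => // _; exact: regular0_0.
  + move=> u Lu; have [c cP] := fin_all_exists (fun x => regular0_residue (Lu x)).
    have [v vP] := fin_all_exists cP.
    exists c, (\sum_x v x *: b x); split.
      by apply/blatticeP; exists v; split=> // x; case: (vP x).
    apply: (bcoord_inj bB) => x; rewrite bcoordB bcoordZ !bcoord_lincomb //.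
    by case: (vP x) => _ ->; rewrite addrC addKr.
  + exact: ratc_lincomb_free.
  + move=> x; exists (wt x), (b x); split=> //; exact: congL_refl.
  + move=> i; have [ce [cf [cfce cE]]] := crys i.
    have kE := based_kashiwara qs_neq0 qsX_neq1 sl rho_h rho_ef i.
    set Et := (E i \o _)%VF in kE; set Ft := (F i \o _)%VF in kE.
    have EtE x : Et (b x) = kcoef qs t i (wt x) *: E i (b x).
      by rewrite comp_lfunE bopE // lfunZ.
    have FtE x : Ft (b x) = kcoef qs t i (wt x) *: F i (b x).
      by rewrite comp_lfunE bopE // lfunZ.
    have Ec x : congL blattice (Et (b x)) (ob (ce x)) by rewrite EtE; case: (cE x).
    have Fc x : congL blattice (Ft (b x)) (ob (cf x)) by rewrite FtE; case: (cE x).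
    have stable (f : 'End(M)) : (forall x, blattice (f (b x))) ->
        forall u, blattice u -> blattice (f u).
      move=> fL u Lu z; rewrite (bcoord_lfun sl) ; apply: regular0_sum => x.
      by apply: regular0M; [exact: Lu | exact: fL].
    have alt o u : congL blattice u (ob o) ->
        congL blattice u 0 \/ exists x', congL blattice u (b x').
      by case: o => [x|] uo; [right; exists x | left].
    exists Et, Ft; split=> //.
    * move=> u Lu; split; apply: stable Lu => x.
        exact: congL_lattice (Ec x) (blattice_ob _).
      exact: congL_lattice (Fc x) (blattice_ob _).
    * by move=> x; exact: alt (Ec x).
    * by move=> x; exact: alt (Fc x).
    * move=> x x'; split=> [c|c].
        have /ob_inj /cfce ce' : congL blattice (ob (cf x)) (ob (Some x')).
          exact: congL_trans (congL_sym (Fc x)) c.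
        by have := Ec x'; rewrite ce'; exact: congL_sym.
      have /ob_inj /esym /cfce cf' : congL blattice (ob (Some x)) (ob (ce x')).
        exact: congL_trans c (Ec x').
      by have := Fc x; rewrite cf'.
- exists (bform b); split=> // [u v Lu Lv|x x'].
    by apply: regular0_sum => x; apply: regular0M; [exact: Lu | exact: Lv].
  exists 0; split; first exact: regular0_0.
  rewrite /bform (bigD1 x) //= big1 => [|z zx]; rewrite !bcoord_b //.
    by rewrite eqxx mul1r addr0 subrr mulr0.
  by rewrite (negPf zx) mul0r.
Qed.

End BasedCrystal.

(** * Sites of the nodes of the diagram *)

Definition is_dia11 (x : diamond) : bool := if x is Dia11 then true else false.

Definition dia2_node (t : affine_type) (n i : nat) : bool :=
  ((i == 0%N) && is_dia2 (diamond0 t)) || ((i == n) && is_dia2 (diamondn t)).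

(** The factor between the end of kind (2) and the end of kind (1) in its place, equal to 1 at all
    other nodes. *)
Definition kap (t : affine_type) (n i : nat) : nat := (dia2_node t n i).+1.

(* The operator e_i raises the occupation numbers of the sites [up t n i] and
   lowers those of the sites [dn t n i]; site k carries the label k + 1. *)
Definition up (t : affine_type) (n i k : nat) : bool :=
  (k == i) || [&& i == 0%N, is_dia11 (diamond0 t) & k == 1%N].

Definition dn (t : affine_type) (n i k : nat) : bool :=
  (k.+1 == i) || [&& i == n, is_dia11 (diamondn t) & k.+2 == n].

Definition step (t : affine_type) (n i k : nat) : int := (up t n i k)%:Z - (dn t n i k)%:Z.

(* The part of the weight <h_i, .> of psi_m |0> that is linear in the
   occupation numbers v, for the Cartan matrix in which the ends of kind (2)
   are replaced by ends of kind (1). *)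
Definition wlin (t : affine_type) (n i : nat) (v : nat -> int) : int :=
  if i == 0%N then (if is_dia11 (diamond0 t) then v 0%N + v 1%N else v 0%N * 2)
  else if i == n then
    (if is_dia11 (diamondn t) then - (v n.-1 + v n.-2) else - (v n.-1 * 2))
  else v i - v i.-1.

Lemma min_rank_gt1 t n : (min_rank t <= n)%N -> (1 < n)%N.
Proof. by case: t => /= /(leq_trans _) -> //. Qed.

(** With α_j = kap_j α'_j and h_i = h'_i / kap_i, the entry <h_i, α_j> is kap_j / kap_i times the
    entry <h'_i, α'_j>, which occupation numbers compute. *)
Lemma kap_cartan t n i j : (min_rank t <= n)%N -> (i <= n)%N -> (j <= n)%N ->
  (kap t n i)%:Z * cartan t n i j = (kap t n j)%:Z * wlin t n i (step t n j).
Proof.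
move=> hn lin ljn.
rewrite /cartan /kap /dia2_node /wlin /step /up /dn /swap_end /row0 /col0.
case: t hn => /= hn; rewrite ?andbT ?andbF ?orbF /=.
all: case: (eqVneq i 0%N) => [?|?]; [|case: (eqVneq i n) => [?|?]];
  (case: (eqVneq j 0%N) => [?|?]; [|case: (eqVneq j n) => [?|?]]);
  case: (eqVneq i j) => [?|?]; try (exfalso; lia); subst; rewrite /=;
  repeat (case: eqP => ? /=); lia.
Qed.

(** Symmetry of (α_i, α_j) = a_i^vee a_i^-1 a_ij, multiplied by a_i a_j. *)
Lemma mark_cartan_sym t n i j : (min_rank t <= n)%N -> (i <= n)%N -> (j <= n)%N ->
  (comark t n i * mark t n j)%N%:Z * cartan t n i j
  = (comark t n j * mark t n i)%N%:Z * cartan t n j i.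
Proof.
move=> hn lin ljn; rewrite /cartan /swap_end /row0 /col0.
case: t hn => /= hn.
all: case: (eqVneq i 0%N) => [?|?]; [|case: (eqVneq i n) => [?|?]];
  (case: (eqVneq j 0%N) => [?|?]; [|case: (eqVneq j n) => [?|?]]);
  case: (eqVneq i j) => [?|?]; try (exfalso; lia); subst; rewrite /=;
  repeat (case: leqP => ? /=); repeat (case: eqP => ? /=); lia.
Qed.

Lemma dnorm_cartan_sym t n i j : (min_rank t <= n)%N -> (i <= n)%N -> (j <= n)%N ->
  (dnorm t n i)%:Z * cartan t n i j = (dnorm t n j)%:Z * cartan t n j i.
Proof.
move=> hn lin ljn; have := mark_cartan_sym hn lin ljn.
have := dnorm_exact t lin; have := dnorm_exact t ljn.
have := mark_gt0 t n i; have := mark_gt0 t n j.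
move: (cartan t n i j) (cartan t n j i) (dnorm t n i) (dnorm t n j) => a a' d d'.
move: (mark t n i) (mark t n j) (comark t n i) (comark t n j) (dlcm t n) => m m' k k' D.
clear=> m'0 m0 dE' dE H.
have mm0 : (m * m')%N%:Z != 0 by rewrite eqz_nat muln_eq0 negb_or -!lt0n m0.
apply: (mulfI mm0); rewrite !PoszM in H *.
have {}dE : d%:Z * m = D%:Z * k by rewrite -!PoszM dE.
have {}dE' : d'%:Z * m' = D%:Z * k' by rewrite -!PoszM dE'.
transitivity (D%:Z * (k%:Z * m' * a)); first by rewrite !mulrA -dE; ring.
by rewrite H !mulrA -dE'; ring.
Qed.

Definition dia1_node (t : affine_type) (n i : nat) : bool :=
  ((i == 0%N) && (if diamond0 t is Dia1 then true else false)) ||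
  ((i == n) && (if diamondn t is Dia1 then true else false)).

(** In terms of p = q_1: q_i^2 = p at an end of kind (1), q_i = p^2 at an end of kind (2), and q_i =
    p at the other nodes. *)
Lemma dnorm1E t n i : (min_rank t <= n)%N -> (i <= n)%N ->
  ((dia1_node t n i).+1 * dnorm t n i = kap t n i * dnorm t n 1)%N.
Proof.
move=> hn lin; have n1 := min_rank_gt1 hn.
have H : ((dia1_node t n i).+1 * comark t n i * mark t n 1
          = kap t n i * comark t n 1 * mark t n i)%N.
  rewrite /dia1_node /kap /dia2_node; case: t hn => /= hn;
  repeat (case: leqP => ? /=); repeat (case: eqP => ? /=); lia.
have E1 := dnorm_exact t (ltnW n1); have Ei := dnorm_exact t lin.
apply/eqP; rewrite -(eqn_pmul2r (mark_gt0 t n i)) -(eqn_pmul2r (mark_gt0 t n 1)).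
apply/eqP; move: E1 Ei H.
move: (dia1_node t n i).+1 (dnorm t n i) (dnorm t n 1) (kap t n i) (dlcm t n) => c d d1 k D.
move: (mark t n i) (mark t n 1) (comark t n i) (comark t n 1) => m m1 o o1.
clear=> E1 Ei H.
transitivity (c * m1 * (d * m))%N; first by lia.
rewrite Ei; transitivity (D * (c * o * m1))%N; first by lia.
by rewrite H; transitivity (k * m * (d1 * m1))%N; [rewrite E1|]; lia.
Qed.

(** Either e_i and f_j both raise, or both lower, a common site, and then both products vanish; or
    they move different sites. This dichotomy underlies the commutation of e_i with f_j. *)
Lemma sites_disjoint t n i j : (min_rank t <= n)%N -> (i <= n)%N -> (j <= n)%N -> i != j ->
  (exists2 k, (k < n)%N & (up t n i k && dn t n j k) || (dn t n i k && up t n j k)) \/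
  (forall k, ~~ ((up t n i k || dn t n i k) && (up t n j k || dn t n j k))).
Proof.
move=> hn; wlog lt_ij : i j / (i < j)%N => [H lin ljn ij|lin ljn _].
  have [lt_ij|lt_ji] : (i < j)%N \/ (j < i)%N by move: ij; rewrite neq_ltn => /orP.
    exact: H.
  have ji : j != i by rewrite eq_sym.
  have [[k kn kH]|kH] := H j i lt_ji ljn lin ji.
    by left; exists k; rewrite // orbC andbC [X in _ || X]andbC.
  by right=> k; rewrite andbC.
(* The minimal ranks keep the site pairs {0, 1} and {n - 2, n - 1} of the forked ends from
   overlapping. *)
have hD : (2 + is_dia11 (diamond0 t) + is_dia11 (diamondn t) <= n)%N by case: (t) hn.
rewrite /up /dn; move: hD lt_ij ljn; clear.
move: (is_dia11 (diamond0 t)) (is_dia11 (diamondn t)) => D0 Dn hD lt_ij ljn.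
have [jE|ji] := eqVneq j i.+1; first by left; exists i; rewrite ?jE ?eqxx //; lia.
have [/and3P[/eqP-> /eqP-> ->]|h1] := boolP [&& i == 0%N, j == 2%N & D0].
  by left; exists 1%N; rewrite //; lia.
have [/and3P[/eqP jE /eqP iE ->]|h2] := boolP [&& j == n, i.+2 == n & Dn].
  by left; exists i; rewrite ?jE ?iE ?eqxx ?orbT //; lia.
right=> k; apply/negP => /andP[].
case: D0 Dn hD h1 h2 => [] [] hD h1 h2 /orP[] H1 /orP[] H2; lia.
Qed.

(** * Partial moves of the occupation numbers *)

Section Masks.
Variables (t : affine_type) (n : nat).
Hypothesis hn : (min_rank t <= n)%N.
Implicit Types (m : mask n) (i j : nat).

Let n1 : (1 < n)%N. Proof. exact: min_rank_gt1 hn. Qed.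

Definition oke i m : bool := [forall k : 'I_n, (up t n i k ==> ~~ m k) && (dn t n i k ==> m k)].
Definition okf i m : bool := [forall k : 'I_n, (up t n i k ==> m k) && (dn t n i k ==> ~~ m k)].

(** A total involution serves both e_i and f_i, which differ only in their domains [oke] and
    [okf]. *)
Definition fl i m : mask n := [ffun k : 'I_n => (up t n i k || dn t n i k) (+) m k].

Definition wm i m : int := (okf i m)%:Z - (oke i m)%:Z.

Lemma flK i : involutive (fl i).
Proof. by move=> m; apply/ffunP => k; rewrite !ffunE addKb. Qed.

Lemma flC i j m : fl i (fl j m) = fl j (fl i m).
Proof. by apply/ffunP => k; rewrite !ffunE addbCA. Qed.

Lemma up_dn i k : (i <= n)%N -> (k < n)%N -> up t n i k -> dn t n i k -> false.
Proof.
rewrite /up /dn; move: n1; clear.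
by case: is_dia11; case: is_dia11; rewrite ?andbF ?andbT /=; lia.
Qed.

Lemma okf_fl i m : (i <= n)%N -> okf i (fl i m) = oke i m.
Proof.
move=> lin; apply: eq_forallb => k; rewrite ffunE.
have := up_dn lin (ltn_ord k).
by case: (up t n i k); case: (dn t n i k); case: (m k) => //= /(_ isT isT).
Qed.

Lemma oke_fl i m : (i <= n)%N -> oke i (fl i m) = okf i m.
Proof. by move=> lin; rewrite -okf_fl // flK. Qed.

Lemma oke_okf i m : (i <= n)%N -> oke i m -> okf i m -> false.
Proof.
move=> lin /forallP oe /forallP of_.
have [k kn] : exists k : 'I_n, up t n i k || dn t n i k.
  move: lin; rewrite leq_eqVlt => /orP[/eqP->|lin].
    have ln : (n.-1 < n)%N by rewrite ltn_predL ltnW.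
    by exists (Ordinal ln); rewrite /dn /= prednK ?eqxx ?orbT // ltnW.
  by exists (Ordinal lin); rewrite /up /= eqxx.
have /andP[] := oe k; have /andP[] := of_ k; move: kn.
by case: (up t n i k); case: (dn t n i k); case: (m k).
Qed.

(** The combinatorial content of e_i f_j = f_j e_i: in the first case of [sites_disjoint] both sides
    are false, in the second each condition ignores the other move. *)
Lemma okef_comm i j m : (i <= n)%N -> (j <= n)%N -> i != j ->
  okf j m && oke i (fl j m) = oke i m && okf j (fl i m).
Proof.
move=> lin ljn ij; have [[k kn opp]|dis] := sites_disjoint hn lin ljn ij.
  transitivity false; last symmetry; apply/negP.
    move=> /andP[/forallP/(_ (Ordinal kn))/andP[fu fd] /forallP/(_ (Ordinal kn))/andP[eu ed]].
    move: opp fu fd eu ed; rewrite ffunE /=.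
    case/orP=> /andP[-> ->]; rewrite ?orbT /=.
      by move=> _ ->.
    by move=> ->.
  move=> /andP[/forallP/(_ (Ordinal kn))/andP[fu fd] /forallP/(_ (Ordinal kn))/andP[eu ed]].
  move: opp fu fd eu ed; rewrite ffunE /=.
  case/orP=> /andP[-> ->]; rewrite ?orbT /=.
    by move=> ->.
  by move=> _ ->.
rewrite andbC; congr (_ && _); apply: eq_forallb => k; rewrite ffunE.
  by have := dis k; case: (up t n i k); case: (dn t n i k); case: (up t n j k);
     case: (dn t n j k).
by have := dis k; case: (up t n i k); case: (dn t n i k); case: (up t n j k);
     case: (dn t n j k).
Qed.

Lemma wm_disjoint i j m :
  (forall k, ~~ ((up t n i k || dn t n i k) && (up t n j k || dn t n j k))) ->
  wm i (fl j m) = wm i m.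
Proof.
move=> dis; congr (_%:Z - _%:Z); congr nat_of_bool; apply: eq_forallb => k; rewrite ffunE.
  by have := dis k; case: (up t n i k); case: (dn t n i k); case: (up t n j k);
     case: (dn t n j k).
by have := dis k; case: (up t n i k); case: (dn t n i k); case: (up t n j k);
     case: (dn t n j k).
Qed.

Definition occ m (k : nat) : bool := if insub k is Some j then m j else false.

Lemma occE m (k : 'I_n) : occ m k = m k.
Proof. by rewrite /occ valK. Qed.

Lemma occ_lt m k (kn : (k < n)%N) : occ m k = m (Ordinal kn).
Proof. exact: (occE m (Ordinal kn)). Qed.

Lemma okeE i m : (i <= n)%N -> oke i m =
  if i == 0%N then ~~ occ m 0%N && (is_dia11 (diamond0 t) ==> ~~ occ m 1%N)
  else if i == n then occ m n.-1 && (is_dia11 (diamondn t) ==> occ m n.-2)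
  else ~~ occ m i && occ m i.-1.
Proof.
move=> lin.
have occP (k : nat) : (k < n)%N -> exists2 j : 'I_n, j = k :> nat & occ m k = m j.
  by move=> kn; exists (Ordinal kn); rewrite // (occ_lt m kn).
have hD : (2 + is_dia11 (diamond0 t) + is_dia11 (diamondn t) <= n)%N by case: (t) hn.
rewrite /oke /up /dn.
move: (is_dia11 (diamond0 t)) (is_dia11 (diamondn t)) hD => D0 Dn hD.
case: (eqVneq i 0%N) => [i0|i0].
  subst i; have [j0 j0E ->] := occP 0%N (ltnW n1); have [j1 j1E ->] := occP 1%N n1.
  have -> : (0%N == n) = false by apply/negP; lia.
  apply/forallP/andP => [H|[H0 H1] k].
    have := H j0; have := H j1; rewrite j0E j1E /= ?andbT ?andbF /=.
    by move=> h1 h0; split.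
  rewrite /= ?andbF andbT /=; apply/implyP => /orP[/eqP kE|/andP[D0t /eqP kE]].
    by have -> : k = j0 by apply: val_inj; rewrite /= kE.
  by have -> : k = j1 by [apply: val_inj; rewrite /= kE]; move: H1; rewrite D0t.
case: (eqVneq i n) => [iN|iN].
  subst i.
  have [|a aE ->] := occP n.-1; first by move: n1; clear; lia.
  have [|c cE ->] := occP n.-2; first by move: n1; clear; lia.
  have nE : n.-1.+1 = n by rewrite prednK // ltnW.
  have nE2 : n.-2.+2 = n by move: n1; clear; lia.
  apply/forallP/andP => [H|[Ha Hc] k].
    have := H a; have := H c; rewrite aE cE nE nE2 !eqxx /= ?andbT ?orbT /= => Hc Ha.
    split; first by case/andP: Ha.
    by apply/implyP => DnT; move: Hc; rewrite DnT /= orbT => /andP[].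
  have -> : (k == n :> nat) = false by apply/negP; have := ltn_ord k; lia.
  rewrite /=; apply/implyP => /orP[/eqP kE|/andP[DnT /eqP kE]].
    by have -> : k = a by apply: val_inj; rewrite /= aE; lia.
  have -> : k = c by apply: val_inj; rewrite /= cE; lia.
  by move: Hc; rewrite DnT.
have ltin : (i < n)%N by rewrite ltn_neqAle iN.
have [a aE ->] := occP i ltin.
have [|c cE ->] := occP i.-1; first by move: ltin; clear; lia.
apply/forallP/andP => [H|[Ha Hc] k].
  have := H a; have := H c; rewrite aE cE eqxx /= prednK ?lt0n // eqxx /=.
  by move=> /andP[_ ->] /andP[->].
rewrite /= !orbF; apply/andP; split; apply/implyP => /eqP kE.
  by have -> : k = a by apply: val_inj; rewrite /= kE.
by have -> : k = c by apply: val_inj; rewrite /= cE -kE.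
Qed.

(** Complementing the occupation numbers exchanges [oke] and [okf]. *)
Lemma okfE i m : (i <= n)%N -> okf i m =
  if i == 0%N then occ m 0%N && (is_dia11 (diamond0 t) ==> occ m 1%N)
  else if i == n then ~~ occ m n.-1 && (is_dia11 (diamondn t) ==> ~~ occ m n.-2)
  else occ m i && ~~ occ m i.-1.
Proof.
move=> lin; pose m' : mask n := [ffun k => ~~ m k].
have oE k : (k < n)%N -> occ m' k = ~~ occ m k.
  by move=> kn; rewrite !(occ_lt _ kn) ffunE.
have -> : okf i m = oke i m'.
  by apply: eq_forallb => k; rewrite ffunE negbK.
rewrite okeE //; case: eqVneq => [i0|i0]; first by rewrite !oE ?negbK // ltnW.
case: eqVneq => [iN|iN]; first by rewrite !oE //; lia.
by rewrite !oE ?negbK //; lia.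
Qed.

(** The weight is affine in the occupation numbers. Its constant term is the weight of the vacuum,
    and only its linear part enters the shift in [wm_step]. *)
Lemma wmE i m : (i <= n)%N ->
  wm i m = wlin t n i (fun k => (occ m k)%:Z) - (i == 0%N)%:Z + (i == n)%:Z.
Proof.
move=> lin; rewrite /wm okeE // okfE // /wlin.
case: (eqVneq i 0%N) => [->|i0].
  have -> : (0%N == n) = false by move: n1; clear; lia.
  by case: is_dia11; case: (occ m 0); case: (occ m 1).
case: (eqVneq i n) => [iN|iN].
  by case: is_dia11; case: (occ m n.-1); case: (occ m n.-2).
by case: (occ m i); case: (occ m i.-1).
Qed.

Lemma wlin_ext i (v v' : nat -> int) : (i <= n)%N ->
  (forall k, (k < n)%N -> v k = v' k) -> wlin t n i v = wlin t n i v'.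
Proof.
move=> lin vE; rewrite /wlin; case: (eqVneq i 0%N) => [i0|i0].
  by rewrite !vE // ltnW.
by case: (eqVneq i n) => [iN|iN]; rewrite !vE //; move: n1 lin i0 iN; clear; lia.
Qed.

Lemma occ_fl j m k : (k < n)%N -> oke j m ->
  (occ (fl j m) k)%:Z = (occ m k)%:Z + step t n j k.
Proof.
move=> kn /forallP/(_ (Ordinal kn)); rewrite !(occ_lt _ kn) ffunE /step /=.
by case: (up t n j k); case: (dn t n j k); case: (m _).
Qed.

Lemma wm_step i j m : (i <= n)%N -> oke j m ->
  wm i (fl j m) = wm i m + wlin t n i (step t n j).
Proof.
move=> lin oj; rewrite !wmE //.
have -> : wlin t n i (fun k => (occ (fl j m) k)%:Z) =
   wlin t n i (fun k => (occ m k)%:Z + step t n j k).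
  by apply: wlin_ext => // k kn; exact: occ_fl.
by rewrite /wlin; do 2?case: ifP => _; try case: ifP => _; ring.
Qed.

(** An end of kind (2) moves a single site, which is either empty or occupied. *)
Lemma oke_dia2 i m : dia2_node t n i -> (i <= n)%N -> oke i m = ~~ okf i m.
Proof.
rewrite /dia2_node => d lin; rewrite okeE // okfE //.
case: (eqVneq i 0%N) d => [->|i0] /=.
  have -> : (0%N == n) = false by move: n1; clear; lia.
  by case: (diamond0 t); rewrite //= !andbT.
by case: (eqVneq i n) => [_|_] //=; case: (diamondn t); rewrite //= !andbT negbK.
Qed.

End Masks.

(** * The spin operators on the Fock space *)

Section SpinOperators.
Variables (K : fieldType) (q : K) (t : affine_type) (n : nat) (M : vectType K).
Hypotheses (q0 : q != 0) (qX : forall k, (0 < k)%N -> q ^+ k != 1).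
Hypothesis two_neq0 : (2%:R : K) != 0.
Hypothesis hn : (min_rank t <= n)%N.
Variable F : fock_space n (qi q t n 1) M.
Implicit Types (m : mask n) (i j : nat).

Local Notation p := (qi q t n 1).

Let n1 : (1 < n)%N. Proof. exact: min_rank_gt1 hn. Qed.

Let p0 : p != 0. Proof. exact: expf_neq0. Qed.

Let p1 : p - p^-1 != 0.
Proof. exact: (@qi_sub_neq0 _ _ t n q0 qX (Ordinal (ltnW n1 : (1 < n.+1)%N))). Qed.

Definition hop (s : bool) (k : 'I_n) : 'End(M) := if s then hpsi F k.+1 else hpsis F k.+1.

Arguments hop : simpl never.

Lemma hop_fockv s (k : 'I_n) m :
  hop s k (fockv F m) = (s (+) m k)%:R *: fockv F (flip k m).
Proof.
rewrite /hop; case: s; rewrite ?hpsi_fockv ?hpsis_fockv //;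
  by case: (m k); rewrite /= ?scale0r ?scale1r.
Qed.

Lemma hop2_fockv s s' (a b : 'I_n) m : a != b ->
  hop s a (hop s' b (fockv F m)) =
    ((s (+) m a) && (s' (+) m b))%:R *: fockv F (flip a (flip b m)).
Proof.
move=> ab; rewrite hop_fockv lfunZ hop_fockv scalerA -natrM mulnb andbC.
by rewrite [flip b m a]ffunE (negPf ab).
Qed.

(** At an end of kind (2), where [act1_e] is only a placeholder, this is the operator applied in
    each factor by [act2_e]. *)
Definition spin_e i : 'End(M) :=
  if dia2_node t n i then (if i == 0%N then hpsi F 1 else hpsis F n) else act1_e t F i.

Definition spin_f i : 'End(M) :=
  if dia2_node t n i then (if i == 0%N then hpsis F 1 else hpsi F n) else act1_f t F i.

Let ord0n : 'I_n := Ordinal (ltnW n1).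
Let ord1n : 'I_n := Ordinal n1.
Let ltN1 : (n.-1 < n)%N. Proof. by move: n1; clear; lia. Qed.
Let ltN2 : (n.-2 < n)%N. Proof. by move: n1; clear; lia. Qed.

Let nE1 : n.-1.+1 = n. Proof. by move: n1; clear; lia. Qed.
Let nE2 : n.-2.+2 = n. Proof. by move: n1; clear; lia. Qed.

Lemma spin_ops i m : (i <= n)%N ->
  spin_e i (fockv F m) = (oke t i m)%:R *: fockv F (fl t i m) /\
  spin_f i (fockv F m) = (okf t i m)%:R *: fockv F (fl t i m).
Proof.
move=> lin; rewrite (okeE hn) // (okfE hn) // /spin_e /spin_f /dia2_node /act1_e /act1_f.
case: (eqVneq i 0%N) => [i0|i0] /=.
  have -> : (i == n) = false by rewrite i0; move: n1; clear; lia.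
  rewrite i0 (occ_lt _ (ltnW n1)) (occ_lt _ n1) -/ord0n -/ord1n orbF.
  have flE D : is_dia11 (diamond0 t) = D ->
      fl t 0 m = if D then flip ord0n (flip ord1n m) else flip ord0n m.
    move=> DE; apply/ffunP => k; rewrite ffunE /up /dn eqxx DE.
    have -> : (0%N == n) = false by move: n1; clear; lia.
    rewrite /=; case: D {DE}; rewrite !ffunE ?orbF //.
    rewrite -!val_eqE /= addbA; congr (_ (+) _).
    by case: (nat_of_ord k) => [|[|]].
  case dE: (diamond0 t) => /=.
  - rewrite (flE false) ?dE // !andbT; split.
      exact: (hop_fockv true ord0n).
    exact: (hop_fockv false ord0n).
  - rewrite (flE false) ?dE // !andbT; split.
      exact: (hop_fockv true ord0n).
    exact: (hop_fockv false ord0n).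
  - rewrite (flE true) ?dE //; split.
      by rewrite -[(_ \o _)%VF]/(hop true ord0n \o hop true ord1n)%VF comp_lfunE hop2_fockv.
    rewrite -[(_ \o _)%VF]/(hop false ord1n \o hop false ord0n)%VF comp_lfunE hop2_fockv //.
    by rewrite flipC andbC.
case: (eqVneq i n) => [iN|iN] /=.
  rewrite iN (occ_lt _ ltN1) (occ_lt _ ltN2).
  set a := Ordinal ltN1; set b := Ordinal ltN2.
  have ab : a != b by rewrite -val_eqE /=; move: n1; clear; lia.
  have flE D : is_dia11 (diamondn t) = D ->
      fl t n m = if D then flip a (flip b m) else flip a m.
    move=> DE; apply/ffunP => k; rewrite ffunE /up /dn eqxx DE.
    have -> : (k == n :> nat) = false by have := ltn_ord k; clear; lia.
    have -> : (n == 0%N) = false by move: n1; clear; lia.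
    have -> : (k.+1 == n) = (k == a) by rewrite -val_eqE /=; move: n1; clear; lia.
    have -> : (k.+2 == n) = (k == b) by rewrite -val_eqE /=; move: n1; clear; lia.
    rewrite /=; case: D {DE}; rewrite !ffunE ?orbF //.
    rewrite addbA; congr (_ (+) _).
    by case: (eqVneq k a) => [->|_] //=; rewrite (negPf ab).
  have aS : n = a.+1 by rewrite /= nE1.
  have bS : n.-1 = b.+1 by rewrite /= -[in LHS]nE2.
  have -> : hpsi F n = hop true a by rewrite /hop -aS.
  have -> : hpsis F n = hop false a by rewrite /hop -aS.
  have -> : hpsi F n.-1 = hop true b by rewrite /hop -bS.
  have -> : hpsis F n.-1 = hop false b by rewrite /hop -bS.
  case dE: (diamondn t) => /=.
  - by rewrite (flE false) ?dE // !andbT !hop_fockv.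
  - by rewrite (flE false) ?dE // !andbT !hop_fockv.
  - rewrite (flE true) ?dE // (comp_lfunE (hop _ _)) (comp_lfunE (hop _ _)).
    rewrite hop2_fockv // hop2_fockv 1?eq_sym //.
    by rewrite (flipC b a); split=> //; rewrite andbC.
have ltin : (i < n)%N by rewrite ltn_neqAle iN.
have ltin' : (i.-1 < n)%N by move: ltin; clear; lia.
rewrite (occ_lt _ ltin) (occ_lt _ ltin').
set a := Ordinal ltin; set b := Ordinal ltin'.
have ab : a != b by rewrite -val_eqE /=; move: i0; clear; lia.
have flE : fl t i m = flip a (flip b m).
  apply/ffunP => k; rewrite !ffunE /up /dn (negPf i0) (negPf iN) /= !orbF.
  have -> : (k.+1 == i) = (k == b) by rewrite -val_eqE /=; move: i0; clear; lia.
  rewrite addbA; congr (_ (+) _); rewrite -[k == a]val_eqE /=.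
  case: (eqVneq k b) => [->|_]; last by rewrite orbF addbF.
  by rewrite /=; move: i0; clear; lia.
have iS : i = b.+1 by rewrite /= prednK ?lt0n.
have -> : hpsi F i = hop true b by rewrite /hop -iS.
have -> : hpsis F i = hop false b by rewrite /hop -iS.
rewrite -[hpsi F i.+1]/(hop true a) -[hpsis F i.+1]/(hop false a) flE (comp_lfunE (hop _ _)) (comp_lfunE (hop _ _)).
by rewrite !hop2_fockv.
Qed.

Lemma spin_eE i m : (i <= n)%N ->
  spin_e i (fockv F m) = (oke t i m)%:R *: fockv F (fl t i m).
Proof. by move=> lin; case: (spin_ops m lin). Qed.

Lemma spin_fE i m : (i <= n)%N ->
  spin_f i (fockv F m) = (okf t i m)%:R *: fockv F (fl t i m).
Proof. by move=> lin; case: (spin_ops m lin). Qed.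

Lemma qi_exprz i (z : int) : qi q t n i ^ z = q ^ ((dnorm t n i)%:Z * z).
Proof. by rewrite -exprz_exp. Qed.

Lemma om_fockvz k m : (k < n)%N ->
  om F k.+1 (fockv F m) = q ^ ((dnorm t n 1)%:Z * ((occ m k)%:Z - 1)) *: fockv F m.
Proof.
move=> kn; rewrite -qi_exprz (occ_lt _ kn) -[k]/(nat_of_ord (Ordinal kn)) om_fockv.
by rewrite expfzDr // exprN1.
Qed.

Lemma omV_fockvz k m : (k < n)%N ->
  omV F k.+1 (fockv F m) = q ^ ((dnorm t n 1)%:Z * (1 - (occ m k)%:Z)) *: fockv F m.
Proof.
move=> kn; rewrite -qi_exprz (occ_lt _ kn) -[k]/(nat_of_ord (Ordinal kn)) omV_fockv //.
by rewrite expfzDr // expr1z -invr_expz.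
Qed.

(** The ω_a contribute powers of p, which [dnorm1E] converts to powers of q_i; the prefactors q_0
    and q_n^-1 supply the constants -1 and +1 of [wmE]. *)
Lemma act1_tE i m : (i <= n)%N -> ~~ dia2_node t n i ->
  act1_t q t F i (fockv F m) = qi q t n i ^ wm t i m *: fockv F m.
Proof.
move=> lin nd; rewrite (wmE hn) // /wlin /act1_t.
have dE := dnorm1E hn lin; rewrite /kap (negPf nd) mul1n in dE.
move: nd dE; rewrite /dia2_node /dia1_node negb_or !qi_exprz.
have omN : omV F n = omV F n.-1.+1 by rewrite nE1.
have omN2 : omV F n.-1 = omV F n.-2.+1.
  by congr (omV F); move: n1; clear; lia.
case: (eqVneq i 0%N) => [i0|i0].
  have iN : (i == n) = false by rewrite i0; move: n1; clear; lia.
  rewrite iN i0 andbT /= addr0.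
  case: (diamond0 t) => //= _ dE; rewrite scale_lfunE ?comp_lfunE !om_fockvz ?(ltnW n1) //.
    rewrite scalerA; congr (_ *: _); rewrite -[qi q t n 0]expr1z qi_exprz -expfzDr //.
    by congr (q ^ _); rewrite -dE ?orbF ?orbT ?andbF ?PoszM /=; ring.
  rewrite lfunZ om_fockvz ?(ltnW n1) // !scalerA.
  rewrite -[qi q t n 0]expr1z qi_exprz -!expfzDr //.
  by congr (q ^ _ *: _); rewrite -dE ?orbF ?orbT ?andbF ?PoszM /=; ring.
case: (eqVneq i n) => [iN|iN].
  rewrite iN subr0; case: (diamondn t) => //= _ dE.
    rewrite scale_lfunE omN omV_fockvz // scalerA -exprN1 qi_exprz -expfzDr //.
    by congr (q ^ _ *: _); rewrite -dE ?orbF ?orbT ?andbF ?PoszM /=; ring.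
  rewrite scale_lfunE comp_lfunE omN omN2 !omV_fockvz // lfunZ omV_fockvz // !scalerA.
  rewrite -exprN1 qi_exprz -!expfzDr //.
  by congr (q ^ _ *: _); rewrite -dE ?orbF ?orbT ?andbF ?PoszM /=; ring.
move=> _ dE; have ltin : (i < n)%N by rewrite ltn_neqAle iN.
have iS : omV F i = omV F i.-1.+1 by rewrite prednK ?lt0n.
rewrite comp_lfunE iS omV_fockvz; last by move: ltin; clear; lia.
rewrite lfunZ om_fockvz // scalerA -expfzDr //.
by congr (q ^ _ *: _); rewrite -dE ?orbF ?orbT ?andbF ?PoszM /=; ring.
Qed.

Lemma dia2_tE0 m : dia2_node t n 0 ->
  (om F 1 \o om F 1)%VF (fockv F m) = q ^ ((dnorm t n 0)%:Z * ((occ m 0)%:Z - 1)) *: fockv F m.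
Proof.
move=> d; have := dnorm1E hn (leq0n n); rewrite /kap d /dia1_node.
have iN : (0%N == n) = false by move: n1; clear; lia.
move: d; rewrite /dia2_node iN orbF /=; case: (diamond0 t) => //= _ dE.
rewrite comp_lfunE om_fockvz ?(ltnW n1) // lfunZ om_fockvz ?(ltnW n1) // scalerA.
rewrite -expfzDr //; congr (q ^ _ *: _).
have -> : (dnorm t n 0)%:Z = (dnorm t n 1)%:Z * 2 by move: dE; clear; lia.
by ring.
Qed.

Lemma dia2_tEn m : dia2_node t n n ->
  (omV F n \o omV F n)%VF (fockv F m) =
  q ^ ((dnorm t n n)%:Z * (1 - (occ m n.-1)%:Z)) *: fockv F m.
Proof.
move=> d; have := dnorm1E hn (leqnn n); rewrite /kap d /dia1_node.
have iN : (n == 0%N) = false by move: n1; clear; lia.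
move: d; rewrite /dia2_node iN eqxx /=; case: (diamondn t) => //= _ dE.
have omN : omV F n = omV F n.-1.+1 by rewrite nE1.
rewrite comp_lfunE omN omV_fockvz // lfunZ omV_fockvz // scalerA.
rewrite -expfzDr //; congr (q ^ _ *: _).
have -> : (dnorm t n n)%:Z = (dnorm t n 1)%:Z * 2 by move: dE; clear; lia.
by ring.
Qed.

End SpinOperators.

(** * Minuscule nodes and tensor squares *)

Section Minuscule.
Variables (K : fieldType) (M : vectType K) (X : finType) (b : X -> M) (y : K).
Hypotheses (bB : basis_of fullv [seq b x | x : X]) (y0 : y != 0) (y1 : y - y^-1 != 0).
Variables (oe of_ : pred X) (f : X -> X) (e phi : 'End(M)).
Hypotheses (fK : involutive f) (of_f : forall x, of_ (f x) = oe x).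
Hypothesis oe_of : forall x, oe x -> of_ x -> false.
Hypothesis eE : forall x, e (b x) = (oe x)%:R *: b (f x).
Hypothesis phiE : forall x, phi (b x) = (of_ x)%:R *: b (f x).

Let oe_f x : oe (f x) = of_ x. Proof. by rewrite -of_f fK. Qed.

(** Stated for any partial involution because it serves both for single masks and for pairs of masks
    at an end of kind (2), where the two factors move together. *)
Lemma minuscule_comm x :
  e (phi (b x)) - phi (e (b x)) = br y ((of_ x)%:Z - (oe x)%:Z) *: b x.
Proof.
rewrite eE phiE !lfunZ eE phiE fK oe_f of_f !scalerA -scalerBl; congr (_ *: _).
have := @oe_of x; case: (oe x); case: (of_ x) => H /=.
- by have := H isT isT.
- by rewrite sub0r brN br1 // mulr1 mul0r sub0r.
- by rewrite subr0 br1 // mulr1 mul0r subr0.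
- by rewrite !subrr br0.
Qed.

Lemma minuscule_pol x x' : bcoord b x' (e (b x)) =
  y^-1 * y ^ (- ((of_ x)%:Z - (oe x)%:Z)) * bcoord b x (phi (b x')).
Proof.
rewrite eE phiE !bcoordZ !bcoord_b //.
case: (eqVneq x (f x')) => [->|ne]; last first.
  rewrite !mulr0; case: eqP => [E|_]; last by rewrite mulr0.
  by rewrite E fK eqxx in ne.
rewrite fK eqxx !mulr1 oe_f of_f; have := @oe_of x'.
case: (of_ x'); case: (oe x') => H /=; rewrite ?mulr0 //.
  by have := H isT isT.
by rewrite sub0r opprK expr1z mulr1 mulVf.
Qed.

End Minuscule.

(** The correction by [2]_i^-1 concerns only weight 0, where e and phi vanish; elsewhere they move
    basis vectors exactly. *)
Lemma minuscule_crystal (t : affine_type) (n : nat) (M : vectType Qqs) (X : finType)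
    (b : X -> M) (wt : X -> weight n) (i : 'I_n.+1) (e phi : 'End(M))
    (oe of_ : pred X) (f : X -> X) :
  involutive f -> (forall x, of_ (f x) = oe x) -> (forall x, oe x -> of_ x -> false) ->
  (forall x, e (b x) = (oe x)%:R *: b (f x)) ->
  (forall x, phi (b x) = (of_ x)%:R *: b (f x)) ->
  (forall x, wt x i = (of_ x)%:Z - (oe x)%:Z) ->
  crystal_node t b wt i e phi.
Proof.
move=> fK of_f oe_of eE phiE wtE.
exists (fun x => if oe x then Some (f x) else None),
       (fun x => if of_ x then Some (f x) else None); split=> [x x'|x].
  split.
    by case: ifP => // fx [<-]; rewrite -of_f fK fx.
  by case: ifP => // ex' [<-]; rewrite of_f ex' fK.
rewrite eE phiE /kcoef wtE; have := @oe_of x.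
case: (oe x); case: (of_ x) => H;
  rewrite /= ?scale1r ?scale0r ?scaler0; first (by have := H isT isT); split; exact: congL_refl.
Qed.

(** * The tensor basis *)

Section TensorBasis.
Variables (K : fieldType) (M : vectType K) (X : finType) (b : X -> M).
Hypothesis bB : basis_of fullv [seq b x | x : X].

Definition tb (z : X * X) : tsq M := tens (b z.1) (b z.2).

Lemma tens_expand u v : tens u v = \sum_z (bcoord b z.1 u * bcoord b z.2 v) *: tb z.
Proof.
rewrite {1}[u](bcoord_sum bB) {1}[v](bcoord_sum bB) tens_suml.
under eq_bigr do rewrite tens_sumr.
rewrite pair_bigA; apply: eq_bigr => z _ /=.
by rewrite tensZl tensZr scalerA.
Qed.

Lemma tb_basis : basis_of fullv [seq tb z | z : X * X].
Proof.
have sz : size [seq tb z | z : X * X] = \dim {: tsq M}.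
  rewrite size_map -cardE card_prod.
  have -> : \dim {: tsq M} = (\dim {:M} * \dim {:M})%N by rewrite dimvf /dim /=.
  by rewrite (size_basis bB).
rewrite basisEdim -sz leqnn andbT; apply/subvP => A _.
have tbS z : tb z \in <<[seq tb z | z : X * X]>>%VS.
  by apply/memv_span/map_f; rewrite mem_enum.
have -> : A = \sum_i \sum_j (A : 'M_(_, _)) i j *:
    (tens (vbasis {:M})`_i (vbasis {:M})`_j : tsq M).
  apply/matrixP => i j; rewrite summxE (bigD1 i) //= summxE (bigD1 j) //=.
  have cE (k l : 'I_(\dim {:M})) : coord (vbasis {:M}) k (vbasis {:M})`_l = (l == k)%:R.
    exact: (coord_free _ _ (basis_free (vbasisP _))).
  rewrite !mxE !cE !eqxx !mulr1 big1 ?addr0 => [|l lj]; last first.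
    by rewrite !mxE !cE (negPf lj) !mulr0.
  rewrite big1 ?addr0 // => k ki; rewrite summxE big1 // => l _.
  by rewrite !mxE !cE (negPf ki) mul0r mulr0.
rewrite memv_suml // => i _; rewrite memv_suml // => j _; apply: memvZ.
by rewrite tens_expand memv_suml // => z _; apply: memvZ.
Qed.

(** The t_i^-1 in Δ(e_i) is a linear inverse of t_i, meaningful once t_i is known to be injective;
    nonzero eigenvalues on a basis give this. *)
Lemma tens_eigen_inverse (f : 'End(M)) (l : X -> K) :
  (forall x, l x != 0) -> (forall x, f (b x) = l x *: b x) ->
  forall x, (f^-1)%VF (b x) = (l x)^-1 *: b x.
Proof.
move=> l0 fE x.
have /lker0_lfunK fK : lker f == 0%VS.
  rewrite -subv0; apply/subvP => u; rewrite memv_ker memv0 => /eqP fu.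
  apply/eqP/(bcoord_inj bB) => z; rewrite bcoord0; apply: (mulIf (l0 z)).
  rewrite mul0r -(bcoord0 b z) -fu (lfun_bsum bB).
  by under eq_bigr do rewrite fE scalerA; rewrite bcoord_lincomb.
by rewrite -{1}[b x](scale1r) -(mulVf (l0 x)) -scalerA lfunZ -fE fK.
Qed.

End TensorBasis.

Lemma tens_blattice (M : vectType Qqs) (X : finType) (b : X -> M) :
  basis_of fullv [seq b x | x : X] ->
  forall w, tens_lattice (blattice b) w <-> blattice (tb b) w.
Proof.
move=> bB w; have tB := tb_basis bB; split=> [[k [u [v [uv ->]]]] z|Lw].
  rewrite bcoord_suml; apply: regular0_sum => j; rewrite (tens_expand bB) bcoord_lincomb //.
  by case: (uv j) => Lu Lv; apply: regular0M; [exact: Lu | exact: Lv].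
exists #|{: X * X}|, (fun j => bcoord (tb b) (enum_val j) w *: b (enum_val j).1),
  (fun j => b (enum_val j).2); split=> [j|].
  split=> x; rewrite ?bcoordZ bcoord_b //; last first.
    by case: eqP => _; [exact: regular0_1 | exact: regular0_0].
  apply: regular0M; first exact: Lw.
  by case: eqP => _; [exact: regular0_1 | exact: regular0_0].
rewrite [LHS](bcoord_sum tB) (reindex (fun j : 'I_#|{: X * X}| => enum_val j)) /=.
  by apply: eq_bigr => j _; rewrite tensZl.
by apply: onW_bij; exact: enum_val_bij.
Qed.

(** * Weights of the two modules *)

Section SpinWeights.
Variables (t : affine_type) (n : nat).
Hypothesis hn : (min_rank t <= n)%N.
Implicit Types (m : mask n) (z : mask n * mask n) (i j : nat).

Lemma wm_oke i m : (i <= n)%N -> oke t i m -> wm t i m = -1.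
Proof.
by move=> lin oe; rewrite /wm oe; case: (boolP (okf t i m)) => // /(oke_okf hn lin oe).
Qed.

Lemma wm_okf i m : (i <= n)%N -> okf t i m -> wm t i m = 1.
Proof.
move=> lin of_; rewrite /wm of_; case: (boolP (oke t i m)) => // oe.
by have := oke_okf hn lin oe of_.
Qed.

Lemma wm_bound i m : -1 <= wm t i m <= 1.
Proof. by rewrite /wm; case: (oke t i m); case: (okf t i m). Qed.

Lemma wm_fl i m : (i <= n)%N -> wm t i (fl t i m) = - wm t i m.
Proof. by move=> lin; rewrite /wm (oke_fl hn) // (okf_fl hn) // opprB. Qed.

Lemma wm_step_f i j m : (i <= n)%N -> (j <= n)%N -> okf t j m ->
  wm t i (fl t j m) = wm t i m - wlin t n i (step t n j).
Proof.
move=> lin ljn of_; have := wm_step hn lin (m := fl t j m) (j := j).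
by rewrite flK (oke_fl hn) // => /(_ of_) ->; rewrite addrK.
Qed.

(** The hypothesis excludes the first case of [sites_disjoint], and moves of disjoint sites do not
    affect each other's weights. *)
Lemma okef_wm i j m m' : (i <= n)%N -> (j <= n)%N -> i != j ->
  okf t j m && oke t i (fl t j m) ->
  wm t i (fl t j m') = wm t i m' /\ wm t j (fl t i m') = wm t j m'.
Proof.
move=> lin ljn ij; have [[k kn opp]|dis _] := sites_disjoint hn lin ljn ij; last first.
  by split; apply: wm_disjoint => // k; rewrite andbC; exact: dis.
move=> /andP[/forallP/(_ (Ordinal kn))/andP[fu fd] /forallP/(_ (Ordinal kn))/andP[eu ed]].
move: opp fu fd eu ed; rewrite ffunE /=.
case/orP=> /andP[-> ->]; rewrite ?orbT /=.
  by move=> _ ->.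
by move=> ->.
Qed.

Definition wt1 m : weight n := [ffun i : 'I_n.+1 => wm t i m].

(** At an end of kind (2) this is half of [wm t i z.1 + wm t i z.2], an integer because both
    summands are 1 or -1 there. *)
Definition wt2 z : weight n := [ffun i : 'I_n.+1 =>
  if dia2_node t n i then
    (okf t i z.1 && okf t i z.2)%:Z - (oke t i z.1 && oke t i z.2)%:Z
  else wm t i z.1 + wm t i z.2].

Lemma kap_wt2 z (i : 'I_n.+1) : (kap t n i)%:Z * wt2 z i = wm t i z.1 + wm t i z.2.
Proof.
rewrite ffunE /kap; case: (boolP (dia2_node t n i)) => d; last by rewrite mul1r.
have lin : (i <= n)%N by rewrite -ltnS.
rewrite /wm !(oke_dia2 hn _ d) //.
by case: (okf t i z.1); case: (okf t i z.2).
Qed.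

(** Coordinate i is multiplied by [kap t n i], which turns the claim into [kap_cartan]. *)
Lemma wt2_shift z z' (j : 'I_n.+1) :
  (forall i : 'I_n.+1, wm t i z'.1 + wm t i z'.2 =
     wm t i z.1 + wm t i z.2 + (kap t n j)%:Z * wlin t n i (step t n j)) ->
  wt2 z' = wt2 z + cl_root t j.
Proof.
move=> H; apply/ffunP => i; rewrite [RHS]ffunE.
have k0 : (kap t n i)%:Z != 0 by rewrite /kap.
apply: (mulfI k0); rewrite mulrDr !kap_wt2 H [cl_root t j i]ffunE.
by rewrite (kap_cartan hn) // -ltnS.
Qed.

End SpinWeights.

(** * The relations on Λ(V) and on its square *)

Section SpinLike.
Variables (K : fieldType) (q : K) (t : affine_type) (n : nat) (M : vectType K).
Hypotheses (q0 : q != 0) (qX : forall k, (0 < k)%N -> q ^+ k != 1).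
Hypothesis hn : (min_rank t <= n)%N.
Local Notation y i := (qi q t n (nat_of_ord i)).
Implicit Types (m : mask n) (z : mask n * mask n) (i j : 'I_n.+1).

Let le_n i : (i <= n)%N. Proof. by rewrite -ltnS. Qed.
Let y0 i : y i != 0. Proof. exact: qi_neq0. Qed.
Let y1 i : y i - (y i)^-1 != 0. Proof. exact: qi_sub_neq0. Qed.

Section Single.
Variables (b : mask n -> M) (E F : 'I_n.+1 -> 'End(M)).
Hypothesis bB : basis_of fullv [seq b m | m : mask n].
Hypothesis no_dia2 : forall i, ~~ dia2_node t n i.
Hypothesis EE : forall i m, E i (b m) = (oke t i m)%:R *: b (fl t i m).
Hypothesis FE : forall i m, F i (b m) = (okf t i m)%:R *: b (fl t i m).

Lemma single_spin_like : spin_like q t b (@wt1 t n) E F.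
Proof.
split=> //.
- by move=> m i; rewrite ffunE; have /andP[h1 h2] := wm_bound t i m; lia.
- move=> j m m'; rewrite EE bcoordZ bcoord_b // -natrM mulnb.
  case: andP => [[oe /eqP ->] _|_]; last by rewrite eqxx.
  apply/ffunP => i; rewrite !ffunE (wm_step hn) //.
  have := kap_cartan hn (le_n i) (le_n j); rewrite /kap !(negPf (no_dia2 _)) !mul1r.
  by move->.
- move=> i j m; case: eqVneq => [<-|ij].
    rewrite ffunE; apply: (minuscule_comm (y1 i) _ _ _ (EE i) (FE i)) => [|x|x].
    + exact: flK.
    + exact: (okf_fl hn).
    + exact: (oke_okf hn).
  rewrite EE FE !lfunZ EE FE !scalerA -!natrM !mulnb (okef_comm hn) // flC.
  by rewrite subrr.
- move=> i m m'; rewrite ffunE.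
  apply: (minuscule_pol bB (y0 i) _ _ _ (EE i) (FE i)) => [|x|x].
  + exact: flK.
  + exact: (okf_fl hn).
  + exact: (oke_okf hn).
Qed.

End Single.

Section Pair.
Variables (B : mask n * mask n -> M) (E F : 'I_n.+1 -> 'End(M)).
Hypothesis BB : basis_of fullv [seq B z | z : mask n * mask n].
Hypothesis EE : forall i z, E i (B z) =
  if dia2_node t n i then
    (oke t i z.1 && oke t i z.2)%:R *: B (fl t i z.1, fl t i z.2)
  else ((oke t i z.1)%:R * y i ^ (- wm t i z.2)) *: B (fl t i z.1, z.2)
       + (oke t i z.2)%:R *: B (z.1, fl t i z.2).
Hypothesis FE : forall i z, F i (B z) =
  if dia2_node t n i then
    (okf t i z.1 && okf t i z.2)%:R *: B (fl t i z.1, fl t i z.2)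
  else (okf t i z.1)%:R *: B (fl t i z.1, z.2)
       + (y i ^ wm t i z.1 * (okf t i z.2)%:R) *: B (z.1, fl t i z.2).

Lemma wt2_bound z i : -2 <= @wt2 t n z i <= 2.
Proof.
have := kap_wt2 hn z i; have := wm_bound t i z.1; have := wm_bound t i z.2.
by rewrite /kap; case: (dia2_node t n i); clear; lia.
Qed.

Lemma pair_E_shift j z z' : bcoord B z' (E j (B z)) != 0 ->
  @wt2 t n z' = wt2 t z + cl_root t j.
Proof.
move=> c0; apply: (wt2_shift hn) => i; have lin := le_n i.
move: c0; rewrite EE /kap; case: ifP => d.
  rewrite bcoordZ bcoord_b //.
  case: (boolP (oke t j z.1)) => o1; last by rewrite mul0r eqxx.
  case: (boolP (oke t j z.2)) => o2; last by rewrite mul0r eqxx.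
  case: (eqVneq z' _) => [-> _|]; last by rewrite mulr0 eqxx.
  by rewrite /= !(wm_step hn) //; ring.
rewrite bcoordD !bcoordZ !bcoord_b // mul1r.
case: (eqVneq z' (fl t j z.1, z.2)) => [-> |_].
  case: (boolP (oke t j z.1)) => [o1 _|_].
    by rewrite /= (wm_step hn) //; ring.
  rewrite !mul0r add0r; case: (boolP (oke t j z.2)) => o2; last by rewrite mul0r eqxx.
  (* The two terms of E_j are not shown to be distinct basis vectors; a coincidence would give the
     same shift. *)
  case: (eqVneq (fl t j z.1, z.2) (z.1, fl t j z.2)) => [->|_]; last by rewrite mulr0 eqxx.
  by move=> _; rewrite /= (wm_step hn) //; ring.
rewrite mulr0 add0r; case: (boolP (oke t j z.2)) => o2; last by rewrite mul0r eqxx.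
case: (eqVneq z' _) => [-> _|]; last by rewrite mulr0 eqxx.
by rewrite /= (wm_step hn) //; ring.
Qed.

(** The commutator of Δ(e) and Δ(f) on a product of vectors of weights k and l has [k] y^-l + y^k
    [l] as its diagonal part. *)
Lemma br_add (x : K) (k l : int) : x != 0 ->
  br x k * x ^ (- l) + x ^ k * br x l = br x (k + l).
Proof.
move=> x0; rewrite /br mulrAC [X in _ + X]mulrA -mulrDl; congr (_ / _).
by rewrite opprD !expfzDr //; ring.
Qed.

Lemma br_wm i m : br (y i) (wm t i m) = (okf t i m)%:R - (oke t i m)%:R.
Proof.
have := oke_okf hn (le_n i) (m := m); rewrite /wm.
case: (oke t i m); case: (okf t i m) => H /=.
- by have := H isT isT.
- by rewrite !sub0r brN br1.
- by rewrite !subr0 br1.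
- by rewrite !subrr br0.
Qed.

Lemma pair_EF_diag i z : ~~ dia2_node t n i ->
  E i (F i (B z)) - F i (E i (B z)) = br (y i) (wt2 t z i) *: B z.
Proof.
case: z => m m' nd; rewrite FE EE (negPf nd) /= !linearD /= !lfunZ !EE !FE (negPf nd) /=.
rewrite !(oke_fl hn) // !(okf_fl hn) // !flK !(wm_fl hn) // ffunE (negPf nd) /=.
rewrite -br_add // !br_wm opprK.
have o1 := oke_okf hn (le_n i) (m := m); have o2 := oke_okf hn (le_n i) (m := m').
have w1 := wm_oke hn (le_n i) (m := m); have w2 := wm_oke hn (le_n i) (m := m').
have w3 := wm_okf hn (le_n i) (m := m); have w4 := wm_okf hn (le_n i) (m := m').
move: (B (m, m')) (B (fl t i m, fl t i m')) => u v.
case: (oke t i m) o1 w1; case: (okf t i m) w3 => w3 o1 w1;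
  try (by have := o1 isT isT);
case: (oke t i m') o2 w2; case: (okf t i m') w4 => w4 o2 w2;
  try (by have := o2 isT isT);
  rewrite ?(w1 isT) ?(w2 isT) ?(w3 isT) ?(w4 isT);
  rewrite ?opprK ?exprN1 ?expr1z /=; apply: vec_eq => k;
  rewrite ?(linearD, linearN, linearB, linearZ, linear0) /=;
  by field; rewrite ?y0.
Qed.

(** Both sides are q^(α_i, α_j). *)
Lemma qi_wlin_sym i j : ~~ dia2_node t n i -> ~~ dia2_node t n j ->
  y j ^ wlin t n j (step t n i) = y i ^ wlin t n i (step t n j).
Proof.
move=> di dj; rewrite !qi_exprz; congr (q ^ _).
have := dnorm_cartan_sym hn (le_n i) (le_n j).
have := kap_cartan hn (le_n i) (le_n j); have := kap_cartan hn (le_n j) (le_n i).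
by rewrite /kap (negPf di) (negPf dj) !mul1r => -> ->.
Qed.

Lemma pair_EF_off i j z : i != j -> E i (F j (B z)) = F j (E i (B z)).
Proof.
case: z => m m' ij; have ji : j != i by rewrite eq_sym.
have cm m0 : okf t j m0 && oke t i (fl t j m0) = oke t i m0 && okf t j (fl t i m0).
  exact: okef_comm.
have cmR m0 : (okf t j m0)%:R * (oke t i (fl t j m0))%:R =
    (oke t i m0)%:R * (okf t j (fl t i m0))%:R :> K.
  by rewrite -!natrM !mulnb cm.
(* The weight inside g may be replaced under a coefficient that vanishes unless [okef_wm]
   applies. *)
have cw m0 m1 (g : int -> K) :
    (okf t j m0)%:R * (oke t i (fl t j m0))%:R * g (wm t i (fl t j m1)) =
    (okf t j m0)%:R * (oke t i (fl t j m0))%:R * g (wm t i m1) /\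
    (okf t j m0)%:R * (oke t i (fl t j m0))%:R * g (wm t j (fl t i m1)) =
    (okf t j m0)%:R * (oke t i (fl t j m0))%:R * g (wm t j m1).
  rewrite -natrM mulnb; case: (boolP (_ && _)) => [H|_]; last by rewrite !mul0r.
  by have [-> ->] := okef_wm hn m1 (le_n i) (le_n j) ij H.
rewrite FE EE /=; case: (boolP (dia2_node t n i)) => di;
  case: (boolP (dia2_node t n j)) => dj;
  rewrite ?linearD ?lfunZ /= ?lfunZ !EE !FE ?(negPf di) ?(negPf dj) ?di ?dj /=.
- rewrite !scalerA -!natrM !mulnb andbACA !cm andbACA.
  by rewrite (flC _ i j m) (flC _ i j m').
- rewrite scalerDr !scalerA (flC _ i j m) (flC _ i j m') -!mulnb !natrM.
  congr (_ *: _ + _ *: _); first by rewrite mulrA cmR mulrAC.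
  have [_ cw2] := cw m' m (fun k => y j ^ k).
  transitivity ((oke t i m)%:R * ((okf t j m')%:R * (oke t i (fl t j m'))%:R * y j ^ wm t j m)).
    by ring.
  by rewrite -cw2 cmR; ring.
- rewrite scalerDr !scalerA (flC _ i j m) (flC _ i j m') -!mulnb !natrM.
  have [cw1 _] := cw m m' (fun k => y i ^ (- k)).
  congr (_ *: _ + _ *: _).
    transitivity ((okf t j m')%:R *
      ((okf t j m)%:R * (oke t i (fl t j m))%:R * y i ^ (- wm t i (fl t j m')))).
      by ring.
    by rewrite cw1 cmR; ring.
  by rewrite -mulrA cmR; ring.
rewrite !scalerDr !scalerA (flC _ i j m) (flC _ i j m') [RHS]addrACA.
congr (_ *: _ + _ *: _ + (_ *: _ + _ *: _)).
- by rewrite mulrA cmR; ring.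
- by ring.
- case: (boolP (oke t i m)) => oi; last by rewrite !mul0r !mulr0.
  case: (boolP (okf t j m')) => fj; last by rewrite !(mulr0, mul0r).
  (* Moving e_i past t_j in the first factor and f_j past t_i^-1 in the second produces the same
     power of q on both sides. *)
  rewrite (wm_step hn (le_n j) oi) (wm_step_f hn (le_n i) (le_n j) fj) opprB !expfzDr //.
  rewrite (qi_wlin_sym di dj).
  by ring.
- by rewrite -mulrA cmR; ring.
Qed.

(** After multiplication by q_i^-1 t_i^-1, the two terms of Δ(f_i) transpose one by one to those of
    Δ(e_i); at an end of kind (2) the pair of masks behaves as a single minuscule label. *)
Lemma pair_pol i z z' : bcoord B z' (E i (B z)) =
  (y i)^-1 * y i ^ (- wt2 t z i) * bcoord B z (F i (B z')).
Proof.
case: (boolP (dia2_node t n i)) => d.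
  have := @minuscule_pol _ _ _ B (y i) BB (y0 i)
    (fun z => oke t i z.1 && oke t i z.2) (fun z => okf t i z.1 && okf t i z.2)
    (fun z => (fl t i z.1, fl t i z.2)) (E i) (F i) _ _ _ _ _ z z'.
  rewrite ffunE d; apply=> [[a c]|[a c]|[a c]|x|x] /=.
  - by rewrite !flK.
  - by rewrite !(okf_fl hn).
  - by move=> /andP[o1 _] /andP[o2 _]; exact: (oke_okf hn (le_n i) o1 o2).
  - by rewrite EE d.
  - by rewrite FE d.
rewrite EE FE (negPf d) !bcoordD !bcoordZ !bcoord_b // ffunE (negPf d).
case: z z' => m1 m2 [m1' m2'] /=; rewrite mulrDr -!pair_eqE /pair_eq /=.
congr (_ + _).
  rewrite [m2 == _]eq_sym; case: (m2' =P m2) => [_|_]; rewrite ?andbF ?mulr0 // !andbT.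
  have -> : (m1 == fl t i m1') = (m1' == fl t i m1).
    by apply/eqP/eqP => ->; rewrite flK.
  case: (m1' =P _) => [->|_]; rewrite ?mulr0 // !mulr1 (okf_fl hn) //.
  case: (boolP (oke t i m1)) => [/(wm_oke hn (le_n i)) ->|_]; rewrite ?mulr0 ?mul0r //.
  move: (wm t i m2) => w.
  by rewrite opprD opprK expfzDr // expr1z /=; field; rewrite y0.
rewrite [m1 == _]eq_sym; case: (m1' =P m1) => [->|_]; rewrite ?mulr0 //=.
have -> : (m2 == fl t i m2') = (m2' == fl t i m2).
  by apply/eqP/eqP => ->; rewrite flK.
case: (m2' =P _) => [->|_]; rewrite ?mulr0 // !mulr1 (okf_fl hn) //.
case: (boolP (oke t i m2)) => [/(wm_oke hn (le_n i)) ->|_]; rewrite ?mulr0 //.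
move: (wm t i m1) => w; rewrite opprD opprK expfzDr // expr1z -invr_expz /=.
by field; rewrite y0 expfz_neq0.
Qed.

Lemma pair_spin_like : spin_like q t B (@wt2 t n) E F.
Proof.
split=> //; [exact: wt2_bound | exact: pair_E_shift | | exact: pair_pol].
move=> i j z; case: eqVneq => [<-|ij]; last by rewrite pair_EF_off // subrr.
case: (boolP (dia2_node t n i)) => d; last exact: pair_EF_diag.
rewrite ffunE d.
apply: (@minuscule_comm _ _ _ B (y i) (y1 i)
  (fun z => oke t i z.1 && oke t i z.2) (fun z => okf t i z.1 && okf t i z.2)
  (fun z => (fl t i z.1, fl t i z.2))) => [[a c]|[a c]|[a c]|x|x] /=.
- by rewrite !flK.
- by rewrite !(okf_fl hn).
- by move=> /andP[o1 _] /andP[o2 _]; exact: (oke_okf hn (le_n i) o1 o2).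
- by rewrite EE d.
- by rewrite FE d.
Qed.

End Pair.
End SpinLike.

(** * The crystal of the tensor square *)

Lemma br2V (K : fieldType) (y : K) : y != 0 -> y - y^-1 != 0 -> 1 + y ^+ 2 != 0 ->
  (br y 2)^-1 = y / (1 + y ^+ 2) /\ (br y 2)^-1 / y - 1 = - y ^+ 2 / (1 + y ^+ 2).
Proof.
move=> y0 y1 y2; rewrite br2 //.
have -> : y + y^-1 = (1 + y ^+ 2) / y by rewrite mulrDl expr2 mulfK // div1r addrC.
by split; field; rewrite y0 y2.
Qed.

Section CrystalCoefficients.
Variable d : nat.
Hypothesis d0 : (0 < d)%N.
Local Notation y := (qs ^+ d).

Lemma qsX_small : exists2 r, regular0 r & y = qs * r.
Proof. by exists (qs ^+ d.-1); [exact: regular0_qsX | rewrite -exprS prednK]. Qed.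

Let y0 : y != 0. Proof. exact: (expf_neq0 _ qs_neq0). Qed.

Let ysq : y ^+ 2 = qs ^+ (d * 2). Proof. by rewrite exprM. Qed.
Let d2 : (0 < d * 2)%N. Proof. by rewrite muln_gt0 d0. Qed.

Let y1 : y - y^-1 != 0.
Proof.
apply: contraNneq (qsX_neq1 d2) => /eqP; rewrite subr_eq0 => /eqP yE.
by rewrite -ysq expr2 {1}yE (mulVf y0).
Qed.

Let y2 : 1 + y ^+ 2 != 0.
Proof.
have d4 : (0 < d * 2 * 2)%N by rewrite muln_gt0 d2.
apply: contraNneq (qsX_neq1 d4) => /eqP; rewrite addrC addr_eq0 => /eqP yE.
by rewrite exprM -ysq yE sqrrN expr1n.
Qed.

Lemma br2V_small : exists2 r, regular0 r & (br y 2)^-1 = qs * r.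
Proof.
have [-> _] := br2V y0 y1 y2; have [r rr yr] := qsX_small.
exists (r * (1 + y ^+ 2)^-1); last by rewrite mulrA -yr.
by apply: regular0M => //; rewrite ysq; exact: regular0_1DqsXV.
Qed.

(** The factor 1/y occurs at total weight 0, when e moves a first factor next to one of weight 1, or
    f a second factor next to one of weight -1. *)
Lemma br2V_one : exists2 r, regular0 r & (br y 2)^-1 / y - 1 = qs * r.
Proof.
have [_ ->] := br2V y0 y1 y2; have [r rr yr] := qsX_small.
exists (- (r * y * (1 + y ^+ 2)^-1)).
  apply/regular0N/regular0M; first by apply: regular0M => //; exact: regular0_qsX.
  by rewrite ysq; exact: regular0_1DqsXV.
by rewrite mulrN !mulrA -yr -expr2 mulNr.
Qed.

End CrystalCoefficients.

Section PairCrystal.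
Variables (t : affine_type) (n : nat) (M : vectType Qqs).
Hypothesis hn : (min_rank t <= n)%N.
Local Notation y i := (qi qs t n (nat_of_ord i)).
Implicit Types (z : mask n * mask n) (i : 'I_n.+1).
Variables (B : mask n * mask n -> M).
Hypothesis BB : basis_of fullv [seq B z | z : mask n * mask n].

Let L := blattice B.

Lemma congL_coef z (a a' r : Qqs) : regular0 r -> a - a' = qs * r ->
  congL L (a *: B z) (a' *: B z).
Proof.
move=> rr aE; exists (r *: B z).
split; last by rewrite -scalerBl aE scalerA.
move=> x; rewrite bcoordZ; apply: regular0M => //; exact: (blattice_b BB).
Qed.

Lemma pair_crystal_node i (e f : 'End(M)) : ~~ dia2_node t n i ->
  (forall z, e (B z) = ((oke t i z.1)%:R * y i ^ (- wm t i z.2)) *: B (fl t i z.1, z.2)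
       + (oke t i z.2)%:R *: B (z.1, fl t i z.2)) ->
  (forall z, f (B z) = (okf t i z.1)%:R *: B (fl t i z.1, z.2)
       + (y i ^ wm t i z.1 * (okf t i z.2)%:R) *: B (z.1, fl t i z.2)) ->
  crystal_node t B (@wt2 t n) i e f.
Proof.
move=> nd eE fE; have lin : (i <= n)%N by rewrite -ltnS.
pose oe := @oke t n i; pose of_ := @okf t n i; pose fi := @fl t n i.
(* The tensor product rule for crystals with φ and ε in {0, 1}: f~ moves the first factor if φ(z.1)
   > ε(z.2) and otherwise the second, e~ moves the first if φ(z.1) >= ε(z.2) and otherwise the
   second. *)
exists (fun z => if oe z.2 then (if of_ z.1 then None else Some (z.1, fi z.2))
                 else if oe z.1 then Some (fi z.1, z.2) else None),
       (fun z => if of_ z.1 then (if oe z.2 then None else Some (fi z.1, z.2))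
                 else if of_ z.2 then Some (z.1, fi z.2) else None).
have oefi m : oe (fi m) = of_ m by exact: (oke_fl hn).
have offi m : of_ (fi m) = oe m by exact: (okf_fl hn).
have fiK m : fi (fi m) = m by exact: flK.
split=> [[a c] [a' c']|[a c]] /=.
  split.
    case: ifP => fa.
      by case: ifP => // ec [<- <-]; rewrite ec oefi fa fiK.
    by case: ifP => // fc [<- <-]; rewrite oefi fc fa fiK.
  case: ifP => ec.
    by case: ifP => // fa [<- <-]; rewrite fa offi ec fiK.
  by case: ifP => // ea [<- <-]; rewrite offi ea ec fiK.
rewrite eE fE /kcoef ffunE (negPf nd) /= -/(oe a) -/(oe c) -/(of_ a) -/(of_ c) -/(fi a) -/(fi c).
have wa1 : oe a -> wm t i a = -1 by exact: (wm_oke hn).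
have wa2 : of_ a -> wm t i a = 1 by exact: (wm_okf hn).
have wc1 : oe c -> wm t i c = -1 by exact: (wm_oke hn).
have wc2 : of_ c -> wm t i c = 1 by exact: (wm_okf hn).
have wa0 : ~~ oe a -> ~~ of_ a -> wm t i a = 0.
  by rewrite /wm -/(oe a) -/(of_ a) => /negPf-> /negPf->.
have wc0 : ~~ oe c -> ~~ of_ c -> wm t i c = 0.
  by rewrite /wm -/(oe c) -/(of_ c) => /negPf-> /negPf->.
have xa : oe a -> of_ a -> false by exact: (oke_okf hn).
have xc : oe c -> of_ c -> false by exact: (oke_okf hn).
have [r rr yr] := qsX_small (dnorm_gt0 t lin).
have [s rs ys] := br2V_small (dnorm_gt0 t lin).
have [u ru yu] := br2V_one (dnorm_gt0 t lin).
have yr' : y i = qs * r by [].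
have ys' : (br (y i) 2)^-1 = qs * s by [].
have yu' : (br (y i) 2)^-1 / y i - 1 = qs * u by [].
move: (y i) yr' ys' yu' => Y {}yr {}ys {}yu.
have refl v : congL L v v by exact: congL_refl.
have small z (x w : Qqs) : regular0 w -> x = qs * w -> congL L (x *: B z) 0.
  by move=> rw xw; rewrite -(scale0r (B z)); apply: (congL_coef z rw); rewrite subr0.
have smallY z : congL L (Y *: B z) 0 by exact: (small z _ _ rr yr).
have small2 z : congL L ((br Y 2)^-1 *: B z) 0 by exact: (small z _ _ rs ys).
have near1 z : congL L ((br Y 2)^-1 *: (Y^-1 *: B z)) (B z).
  by rewrite scalerA -{2}(scale1r (B z)); exact: (congL_coef z ru yu).
have addY z v : congL L (Y *: B z + v) v.
  by have [w [Lw wE]] := smallY z; exists w; split=> //; rewrite addrK -wE subr0.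
case: (oe a) wa1 wa0 xa => wa1 wa0 xa; case: (of_ a) wa2 wa0 xa => wa2 wa0 xa;
  try (by have := xa isT isT);
case: (oe c) wc1 wc0 xc => wc1 wc0 xc; case: (of_ c) wc2 wc0 xc => wc2 wc0 xc;
  try (by have := xc isT isT);
rewrite ?(wa1 isT) ?(wa2 isT) ?(wa0 isT isT) ?(wc1 isT) ?(wc2 isT) ?(wc0 isT isT) /=
  ?opprK ?expr1z ?exprN1 ?oppr0 ?expr0z ?mul1r ?mulr1 ?mul0r ?mulr0 ?scale0r ?scale1r
  ?add0r ?addr0 ?scaler0;
split; rewrite /= ?[B (fi a, c) + _]addrC;
  first [exact: refl | exact: near1 | exact: small2 | exact: addY].
Qed.

Lemma pair_crystal_dia2 i (e f : 'End(M)) : dia2_node t n i ->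
  (forall z, e (B z) = (oke t i z.1 && oke t i z.2)%:R *: B (fl t i z.1, fl t i z.2)) ->
  (forall z, f (B z) = (okf t i z.1 && okf t i z.2)%:R *: B (fl t i z.1, fl t i z.2)) ->
  crystal_node t B (@wt2 t n) i e f.
Proof.
move=> d eE fE; have lin : (i <= n)%N by rewrite -ltnS.
apply: (@minuscule_crystal t n M _ B _ i e f
  (fun z => oke t i z.1 && oke t i z.2) (fun z => okf t i z.1 && okf t i z.2)
  (fun z => (fl t i z.1, fl t i z.2)) _ _ _ eE fE) => [[a c]|[a c]|[a c]|z] /=.
- by rewrite !flK.
- by rewrite !(okf_fl hn).
- by move=> /andP[o1 _] /andP[o2 _]; exact: (oke_okf hn lin o1 o2).
- by rewrite ffunE d.
Qed.

End PairCrystal.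

(** * The Fock space and its tensor square *)

(** An equality of predicates, so that [crystal_base] and [polarizable] can be rewritten along
    it. *)
Lemma fock_lattice_blattice n p (M : vectType Qqs) (F : fock_space n p M) :
  fock_lattice F = blattice (fockv F).
Proof.
apply: functional_extensionality => u; apply: propositional_extensionality.
exact: iff_sym (blatticeP (fk_basis F) u).
Qed.

Lemma Qqs_two_neq0 : (2%:R : Qqs) != 0.
Proof.
rewrite -(rmorph_nat (@tofrac {poly rat})) tofrac_eq0 -polyC_natr polyC_eq0.
by rewrite pnatr_eq0.
Qed.

(** * The weight of the vacuum *)

Section Vacuum.
Variables (t : affine_type) (n : nat).
Hypothesis hn : (min_rank t <= n)%N.

Definition mask0 : mask n := [ffun=> false].

Lemma fockv_mask0 (K : fieldType) (p : K) (M : vectType K) (F : fock_space n p M) :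
  fockv F mask0 = vac F.
Proof.
rewrite /fockv /psi_mono; elim: (enum 'I_n) => //= k s IHs.
by rewrite ffunE.
Qed.

Lemma wm_mask0 (i : 'I_n.+1) : wm t i mask0 = (i == ord_max)%:Z - (i == ord0)%:Z.
Proof.
have lin : (i <= n)%N by rewrite -ltnS.
rewrite (wmE hn) //.
have -> : wlin t n i (fun k => (occ mask0 k)%:Z) = 0.
  have o0 k : occ mask0 k = false by rewrite /occ; case: insubP => // j _ _; rewrite ffunE.
  by rewrite /wlin !o0 /=; do 2?case: ifP => _; try case: ifP.
by rewrite add0r addrC.
Qed.

Lemma varpinE (i : 'I_n.+1) : varpin t n i =
  (i == ord_max)%:Z * (if t is TypeAdagger then 2 else 1)
  - (i == ord0)%:Z * (if t is TypeAdagger then 1 else (comark t n n)%:Z).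
Proof.
have MnE (f : weight n) k : (f *+ k) i = f i * k%:Z by rewrite ffunMnE -mulr_natr natz.
by rewrite /varpin; case: (t) => /=; rewrite !ffunE ?MnE ?ffunE ?mulr1 //; ring.
Qed.

Lemma wt1_mask0 : diamond0 t <> Dia2 /\ diamondn t <> Dia2 -> wt1 t mask0 = varpin t n.
Proof.
case=> d0 dn; apply/ffunP => i; rewrite ffunE wm_mask0 varpinE.
have c1 : (comark t n n)%:Z = 1 /\ t <> TypeAdagger.
  by move: d0 dn; case: (t) => /= h1 h2; try (by case: h1); try (by case: h2);
    split=> //; rewrite ?eqxx ?leq_pred;
    first [by case: (n <= 1)%N | by case: (n == 0%N)].
by case: c1 => ->; case: (t) => // _; rewrite ?mulr1.
Qed.

Lemma wt2_mask0 (i : 'I_n.+1) : (kap t n i)%:Z * wt2 t (mask0, mask0) i =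
  ((i == ord_max)%:Z - (i == ord0)%:Z) * 2.
Proof. by rewrite (kap_wt2 hn) wm_mask0 mulr_natr. Qed.

Lemma wt2_mask0_no_dia2 : diamond0 t <> Dia2 /\ diamondn t <> Dia2 ->
  wt2 t (mask0, mask0) = varpin t n *+ 2.
Proof.
move=> d; rewrite mulr2n -(wt1_mask0 d); apply/ffunP => i.
rewrite [RHS]ffunE [wt1 t mask0 i]ffunE [LHS]ffunE.
case: ifP => //; rewrite /dia2_node; case: d => d0 dn.
by case/orP=> /andP[_]; case: diamond0 d0 => //; case: diamondn dn.
Qed.

(** Before rescaling, the weight is 2 (Λ_n - Λ_0); each end of kind (2) halves its coefficient. What
    remains is Λ_n - a_n^vee Λ_0, or 2 Λ_n - Λ_0 when only the end 0 is of kind (2). *)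
Lemma wt2_mask0_dia2 : diamond0 t = Dia2 \/ diamondn t = Dia2 ->
  wt2 t (mask0, mask0) = varpin t n.
Proof.
move=> d; apply/ffunP => i; have n1 := min_rank_gt1 hn.
have k0 : (kap t n i)%:Z != 0 by rewrite /kap.
apply: (mulfI k0); rewrite wt2_mask0 varpinE /kap /dia2_node.
rewrite -![i == _]val_eqE /=.
have c1 : (comark t n n)%:Z = if t is TypeC then 1 else if t is TypeAeven then 2
    else if t is TypeAodd then 2 else comark t n n.
  by case: (t) => //=; do ?case: ifP => //; lia.
rewrite c1; case: (t) d => [] /= []; rewrite ?eqxx //= => _;
  case: (eqVneq (i : nat) 0%N) => [->|i0]; try case: (eqVneq (i : nat) n) => [iN|iN];
  rewrite /= ?andbF ?andbT ?orbF; lia.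
Qed.

End Vacuum.

(** * The action on the tensor basis of the square *)

Section SquareAction.
Variables (K : fieldType) (q : K) (t : affine_type) (n : nat) (M : vectType K).
Hypotheses (q0 : q != 0) (qX : forall k, (0 < k)%N -> q ^+ k != 1).
Hypothesis two_neq0 : (2%:R : K) != 0.
Hypothesis hn : (min_rank t <= n)%N.
Variable F : fock_space n (qi q t n 1) M.
Local Notation y i := (qi q t n (nat_of_ord i)).

Let bB : basis_of fullv [seq fockv F m | m : mask n] := fk_basis F.

Lemma act2_eE (i : 'I_n.+1) z : act2_e q t F i (tb (fockv F) z) =
  if dia2_node t n i then
    (oke t i z.1 && oke t i z.2)%:R *: tb (fockv F) (fl t i z.1, fl t i z.2)
  else ((oke t i z.1)%:R * y i ^ (- wm t i z.2)) *: tb (fockv F) (fl t i z.1, z.2)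
       + (oke t i z.2)%:R *: tb (fockv F) (z.1, fl t i z.2).
Proof.
have lin : (i <= n)%N by rewrite -ltnS.
have n1 := min_rank_gt1 hn.
have sE m := spin_eE q0 qX two_neq0 hn F m lin.
case: (boolP (dia2_node t n i)) => d.
  have -> : act2_e q t F i = tens_lfun (spin_e F i) (spin_e F i).
    rewrite /act2_e /spin_e d; move: d; rewrite /dia2_node.
    case: (eqVneq (i : nat) 0%N) => [i0|i0] /=; last by move=> ->.
    have -> : (i == n :> nat) = false by rewrite i0; move: n1; clear; lia.
    by rewrite /= orbF => ->.
  by rewrite /tb tens_lfunE !sE tensZl tensZr scalerA -natrM mulnb.
have eE : spin_e F i = act1_e t F i by rewrite /spin_e (negPf d).
have -> : act2_e q t F i = tens_lfun (act1_e t F i) ((act1_t q t F i)^-1)%VF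
    + tens_lfun \1%VF (act1_e t F i).
  by move: d; rewrite /act2_e /dia2_node negb_or => /andP[/negPf-> /negPf->].
have y0 (m : mask n) : y i ^ wm t i m != 0 by exact: (expfz_neq0 _ (qi_neq0 t q0 i)).
have tV := tens_eigen_inverse bB y0 (fun m => @act1_tE _ _ t n M q0 hn F i m lin d).
rewrite add_lfunE /tb !tens_lfunE id_lfunE -eE !sE tV !tensZl !tensZr scalerA.
by rewrite invr_expz.
Qed.

Lemma act2_fE (i : 'I_n.+1) z : act2_f q t F i (tb (fockv F) z) =
  if dia2_node t n i then
    (okf t i z.1 && okf t i z.2)%:R *: tb (fockv F) (fl t i z.1, fl t i z.2)
  else (okf t i z.1)%:R *: tb (fockv F) (fl t i z.1, z.2)
       + (y i ^ wm t i z.1 * (okf t i z.2)%:R) *: tb (fockv F) (z.1, fl t i z.2).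
Proof.
have lin : (i <= n)%N by rewrite -ltnS.
have n1 := min_rank_gt1 hn.
have sE m := spin_fE q0 qX two_neq0 hn F m lin.
case: (boolP (dia2_node t n i)) => d.
  have -> : act2_f q t F i = tens_lfun (spin_f F i) (spin_f F i).
    rewrite /act2_f /spin_f d; move: d; rewrite /dia2_node.
    case: (eqVneq (i : nat) 0%N) => [i0|i0] /=; last by move=> ->.
    have -> : (i == n :> nat) = false by rewrite i0; move: n1; clear; lia.
    by rewrite /= orbF => ->.
  by rewrite /tb tens_lfunE !sE tensZl tensZr scalerA -natrM mulnb.
have fE : spin_f F i = act1_f t F i by rewrite /spin_f (negPf d).
have -> : act2_f q t F i = tens_lfun (act1_f t F i) \1%VF
    + tens_lfun (act1_t q t F i) (act1_f t F i).
  by move: d; rewrite /act2_f /dia2_node negb_or => /andP[/negPf-> /negPf->].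
rewrite add_lfunE /tb !tens_lfunE id_lfunE -fE !sE.
by rewrite (act1_tE q0 hn F _ lin d) !tensZl !tensZr scalerA.
Qed.

Lemma act2_tE (i : 'I_n.+1) z :
  act2_t q t F i (tb (fockv F) z) = y i ^ wt2 t z i *: tb (fockv F) z.
Proof.
have lin : (i <= n)%N by rewrite -ltnS.
have n1 := min_rank_gt1 hn.
case: (boolP (dia2_node t n i)) => d; last first.
  have -> : act2_t q t F i = tens_lfun (act1_t q t F i) (act1_t q t F i).
    by move: d; rewrite /act2_t /dia2_node negb_or => /andP[/negPf-> /negPf->].
  rewrite /tb tens_lfunE !(act1_tE q0 hn F _ lin d) tensZl tensZr scalerA.
  rewrite ffunE (negPf d) expfzDr //; exact: (qi_neq0 t q0 i).
(* At an end of kind (2) the weight is obtained from its double, which is affine in the two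
   occupation numbers. *)
have k2 := kap_wt2 hn z i; rewrite /kap d !(wmE hn) // /wlin in k2.
rewrite /act2_t; move: (d) k2; rewrite {1}/dia2_node.
case: (eqVneq (i : nat) 0%N) => [i0|i0].
  have -> : (i == n :> nat) = false by rewrite i0; move: n1; clear; lia.
  rewrite orbF /= => d2; rewrite d2.
  have -> : is_dia11 (diamond0 t) = false by case: diamond0 d2.
  move=> k2; have dd : dia2_node t n 0 by move: d; rewrite i0.
  rewrite scale_lfunE /tb tens_lfunE !(dia2_tE0 q0 hn F _ dd).
  rewrite tensZl tensZr !scalerA i0; congr (_ *: _).
  rewrite -[X in X * _]expr1z !qi_exprz -!(expfzDr _ _ q0).
  congr (q ^ _); rewrite -!mulrDr; congr (_ * _).
  move: k2; move: (wt2 t z i) (occ z.1 0) (occ z.2 0) => w a b; clear.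
  by case: a; case: b => /=; lia.
case: (eqVneq (i : nat) n) => [iN|iN] //= d2; rewrite d2.
have -> : is_dia11 (diamondn t) = false by case: diamondn d2.
move=> k2; have dd : dia2_node t n n by move: d; rewrite iN.
rewrite scale_lfunE /tb tens_lfunE !(dia2_tEn q0 hn F _ dd).
rewrite tensZl tensZr !scalerA iN; congr (_ *: _).
rewrite -exprN1 !qi_exprz -!(expfzDr _ _ q0).
congr (q ^ _); rewrite -!mulrDr; congr (_ * _).
move: k2; move: (wt2 t z i) (occ z.1 n.-1) (occ z.2 n.-1) => w a b; clear.
by case: a; case: b => /=; lia.
Qed.

End SquareAction.

(** * The two crystal bases *)

Section FockModules.
Variables (t : affine_type) (n : nat).
Hypothesis hn : (min_rank t <= n)%N.
Variables (M : vectType Qqs) (F : fock_space n (qi qs t n 1%N) M).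
Local Notation y i := (qi qs t n (nat_of_ord i)).

Let bB : basis_of fullv [seq fockv F m | m : mask n] := fk_basis F.
Let tB := tb_basis bB.

Lemma fock_crystal : diamond0 t <> Dia2 /\ diamondn t <> Dia2 ->
  exists rho : uq_rep qs t n M,
    [/\ acts_by rho (act1_t qs t F) (act1_e t F) (act1_f t F),
        semisimple rho,
        crystal_base rho (fock_lattice F) (fockv F),
        polarizable rho (fock_lattice F) (fockv F)
      & weight_vector rho (varpin t n) (vac F)].
Proof.
move=> d; have nd (i : 'I_n.+1) : ~~ dia2_node t n i.
  rewrite /dia2_node; case: d => d0 dn; apply/negP.
  by case/orP=> /andP[_]; case: diamond0 d0 => //; case: diamondn dn.
have le_n (i : 'I_n.+1) : (i <= n)%N by rewrite -ltnS.
have EE (i : 'I_n.+1) m : act1_e t F i (fockv F m) = (oke t i m)%:R *: fockv F (fl t i m).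
  have := spin_eE qs_neq0 qsX_neq1 Qqs_two_neq0 hn F m (le_n i).
  by rewrite /spin_e (negPf (nd i)).
have FE (i : 'I_n.+1) m : act1_f t F i (fockv F m) = (okf t i m)%:R *: fockv F (fl t i m).
  have := spin_fE qs_neq0 qsX_neq1 Qqs_two_neq0 hn F m (le_n i).
  by rewrite /spin_f (negPf (nd i)).
have sl := single_spin_like qs_neq0 qsX_neq1 hn bB nd EE FE.
have crys : crystal_graph t (fockv F) (@wt1 t n) (fun i => act1_e t F i) (fun i => act1_f t F i).
  move=> i; apply: (@minuscule_crystal t n M _ (fockv F) _ i _ _
    (oke t i) (okf t i) (fl t i) _ _ _ (EE i) (FE i)) => [m|m|m|m].
  - exact: flK.
  - exact: (okf_fl hn).
  - exact: (oke_okf hn).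
  - by rewrite ffunE.
have [rho [rho_h rho_ef ss cb pol]] := based_crystal_base bB sl crys.
exists rho; rewrite fock_lattice_blattice; split=> //.
- move=> i; have [-> ->] := rho_ef i; split=> //.
  apply: (lfun_bext bB) => m; rewrite rho_h qpair_tco ffunE.
  by rewrite (act1_tE qs_neq0 hn F m (le_n i) (nd i)).
- by move=> h; rewrite -fockv_mask0 rho_h (wt1_mask0 hn d).
Qed.

Lemma fock_square_crystal : exists rho : uq_rep qs t n (tsq M),
    [/\ acts_by rho (act2_t qs t F) (act2_e qs t F) (act2_f qs t F),
        semisimple rho,
        crystal_base rho (tens_lattice (fock_lattice F)) (fockv2 F),
        polarizable rho (tens_lattice (fock_lattice F)) (fockv2 F)
      & (diamond0 t <> Dia2 /\ diamondn t <> Dia2 ->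
           weight_vector rho (varpin t n *+ 2) (tens (vac F) (vac F))) /\
        (diamond0 t = Dia2 \/ diamondn t = Dia2 ->
           weight_vector rho (varpin t n) (tens (vac F) (vac F)))].
Proof.
have sl := pair_spin_like qs_neq0 qsX_neq1 hn tB
  (act2_eE qs_neq0 qsX_neq1 Qqs_two_neq0 hn F)
  (act2_fE qs_neq0 qsX_neq1 Qqs_two_neq0 hn F).
have crys : crystal_graph t (tb (fockv F)) (@wt2 t n)
    (fun i => act2_e qs t F i) (fun i => act2_f qs t F i).
  move=> i; have E := act2_eE qs_neq0 qsX_neq1 Qqs_two_neq0 hn F i.
  have E' := act2_fE qs_neq0 qsX_neq1 Qqs_two_neq0 hn F i.
  case: (boolP (dia2_node t n i)) => d.
    apply: (pair_crystal_dia2 hn d) => z.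
      by have := E z; rewrite d.
    by have := E' z; rewrite d.
  apply: (pair_crystal_node hn tB d) => z.
    by have := E z; rewrite (negPf d).
  by have := E' z; rewrite (negPf d).
have [rho [rho_h rho_ef ss cb pol]] := based_crystal_base tB sl crys.
have LE : tens_lattice (fock_lattice F) = blattice (tb (fockv F)).
  apply: functional_extensionality => w; apply: propositional_extensionality.
  by rewrite fock_lattice_blattice; exact: tens_blattice.
have vE : tens (vac F) (vac F) = tb (fockv F) (mask0 n, mask0 n).
  by rewrite /tb /= fockv_mask0.
exists rho; rewrite LE; split=> //.
- move=> i; have [-> ->] := rho_ef i; split=> //.
  by apply: (lfun_bext tB) => z; rewrite rho_h qpair_tco (act2_tE qs_neq0 hn).
- split=> d h; rewrite vE rho_h.
    by rewrite (wt2_mask0_no_dia2 hn d).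
  by rewrite (wt2_mask0_dia2 hn d).
Qed.

End FockModules.

Theorem proposition3p4 (t : affine_type) (n : nat) (hn : (min_rank t <= n)%N)
    (M : vectType Qqs) (F : fock_space n (qi qs t n 1%N) M) :
  (diamond0 t <> Dia2 /\ diamondn t <> Dia2 ->
     exists rho : uq_rep qs t n M,
       [/\ acts_by rho (act1_t qs t F) (act1_e t F) (act1_f t F),
           semisimple rho,
           crystal_base rho (fock_lattice F) (fockv F),
           polarizable rho (fock_lattice F) (fockv F)
         & weight_vector rho (varpin t n) (vac F)])
  /\
  exists rho : uq_rep qs t n (tsq M),
    [/\ acts_by rho (act2_t qs t F) (act2_e qs t F) (act2_f qs t F),
        semisimple rho,
        crystal_base rho (tens_lattice (fock_lattice F)) (fockv2 F),
        polarizable rho (tens_lattice (fock_lattice F)) (fockv2 F)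
      & (diamond0 t <> Dia2 /\ diamondn t <> Dia2 ->
           weight_vector rho (varpin t n *+ 2) (tens (vac F) (vac F))) /\
        (diamond0 t = Dia2 \/ diamondn t = Dia2 ->
           weight_vector rho (varpin t n) (tens (vac F) (vac F)))].
Proof.
split; [exact: (fock_crystal hn) | exact: (fock_square_crystal hn)].
Qed.
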